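(* Let $1<p<\infty$. Then the extremal problem $(P_p)$: find $F^*\in\mathcal{C}_p(E)$ such that $$\|F^{*\prime\prime}\|_p=\inf_{F\in\mathcal{C}_p(E)}\|F''\|_p ,$$ always has a unique solution $F^*\in\mathcal{C}_p(E)$.
   Context: Data and triangulation. Let $n\ge 3$ and let $P_i=(x_i,y_i,z_i)\in\mathbb{R}^3$, $i=1,\dots,n$, be points whose projections $V_i=(x_i,y_i)\in\mathbb{R}^2$ are pairwise different and not all on one line. A triangulation of $V_1,\dots,V_n$ is a collection of non-degenerate, non-overlapping triangles in the plane (two distinct triangles intersect, if at all, only in a common vertex or a common full edge) such that the set of all vertices of the triangles is exactly $\{V_1,\dots,V_n\}$. A triangulation $T$ is fixed. $D\subset\mathbb{R}^2$ is the union of the (closed) triangles of $T$ (in general a collection of polygons with holes), and $E$ is the set of edges of the triangles of $T$. The edge between $V_i$ and $V_j$ is denoted $e_{ij}$ or $e$, and $\|e\|$ is its Euclidean length. Curve networks. A curve network is a family $\{f_e\}_{e\in E}$ of real-valued univariate functions, $f_e$ being defined on the edge $e$, i.e. on $[0,\|e\|]$ via the arc-length parametrization of $e$. A function $F:D\to\mathbb{R}$ induces the curve network given for $e=e_{ij}$ by $$f_e(t)=F\Bigl(\bigl(1-\tfrac{t}{\|e\|}\bigr)x_i+\tfrac{t}{\|e\|}x_j,\ \bigl(1-\tfrac{t}{\|e\|}\bigr)y_i+\tfrac{t}{\|e\|}y_j\Bigr),\quad 0\le t\le\|e\| .$$ The direction in which an edge is parametrized is immaterial. Smooth interpolation curve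 networks. $\mathcal{F}_p$ is the set of functions $F:D\to\mathbb{R}$ with $F(x_i,y_i)=z_i$ for $i=1,\dots,n$, with $\partial F/\partial x,\ \partial F/\partial y\in C(D)$ (i.e. $F$ is differentiable relative to $D$ with gradient continuous on $D$), and such that for every $e\in E$ the function $f_e'$ is absolutely continuous on $[0,\|e\|]$ and $f_e''\in L_p[0,\|e\|]$. $\mathcal{C}_p(E)$ is the set of curve networks $\{f_e\}_{e\in E}$ induced on $E$ by functions $F\in\mathcal{F}_p$. Geometrically, the smoothness of such a network means that at every vertex $V_i$ the graphs of the $f_e$, for the edges $e$ incident to $V_i$, have a common tangent plane: there is $(a_i,b_i)\in\mathbb{R}^2$ such that for every edge $e$ at $V_i$ with unit direction vector $(u,v)$ pointing away from $V_i$, the derivative of $f_e$ at $V_i$ in that direction equals $a_iu+b_iv$. For a network $F=\{f_e\}_{e\in E}$, $F''=\{f_e''\}_{e\in E}$, and for a network $G=\{g_e\}_{e\in E}$, $\|G\|_p=\bigl(\sum_{e\in E}\int_0^{\|e\|}|g_e(t)|^p\,dt\bigr)^{1/p}$. *)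

(* Defs.v *)
(* Stated with MathComp-Analysis, over an abstract realType. *)
From HB Require Import structures.
From mathcomp Require Import all_boot all_order all_algebra.
From mathcomp Require Import all_classical all_reals all_analysis.
Import Order.TTheory GRing.Theory Num.Theory.
Import numFieldNormedType.Exports.

Set Implicit Arguments.
Unset Strict Implicit.
Unset Printing Implicit Defensive.

Local Open Scope classical_set_scope.
Local Open Scope ring_scope.

Section Triangulation.
Variables (R : realType) (n : nat) (V : 'I_n -> R * R).
Implicit Types (S t : {set 'I_n}) (T : {set {set 'I_n}}) (e : 'I_n * 'I_n).

Definition collinear S : Prop :=
  exists a b c : R, (a, b) != (0, 0) /\
    forall i, i \in S -> a * (V i).1 + b * (V i).2 = c.

(* The convex hull of the points V i, i \in S: a vertex, an edge or a closed
   triangle when #|S| is 1, 2 or 3. *)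
Definition hull S : set (R * R) :=
  [set w | exists a : 'I_n -> R,
     [/\ forall i, 0 <= a i, forall i, i \notin S -> a i = 0,
         \sum_i a i = 1 & w = \sum_i a i *: V i]].

(* Each triangle is given by the set of the indices of its vertices, which
   loses nothing when V is injective. *)
Definition triangulation T : Prop :=
  [/\ forall t, t \in T -> #|t| = 3%N /\ ~ collinear t,
      forall t1 t2, t1 \in T -> t2 \in T -> t1 != t2 ->
        [\/ hull t1 `&` hull t2 = set0,
            exists2 i, i \in t1 :&: t2 &
              hull t1 `&` hull t2 = hull [set i]%SET |
            exists i j, [/\ i != j, i \in t1 :&: t2, j \in t1 :&: t2 &
              hull t1 `&` hull t2 = hull [set i; j]%SET]] &
      forall i, exists2 t, t \in T & i \in t].

Definition triangulated_domain T : set (R * R) := [set w | exists2 t, t \in T & hull t w].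

(* Every edge is listed once, as the pair of the indices of its endpoints in
   increasing order. *)
Definition edges T : {set 'I_n * 'I_n} :=
  [set e : 'I_n * 'I_n | (e.1 < e.2)%N &&
     [exists t in T, (e.1 \in t) && (e.2 \in t)]]%SET.

Definition edge_length e : R :=
  Num.sqrt (((V e.2).1 - (V e.1).1) ^+ 2 + ((V e.2).2 - (V e.1).2) ^+ 2).

Definition edge_path e (s : R) : R * R :=
  (1 - s / edge_length e) *: V e.1 + (s / edge_length e) *: V e.2.

End Triangulation.

Section OneVariable.
Variable R : realType.
Implicit Types (a b : R) (f : R -> R).

(* The derivative of f relative to [a, b], hence one-sided at the endpoints.
   For s in [a, b] it only depends on f over [a, b]; its value is a junk one
   where the limit does not exist. *)
Definition derive_on a b f (s : R) : R :=
  lim ((f r - f s) / (r - s) @[r --> within `[a, b] s^']).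

Definition absolutely_continuous a b f : Prop :=
  forall eps : R, 0 < eps -> exists2 delta : R, 0 < delta &
    forall (m : nat) (u v : 'I_m -> R),
      (forall k, a <= u k <= v k /\ v k <= b) ->
      trivIset setT (fun k => `]u k, v k[%classic) ->
      \sum_k (v k - u k) < delta ->
      \sum_k `|f (v k) - f (u k)| < eps.

Definition in_Lp (p : R) a b f : Prop :=
  measurable_fun `[a, b] f /\
  (\int[lebesgue_measure]_(s in `[a, b]) (`|f s| `^ p)%:E < +oo)%E.

End OneVariable.

Section C1.
Variable R : realType.
Implicit Types (D : set (R * R)) (F : R * R -> R).

(* F (w') = F (w) + g . (w' - w) + o(|w' - w|) for w' -> w in D; at w \in D
   this g is unique when D is a union of non-degenerate triangles. *)
Definition has_gradient_on D F (w g : R * R) : Prop :=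
  forall eps : R, 0 < eps -> \forall w' \near within D (nbhs w),
    `|F w' - F w - (g.1 * (w'.1 - w.1) + g.2 * (w'.2 - w.2))|
      <= eps * `|w' - w|.

Definition C1_on D F : Prop :=
  exists2 g : R * R -> R * R, {within D, continuous g} &
    forall w, D w -> has_gradient_on D F w (g w).

End C1.

Section Networks.
Variables (R : realType) (n : nat) (V : 'I_n -> R * R) (z : 'I_n -> R).
Variables (T : {set {set 'I_n}}) (p : R).

(* A curve network {f_e} is represented by total functions; only the values
   f e s for e an edge and 0 <= s <= edge_length V e are relevant, and networks
   are compared by network_eq. *)
Definition network := 'I_n * 'I_n -> R -> R.
Implicit Types f g : network.

Definition network_eq f g : Prop :=
  forall e, e \in edges T ->
    forall s, 0 <= s <= edge_length V e -> f e s = g e s.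

Definition induced_network (F : R * R -> R) : network :=
  fun e s => F (edge_path V e s).

Definition network_derive f : network :=
  fun e => derive_on 0 (edge_length V e) (f e).

Definition network_derive2 f : network := network_derive (network_derive f).

Definition network_norm g : \bar R :=
  ((\sum_(e in edges T)
      \int[lebesgue_measure]_(s in `[0%R, edge_length V e])
        (`|g e s| `^ p)%:E) `^ p^-1)%E.

Definition interpolants : set (R * R -> R) :=
  [set F | [/\ forall i, F (V i) = z i,
               C1_on (triangulated_domain V T) F &
               forall e, e \in edges T ->
                 absolutely_continuous 0 (edge_length V e)
                   (network_derive (induced_network F) e) /\
                 in_Lp p 0 (edge_length V e)
                   (network_derive2 (induced_network F) e)]].

Definition interpolation_networks : set network :=
  [set f | exists2 F, interpolants F & network_eq f (induced_network F)].

Definition extremal_solution f : Prop :=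
  interpolation_networks f /\
  network_norm (network_derive2 f) =
    ereal_inf [set network_norm (network_derive2 g)
              | g in interpolation_networks].

End Networks.

(* Main.v *)
(* The direct method is run on the dual side, where it is finite dimensional.

   A minimiser must have second derivatives f_e'' = phi(l_e), with l_e affine on
   e and phi(x) = sgn(x) |x|^(q-1), q = p/(p-1), the multiplier (l_e) being
   annihilated by every network whose vertex values vanish.  Such multipliers
   form a finite dimensional space W.  Minimising over W the strictly coercive
   function (1/q) sum_e int |l_e|^q - <l, data> yields a multiplier for which
   the phi(l_e) have the moments of a network with common tangent planes at the
   vertices.  The pointwise tangent inequality
   |h|^p >= |phi(l)|^p + p l (h - phi(l)), strict for h <> phi(l), then gives
   both optimality and uniqueness, because int l_e f_e'' only depends on the
   values and gradients of f at the vertices.  This integration by parts is the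
   Lebesgue fundamental theorem of calculus for absolutely continuous functions:
   total variation reduces it to nondecreasing functions, whose Stieltjes
   measure is dominated by the Lebesgue measure, so that the Radon-Nikodym and
   Lebesgue differentiation theorems apply.

   A network with prescribed tangent planes extends to a C^1 function on the
   whole plane, irrespective of the triangles: a function P interpolates values
   and gradients at the vertices, and each residual r_e = f_e - P is carried by
   a lens c s (L - s) >= |t| around the edge e, in the coordinates (s, t) of e,
   which for small c avoids all the other edges. *)
Require Import Defs.
From mathcomp Require Import all_boot all_order all_algebra.
From mathcomp Require Import all_classical all_reals all_analysis.
From HB Require Import structures.
From mathcomp Require Import measurable_realfun ring lra.
Import Order.TTheory GRing.Theory Num.Theory.
Import numFieldNormedType.Exports.
Set Implicit Arguments.
Unset Strict Implicit.
Unset Printing Implicit Defensive.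
Local Open Scope classical_set_scope.
Local Open Scope ring_scope.

(** * Absolutely continuous functions *)

Section AbsoluteContinuity.
Variable R : realType.
Implicit Types (a b : R) (f : R -> R) (S : seq (R * R)).

(** Passing to the dual avoids weak compactness in L_p. A function with given second derivative, end
    values and end slopes exists on an edge exactly when two moments of the second derivative,
    against 1 - t/L and t/L, have prescribed values. Edges interact only through the vertex
    gradients, on which these values depend linearly. So finitely many linear conditions describe
    the admissible second derivatives, and the multiplier has two unknowns per edge, its end values.
    The gradients of the minimiser are not known beforehand: they come out as Lagrange multipliers
    of the constraint defining W. A second obstacle is that f_e' is merely absolutely continuous,
    while [derive_on] returns an arbitrary value where its limit fails to exist. Second derivatives
    are thus controlled almost everywhere only, and a competitor is compared with the minimiser
    through integrals; uniqueness recovers the network from second derivatives agreeing almost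
    everywhere and from the vertex values. *)

Definition nonoverlap (x y : R * R) := (x.2 <= y.1) || (y.2 <= x.1).

(** Lists make it possible to replace an interval by the pieces of a partition, by concatenation.
    Adjacent and degenerate intervals are allowed, but not a point strictly inside another
    interval. *)
Definition itv_system S := all (fun x => x.1 <= x.2) S && pairwise nonoverlap S.

Definition total_length S := \sum_(x <- S) (x.2 - x.1).

Definition total_increment f S := \sum_(x <- S) `|f x.2 - f x.1|.

(** Stated on the whole line, to which a function on [a, b] is extended by constants through
    [clamp]; the weak inequality survives the suprema of total variation. *)
Definition ac_on_systems f := forall eps : R, 0 < eps ->
  exists2 delta : R, 0 < delta &
    forall S, itv_system S -> total_length S < delta -> total_increment f S <= eps.

Definition clamp a b (x : R) := Num.max a (Num.min b x).

Lemma clamp_homo a b : {homo clamp a b : x y / x <= y}.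
Proof.
move=> x y xy; rewrite /clamp ge_max !le_max lexx/=.
by rewrite le_min !ge_min lexx xy !orbT.
Qed.

Lemma clamp_bound a b x : a <= b -> a <= clamp a b x <= b.
Proof. by move=> ab; rewrite /clamp le_max lexx ge_max ab ge_min lexx. Qed.

Lemma clamp_id a b x : a <= x <= b -> clamp a b x = x.
Proof. by move=> /andP[ax xb]; rewrite /clamp min_r // max_r. Qed.

Lemma clamp_le a b x : a <= b -> x <= a -> clamp a b x = a.
Proof. by move=> ab xa; rewrite /clamp (min_r (le_trans xa ab)) max_l. Qed.

Lemma clamp_lip a b x y : a <= b -> x <= y -> clamp a b y - clamp a b x <= y - x.
Proof.
move=> ab xy; rewrite /clamp.
by case: (leP b x) => ?; case: (leP b y) => ?; case: (leP a b) => ?;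
  try (case: (leP a x) => ?); try (case: (leP a y) => ?); lra.
Qed.

Lemma total_increment_ge0 f S : 0 <= total_increment f S.
Proof. exact: sumr_ge0. Qed.

Lemma ac_on_systems_clamp a b f : a <= b ->
  absolutely_continuous a b f -> ac_on_systems (f \o clamp a b).
Proof.
move=> ab acf eps e0; have [d d0 H] := acf _ e0; exists d => // S.
move=> /andP[/allP Sle Snon] Sd.
pose u (k : 'I_(size S)) := clamp a b (tnth (in_tuple S) k).1.
pose v (k : 'I_(size S)) := clamp a b (tnth (in_tuple S) k).2.
have tin k : tnth (in_tuple S) k \in S by rewrite mem_tnth.
rewrite /total_increment big_tnth; apply: ltW; apply: (H _ u v).
- move=> k; rewrite clamp_homo ?Sle// andbT.
  by have /andP[-> _] := clamp_bound (tnth (in_tuple S) k).1 ab;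
     have /andP[_ ->] := clamp_bound (tnth (in_tuple S) k).2 ab.
- have noI (i j : 'I_(size S)) : (i < j)%N ->
      `]u i, v i[%classic `&` `]u j, v j[%classic = set0.
    move=> ij; apply/seteqP; split => // x [] /=.
    rewrite !in_itv/= => /andP[ux xv] /andP[ux' xv'].
    have /orP[le|le] : nonoverlap (tnth (in_tuple S) i) (tnth (in_tuple S) j).
      rewrite !(tnth_nth (0, 0))/=.
      by move/pairwiseP : Snon => /(_ (0,0)); apply; rewrite ?inE.
    + have := lt_trans ux' xv; rewrite ltNge => /negP; apply.
      exact: clamp_homo.
    + have := lt_trans ux xv'; rewrite ltNge => /negP; apply.
      exact: clamp_homo.
  apply/trivIsetP => i j _ _; rewrite neq_ltn => /orP[/noI//|/noI].
  by rewrite setIC.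
- apply: le_lt_trans Sd; rewrite /total_length [leRHS]big_tnth.
  by apply: ler_sum => k _; rewrite clamp_lip ?Sle.
Qed.

Definition pieces := pairmap (fun x y : R => (x, y)).

Lemma variation_pieces a b f s : itv_partition a b s ->
  variation a b f s = total_increment f (pieces a s).
Proof.
elim: s a b => // [a b|h t ih a b].
  by move=> [_ _]; rewrite /variation /total_increment !big_nil.
rewrite /itv_partition /variation => -[]/= /andP[ah ht] /eqP htb.
rewrite big_nat_recl//= /total_increment big_cons/=; congr +%R.
have /ih : itv_partition h b t by split => //; exact/eqP.
by rewrite /variation /total_increment => <-.
Qed.

Lemma pieces_system a b s : itv_partition a b s ->
  [/\ itv_system (pieces a s), total_length (pieces a s) = b - a
    & {in pieces a s, forall x, a <= x.1 /\ x.2 <= b}].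
Proof.
elim: s a => [a /itv_partition_nil ->|h t ih a p].
  by rewrite /total_length big_nil subrr.
have /= [/andP[ah _] _] := p.
have pt := itv_partition_cons p.
have [/andP[s1 s2] l inn] := ih _ pt.
split.
- rewrite /itv_system/= (ltW ah)/= s1 s2 andbT; apply/allP => x /inn[hx _].
  by rewrite /nonoverlap/= hx.
- by rewrite /total_length big_cons/= -/(total_length _) l; ring.
- move=> x; rewrite inE => /predU1P[->/=|/inn[hx xb]].
    by split => //; exact: itv_partition_le pt.
  by split => //; rewrite (le_trans (ltW ah)).
Qed.

Lemma nonoverlapC x y : nonoverlap x y = nonoverlap y x.
Proof. by rewrite /nonoverlap orbC. Qed.

Lemma nonoverlap_sub x y z : z.1 <= x.1 -> x.2 <= z.2 ->
  nonoverlap z y -> nonoverlap x y.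
Proof.
by move=> zx xz /orP[h|h]; rewrite /nonoverlap; [rewrite (le_trans xz h)|
  rewrite (le_trans h zx) orbT].
Qed.

Lemma itv_system_refine x S s : itv_system (x :: S) ->
  itv_partition x.1 x.2 s -> itv_system (pieces x.1 s ++ S) /\
  total_length (pieces x.1 s ++ S) = total_length (x :: S).
Proof.
rewrite {1}/itv_system/= => /andP[/andP[x12 S1]] /andP[xS S2] p.
have [/andP[p1 p2] pl pin] := pieces_system p.
split; last by rewrite /total_length big_cat big_cons/=; congr +%R.
rewrite /itv_system all_cat p1 S1 pairwise_cat p2 S2 !andbT/=.
apply/allrelP => y z yp zS; have [l r] := pin _ yp.
by apply: (nonoverlap_sub l r); move/allP : xS => /(_ _ zS).
Qed.

Lemma itv_system_perm S1 S2 : perm_eq S1 S2 -> itv_system S1 -> itv_system S2.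
Proof.
move=> p /andP[S1le S1p]; rewrite /itv_system -(perm_all _ p) S1le/=.
elim: S1 S2 p {S1le} S1p => [S2|x S1 ih S2 p].
  by rewrite perm_sym => /perm_nilP ->.
rewrite /= => /andP[xS1 S1p].
have xS2 : x \in S2 by rewrite -(perm_mem p) mem_head.
have /rot_to[i S' e] := xS2.
have S'p : perm_eq S1 S'.
  by rewrite -(perm_cons x); rewrite (perm_trans p)// -e perm_sym perm_rot.
have : pairwise nonoverlap (drop i S2 ++ take i S2).
  move: e; rewrite /rot => ->/=; rewrite ih// andbT.
  by rewrite -(perm_all _ S'p).
rewrite pairwise_cat => /and3P[a1 a2 a3].
rewrite -(cat_take_drop i S2) pairwise_cat a2 a3 !andbT.
by rewrite allrelC; apply: sub_allrel a1 => y z; rewrite nonoverlapC.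
Qed.

Lemma sub_itv_system S1 S2 : itv_system (S1 ++ S2) -> itv_system S2.
Proof.
by rewrite /itv_system all_cat pairwise_cat => /andP[/andP[_ ->] /and3P[_ _ ->]].
Qed.

Local Notation TV := (@total_variation R).

(** Each interval of S1 is replaced in turn by an arbitrary partition, whose pieces move into S2;
    length and nonoverlap are preserved, so the bound on increments still applies. The induction
    carries S2 so that one supremum is taken at a time. *)
Lemma total_variation_system f (eps delta : R) S1 S2 :
  (forall S, itv_system S -> total_length S < delta -> total_increment f S <= eps) ->
  itv_system (S1 ++ S2) -> total_length (S1 ++ S2) < delta ->
  (\sum_(x <- S1) TV x.1 x.2 f + (total_increment f S2)%:E <= eps%:E)%E.
Proof.
move=> H; elim: S1 S2 => [S2 /= s l|x S1 ih S2 s l].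
  by rewrite big_nil add0e lee_fin H.
have s0 : all (fun x : R * R => x.1 <= x.2) (x :: S1).
  by move: s; rewrite /itv_system all_cat => /andP[/andP[-> _] _].
have rest_ge0 : (0 <= \sum_(y <- S1) TV y.1 y.2 f)%E.
  rewrite big_seq; apply: sume_ge0 => y yS; apply: total_variation_ge0.
  by move: s0 => /= /andP[_ /allP]; exact.
have st : itv_system (S1 ++ S2) by apply: (@sub_itv_system [:: x]).
have x12 : x.1 <= x.2 by move: s0 => /= /andP[].
have lt' : total_length (S1 ++ S2) < delta.
  by apply: le_lt_trans l; rewrite /total_length big_cons lerDr subr_ge0.
have rest_le := ih _ st lt'.
(* Finiteness lets these terms cross the inequality before the supremum for [x] is taken. *)
have rest_fin : (\sum_(y <- S1) TV y.1 y.2 f + (total_increment f S2)%:E)%E \is a fin_num.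
  rewrite ge0_fin_numE; first by apply: le_lt_trans rest_le _; rewrite ltry.
  by rewrite adde_ge0// lee_fin total_increment_ge0.
rewrite big_cons -addeA -leeBrDr//.
apply: ge_ereal_sup => _ [_ [p pp <-] <-].
rewrite leeBrDr// (variation_pieces _ pp).
have [sp lp] := itv_system_refine s pp.
have perm : perm_eq (pieces x.1 p ++ S1 ++ S2) (S1 ++ (pieces x.1 p ++ S2)).
  by rewrite perm_catCA.
rewrite addeCA -EFinD.
have -> : total_increment f (pieces x.1 p) + total_increment f S2 =
  total_increment f (pieces x.1 p ++ S2) by rewrite /total_increment big_cat.
apply: ih; first exact: itv_system_perm perm sp.
by rewrite /total_length -(perm_big _ perm) -/(total_length _) lp.
Qed.

End AbsoluteContinuity.

(** * Variation functions and Stieltjes measures of absolutely continuous functions *)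

Section TotalVariationAC.
Variable R : realType.
Implicit Types (a b : R) (f : R -> R) (S : seq (R * R)).
Local Notation TV := (@total_variation R).

Lemma clamp_system a b S : a <= b -> itv_system S ->
  itv_system [seq (clamp a b x.1, clamp a b x.2) | x <- S] /\
  total_length [seq (clamp a b x.1, clamp a b x.2) | x <- S] <= total_length S.
Proof.
move=> ab /andP[/allP Sle Sno]; split.
  apply/andP; split; first by apply/allP => _ /mapP[x xS ->]/=; rewrite clamp_homo ?Sle.
  rewrite pairwise_map; apply: sub_pairwise Sno => x y /=.
  by rewrite /nonoverlap/= => /orP[] /(@clamp_homo _ a b) -> //; rewrite orbT.
rewrite /total_length big_map big_seq [leRHS]big_seq; apply: ler_sum => x xS/=.
by rewrite clamp_lip ?Sle.
Qed.

Lemma total_variation_lty f a b : a < b -> ac_on_systems f -> (TV a b f < +oo)%E.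
Proof.
move=> ab /(_ 1 ltr01)[d d0 H].
(* Subintervals shorter than the modulus for eps = 1 have variation at most 1 each. *)
have [N Nd] : exists N : nat, (b - a) / N.+1%:R < d.
  exists (Num.bound ((b - a) / d)).
  rewrite ltr_pdivrMr// mulrC -ltr_pdivrMr//.
  apply: lt_le_trans (archimedean.Num.Theory.archi_boundP _) _.
    by rewrite divr_ge0// ?subr_ge0 ltW.
  by rewrite ler_nat.
set h := (b - a) / N.+1%:R in Nd.
have h0 : 0 < h by rewrite divr_gt0// subr_gt0.
have le_ah k : a <= a + h *+ k by rewrite lerDl mulrn_wge0// ltW.
have step k : (TV (a + h *+ k)%R (a + h *+ k.+1)%R f <= 1)%E.
  have := @total_variation_system _ f 1 d [:: (a + h *+ k, a + h *+ k.+1)] [::] H.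
  rewrite /= big_cons big_nil adde0 /total_increment big_nil adde0; apply.
    by rewrite /itv_system/= andbT mulrSr addrA lerDl ltW.
  by rewrite /total_length/= big_cons big_nil/= addr0 mulrSr; move: Nd; lra.
have TVk k : (TV a (a + h *+ k)%R f <= k%:R%:E)%E.
  elim: k => [|k ih]; first by rewrite mulr0n addr0 total_variationxx.
  rewrite (total_variationD _ (le_ah k)); last by rewrite mulrSr addrA lerDl ltW.
  by rewrite -natr1 EFinD leeD.
have <- : a + h *+ N.+1 = b.
  by rewrite -mulr_natr /h divfK ?pnatr_eq0//; ring.
by apply: le_lt_trans (TVk _) _; rewrite ltry.
Qed.

Section variation_function.
Variables (f : R -> R) (a b : R).
Hypotheses (ab : a < b) (acf : ac_on_systems f).

Definition variation_fun x := fine (TV a (clamp a b x) f).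

Let TVfin u v : a <= u -> u <= v -> v <= b -> TV u v f \is a fin_num.
Proof.
move=> au uv vb; rewrite ge0_fin_numE ?total_variation_ge0//.
apply: le_lt_trans (total_variation_lty ab acf).
rewrite (total_variationD f au (le_trans uv vb)) (total_variationD f uv vb).
rewrite addeA (le_trans _ (leeDl _ _))// ?total_variation_ge0//.
by rewrite leeDr// total_variation_ge0.
Qed.

Lemma variation_funB u v : u <= v ->
  (variation_fun v - variation_fun u)%:E = TV (clamp a b u) (clamp a b v) f.
Proof.
move=> uv; have /andP[au ub] := clamp_bound u (ltW ab).
have /andP[av vb] := clamp_bound v (ltW ab).
have cuv : clamp a b u <= clamp a b v by exact: clamp_homo.
rewrite EFinB /variation_fun !fineK ?TVfin//.
by rewrite (total_variationD f au cuv) addeAC subee ?add0e ?TVfin.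
Qed.

Lemma variation_fun_ge u v : u <= v ->
  `|f (clamp a b v) - f (clamp a b u)| <= variation_fun v - variation_fun u.
Proof.
move=> uv; rewrite -lee_fin variation_funB//.
by rewrite total_variation_ge// clamp_homo.
Qed.

Lemma variation_fun_homo : {homo variation_fun : x y / x <= y}.
Proof.
by move=> x y xy; rewrite -subr_ge0 (le_trans _ (variation_fun_ge xy)).
Qed.

(** An increment of [variation_fun] is a total variation of f, so [total_variation_system] applies
    to the clamped system, with S2 empty. *)
Lemma variation_fun_ac : ac_on_systems variation_fun.
Proof.
move=> eps e0; have [d d0 H] := acf e0; exists d => // S sysS Sd.
have [s' l'] := clamp_system (ltW ab) sysS.
have := @total_variation_system _ f eps d
  [seq (clamp a b x.1, clamp a b x.2) | x <- S] [::] H.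
rewrite cats0 => /(_ s' (le_lt_trans l' Sd)).
rewrite big_map /total_increment big_nil adde0 -lee_fin; apply: le_trans.
rewrite -sumEFin big_seq [leRHS]big_seq; apply: lee_sum => x xS/=.
have x12 : x.1 <= x.2 by case/andP: sysS => /allP/(_ _ xS).
by rewrite -variation_funB// ger0_norm// subr_ge0 variation_fun_homo.
Qed.

End variation_function.

Lemma ac_on_systemsB f g : ac_on_systems f -> ac_on_systems g ->
  ac_on_systems (f \- g).
Proof.
move=> acf acg e e0; have e20 : 0 < e / 2 by rewrite divr_gt0.
have [d1 d10 H1] := acf _ e20; have [d2 d20 H2] := acg _ e20.
exists (Num.min d1 d2); first by rewrite lt_min d10.
move=> S sS; rewrite lt_min => /andP[S1 S2].
rewrite (splitr e); apply: le_trans (lerD (H1 _ sS S1) (H2 _ sS S2)).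
rewrite /total_increment -big_split/=; apply: ler_sum => x _.
have -> : (f \- g) x.2 - (f \- g) x.1 = f x.2 - f x.1 - (g x.2 - g x.1).
  by rewrite /=; ring.
exact: ler_normB.
Qed.

Lemma ac_on_systems_continuous f : ac_on_systems f -> continuous f.
Proof.
move=> acf x; apply/cvgrPdist_le => e e0; have [d d0 H] := acf _ e0.
near=> y.
have yx : `|x - y| < d by near: y; exact: cvgr_dist_lt.
have [xy|yx'] := leP x y.
- have := H [:: (x, y)].
  rewrite /itv_system/= xy /total_length /total_increment !big_cons !big_nil/= !addr0.
  by move=> /(_ isT); rewrite distrC; apply; move: yx; rewrite distrC ger0_norm// subr_ge0.
- have := H [:: (y, x)].
  rewrite /itv_system/= (ltW yx') /total_length /total_increment !big_cons !big_nil/= !addr0.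
  by move=> /(_ isT); apply; move: yx; rewrite gtr0_norm// subr_gt0.
Unshelve. all: by end_near. Qed.

(** Boundedness makes the end points of each component real; an empty component of the enumeration
    is recorded as ]0, 0[. *)
Lemma bounded_open_components (U : set R) (m M : R) : open U -> U `<=` `]m, M[ ->
  exists u v : nat -> R, [/\ forall k, u k <= v k,
    trivIset setT (fun k => `]u k, v k[%classic) & U = \bigcup_k `]u k, v k[%classic].
Proof.
move=> oU UmM.
have comp k : exists uv : R * R, uv.1 <= uv.2 /\ open_disjoint_itv oU k = `]uv.1, uv.2[%classic.
  set I := open_disjoint_itv oU k.
  have IU : I `<=` U.
    by rewrite [X in _ `<=` X](open_disjoint_itv_bigcup oU); exact: bigcup_sup.
  have [I0|/set0P I0] := eqVneq I set0.
    by exists (0, 0); split => //=; rewrite I0 set_itvoo0.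
  have lb : has_lbound I.
    by exists m => x /IU /UmM/=; rewrite in_itv/= => /andP[/ltW].
  have ub : has_ubound I.
    by exists M => x /IU /UmM/=; rewrite in_itv/= => /andP[_ /ltW].
  have := interval_bounded_interior (@open_disjoint_itv_is_interval _ _ oU k) lb ub.
  rewrite (interior_id I).1; last exact: open_disjoint_itv_open.
  move=> Ie; exists (inf I, sup I); split => //=.
  have [x Ix] := I0.
  by apply: (@le_trans _ _ x); [exact: ge_inf|exact: ub_le_sup].
have [uv H] := choice comp.
have e : open_disjoint_itv oU = fun k => `](uv k).1, (uv k).2[%classic.
  by apply/funext => k; have [] := H k.
exists (fun k => (uv k).1), (fun k => (uv k).2); split.
- by move=> k; have [] := H k.
- by rewrite -e; exact: open_disjoint_itv_trivIset.
- by rewrite -e; exact: open_disjoint_itv_bigcup.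
Qed.

Local Notation mu := (@lebesgue_measure R).

(** By outer regularity N lies in a bounded open set U of small Lebesgue measure. Finitely many
    components of U form a system of small length, over which F grows little; countable
    subadditivity then bounds the Stieltjes measure of U. *)
Lemma stieltjes_null (F : cumulative R R) (m M : R) (N : set R) :
  ac_on_systems F -> measurable N -> N `<=` `]m, M[ -> mu N = 0%E ->
  lebesgue_stieltjes_measure F N = 0%E.
Proof.
move=> acF mN NmM N0.
apply/eqP; rewrite -measure_le0; apply/lee_addgt0Pr => e e0; rewrite add0e.
have [d d0 H] := acF _ e0.
have [U0 [oU0 NU0 U0d]] : exists U : set R, [/\ open U, N `<=` U & (mu (U `\` N) < d%:E)%E].
  by apply: lebesgue_regularity_outer => //; change (mu N < +oo)%E; rewrite N0 ltry.
pose U := U0 `&` `]m, M[%classic.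
have oU : open U by apply: openI => //; exact: interval_open.
have mU : measurable U by exact: open_measurable.
have mU0 : measurable U0 by exact: open_measurable.
have NU : N `<=` U by move=> x Nx; split; [exact: NU0|exact: NmM].
have Ud : (mu U < d%:E)%E.
  apply: le_lt_trans U0d.
  apply: (@le_trans _ _ (mu U0)); first by apply: le_measure; rewrite ?inE//; exact: subIsetl.
  have -> : mu U0 = (mu N + mu (U0 `\` N))%E.
    by rewrite -measureU ?setDUK ?setDIK//; exact: measurableD.
  by rewrite N0 add0e.
have [|u [v [uv tri Ue]]] := @bounded_open_components U m M oU; first exact: subIsetr.
have mI k : measurable (`]u k, v k[%classic : set R) by [].
have muI k : lebesgue_measure (`]u k, v k[%classic : set R) = (v k - u k)%:E.
  rewrite lebesgue_measure_itv/= lte_fin EFinB.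
  by case: ltP => // vu; rewrite -EFinB (le_anti (introT andP (conj (uv k) vu))) subrr.
have muU : mu U = (\sum_(0 <= k <oo) (v k - u k)%:E)%E.
  rewrite Ue measure_bigcup//.
  by rewrite eseries_mkcond; apply: eq_eseriesr => k _; rewrite in_setT; exact: muI.
apply: (@le_trans _ _ (lebesgue_stieltjes_measure F U)).
  by apply: le_measure; rewrite ?inE.
apply: (@le_trans _ _ (\sum_(0 <= k <oo) lebesgue_stieltjes_measure F `]u k, v k[%classic)%E).
  by rewrite Ue; apply: measure_sigma_subadditive => //; apply: bigcup_measurable.
have Fle k : (lebesgue_stieltjes_measure F `]u k, v k[%classic <= (F (v k) - F (u k))%:E)%E.
  have -> : (F (v k) - F (u k))%:E = lebesgue_stieltjes_measure F `]u k, v k]%classic.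
    rewrite /lebesgue_stieltjes_measure /measure_extension measurable_mu_extE/=; last exact: is_ocitv.
    by rewrite wlength_itv_bnd.
  apply: le_measure; rewrite ?inE//.
  exact: subset_itv_oo_oc.
apply: (@le_trans _ _ (\sum_(0 <= k <oo) (F (v k) - F (u k))%:E)%E).
  by apply: lee_nneseries.
apply: lime_le.
  by apply: is_cvg_nneseries => n _ _; rewrite lee_fin subr_ge0 cumulative_is_nondecreasing.
apply: nearW => n.
(* Degenerate components are dropped: such a point could lie strictly inside another interval, which
   [nonoverlap] forbids. They contribute nothing to the sums. *)
pose S := [seq (u k, v k) | k <- iota 0 n & u k < v k].
have Ssum (G : R -> R) : \sum_(x <- S) (G x.2 - G x.1) = \sum_(0 <= k < n) (G (v k) - G (u k)).
  rewrite big_map big_filter [RHS](bigID (fun k => u k < v k))/= [X in _ = _ + X]big1 ?addr0.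
    by rewrite /index_iota subn0.
  move=> k; rewrite -leNgt => vu.
  by rewrite (le_anti (introT andP (conj (uv k) vu))) subrr.
have SF : total_increment F S = \sum_(0 <= k < n) (F (v k) - F (u k)).
  rewrite -Ssum; apply: eq_big_seq => x /mapP[k _ ->]/=.
  by rewrite ger0_norm// subr_ge0 cumulative_is_nondecreasing.
rewrite sumEFin lee_fin -SF; apply: H.
- apply/andP; split; first by apply/allP => x /mapP[k _ ->]/=.
  rewrite pairwise_map.
  have : pairwise (fun i j => i != j) [seq k <- iota 0 n | u k < v k].
    by rewrite -uniq_pairwise filter_uniq// iota_uniq.
  apply: (@sub_in_pairwise _ (fun k => u k < v k)); last exact: filter_all.
  move=> i j ui uj ij; rewrite /nonoverlap/=; apply: contraT.
  rewrite negb_or -!ltNge => /andP[h1 h2].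
  have /trivIsetP/(_ i j Logic.I Logic.I ij) := tri.
  (* Overlapping open intervals share the midpoint of their intersection. *)
  move=> /seteqP[/(_ ((Num.max (u i) (u j) + Num.min (v i) (v j))/2)) + _].
  have ui' : u i < v i := ui.
  have uj' : u j < v j := uj.
  case; split => /=; rewrite in_itv/=; apply/andP; split;
    case: (leP (u i) (u j)) => ?; case: (leP (v i) (v j)) => ?; lra.
- rewrite -lte_fin /total_length (Ssum id).
  apply: le_lt_trans Ud; rewrite muU -sumEFin.
  apply: nneseries_lim_ge => k _ _; rewrite lee_fin subr_ge0//.
Qed.

End TotalVariationAC.

(** * The Lebesgue fundamental theorem of calculus *)

Section LebesgueFTC.
Variable R : realType.
Implicit Types (a b : R) (f : R -> R).
Local Notation mu := (@lebesgue_measure R).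

(** h is the Radon-Nikodym density of the Stieltjes measure of F restricted to ]a, b]. The
    restriction makes the measure finite and lets the integral start at -oo, the form in which
    Lebesgue differentiation is applied. *)
Lemma nondecreasing_ac_density (F : R -> R) a b : a < b ->
  {homo F : x y / x <= y} -> ac_on_systems F ->
  exists2 h : R -> R, mu.-integrable setT (EFin \o h) &
    forall x, a <= x <= b ->
      (\int[mu]_(t in `]-oo, x]) (h t)%:E = (F x - F a)%:E)%E.
Proof.
move=> ab ndF acF.
have rcF : right_continuous F by apply/right_continuousW/ac_on_systems_continuous.
pose cF := isCumulative.Build R _ R F ndF rcF.
pose G : cumulative R R := HB.pack F cF.
pose lsf := lebesgue_stieltjes_measure G.
have lsfE x : a <= x -> lsf `]a, x]%classic = (F x - F a)%:E.
  move=> ax; rewrite /lsf /lebesgue_stieltjes_measure /measure_extension.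
  by rewrite measurable_mu_extE/= ?wlength_itv_bnd//; exact: is_ocitv.
have mE : measurable (`]a, b]%classic : set (measurableTypeR R)) by exact: measurable_itv.
have Eoo : (lsf `]a, b]%classic < +oo)%E by rewrite lsfE ?ltry// ltW.
pose nu : {finite_measure set (measurableTypeR R) -> \bar R} := mfrestr mE Eoo.
have numu : nu `<< mu.
  move=> A nullA B mB BA; rewrite /nu/= /mfrestr /mrestr.
  apply: (@stieltjes_null _ G (a - 1) (b + 1)) => //.
  - exact: measurableI.
  - by move=> x [_] /=; rewrite !in_itv/= => /andP[? ?]; apply/andP; split; lra.
  - by apply: nullA; [exact: measurableI|move=> x [/BA]].
have [h [h0 hfin hint hE]] := radon_nikodym_sigma_finite numu.
exists (fine \o h).
  by apply: eq_integrable hint => // x _ /=; rewrite fineK.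
move=> x /andP[ax xb]; under eq_integral do rewrite /= fineK//.
rewrite -hE//= /mfrestr /mrestr -lsfE//; congr (lsf _).
apply/seteqP; split => y /=; rewrite !in_itv/=.
  by case=> -> /andP[-> _].
by case/andP=> ay yx; rewrite ay yx (le_trans yx).
Qed.

(** Jordan decomposition f = V - (V - f), with V the variation function: both terms are
    nondecreasing and absolutely continuous, and h is the difference of their densities. *)
Theorem ac_fundamental a b f : a < b -> absolutely_continuous a b f ->
  exists h : R -> R, [/\ mu.-integrable setT (EFin \o h),
    forall x, a <= x <= b -> f x = f a + \int[mu]_(t in `]-oo, x]) h t &
    {ae mu, forall x, a < x < b -> is_derive x 1 f (h x)}].
Proof.
move=> ab acf; pose g := f \o clamp a b.
have acg : ac_on_systems g by apply: ac_on_systems_clamp => //; exact: ltW.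
pose V := variation_fun g a b.
have acV : ac_on_systems V by exact: variation_fun_ac.
have clampK x : clamp a b (clamp a b x) = clamp a b x.
  by rewrite clamp_id// clamp_bound// ltW.
have gV x y : x <= y -> `|g y - g x| <= V y - V x.
  by move=> xy; have := variation_fun_ge ab acg xy; rewrite /g/= !clampK.
have ab1 : a - 1 < b + 1 by lra.
have [h1 h1int h1E] := nondecreasing_ac_density ab1 (variation_fun_homo ab acg) acV.
have ndVg : {homo V \- g : x y / x <= y}.
  by move=> x y /gV; rewrite ler_norml /= => /andP[_]; lra.
have [h2 h2int h2E] := nondecreasing_ac_density ab1 ndVg (ac_on_systemsB acV acg).
have hint : mu.-integrable setT (EFin \o (h1 \- h2)).
  rewrite (_ : EFin \o _ = (EFin \o h1) \- (EFin \o h2))%E; first exact: integrableB.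
  by apply/funext => x; rewrite /= EFinB.
have gE x : a - 1 <= x <= b + 1 -> g x = f a + \int[mu]_(t in `]-oo, x]) (h1 \- h2) t.
  move=> xab; rewrite RintegralB//; last 2 first.
  - exact: integrableS h1int.
  - exact: integrableS h2int.
  have ga : g (a - 1) = f a by rewrite /g/= clamp_le//; [exact: ltW|lra].
  rewrite /Rintegral h1E// h2E//.
  transitivity (f a + ((V x - V (a - 1)) - ((V x - g x) - (V (a - 1) - g (a - 1))))).
    by rewrite ga; ring.
  by [].
exists (h1 \- h2); split => //.
  move=> x /andP[ax xb]; rewrite -gE; last by lra.
  by rewrite /g/= clamp_id ?ax.
have li : locally_integrable setT (h1 \- h2).
  by apply: open_integrable_locally => //; exact: openT.
have hintS y : mu.-integrable `]-oo, y] (EFin \o (h1 \- h2)) by exact: integrableS hint.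
(* Lebesgue differentiation of the integral over ]-oo, x]. *)
have := FTC1Ny hintS li.
apply: filterS; first exact: (ae_filter_ringOfSetsType mu).
move=> x [dx dxE] /andP[ax xb].
set Fi := (fun x : R => _) in dx dxE.
have dFi : is_derive x 1 (fun y => f a + Fi y) ((h1 \- h2) x).
  rewrite -[X in is_derive _ _ _ X]add0r; apply: is_deriveD.
  by rewrite -dxE derive1E; exact/derivableP.
apply: near_eq_is_derive dFi.
near=> y.
have ayb : a <= y <= b.
  apply/andP; split.
    by near: y; exact: lt_le_nbhsr.
  by near: y; exact: lt_le_nbhsl.
rewrite -gE; first by rewrite /g/= clamp_id.
by move: ayb => /andP[? ?]; lra.
Unshelve. all: by end_near. Qed.

End LebesgueFTC.

(** * Signed powers and the dual problem *)

Section SignedPower.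
Variable R : realType.
Implicit Types (r s u x y : R).

(** For s = r - 1 with r > 1, this is the derivative of |u|^r / r. *)
Definition spow s u : R := Num.sg u * `|u| `^ s.

Lemma spow0 s : spow s 0 = 0.
Proof. by rewrite /spow sgr0 mul0r. Qed.

Lemma spow_mul r u : 0 < r -> spow (r - 1) u * u = `|u| `^ r.
Proof.
by move=> r0; rewrite /spow mulrAC -normrEsg mulr_powRB1.
Qed.

Lemma norm_spow s u : s != 0 -> `|spow s u| = `|u| `^ s.
Proof.
move=> s0; rewrite /spow normrM [`|_ `^ _|]ger0_norm ?powR_ge0// normr_sg.
by have [->|u0] := eqVneq u 0; rewrite ?mul1r// normr0 powR0// mul0r.
Qed.

Lemma spowK s t u : s * t = 1 -> spow t (spow s u) = u.
Proof.
move=> st; have s0 : s != 0 by apply: contra_eq_neq st => ->; rewrite mul0r eq_sym oner_eq0.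
rewrite {1}/spow norm_spow// -powRrM st powRr1// /spow sgrM sgr_id.
have [->|u0] := eqVneq u 0; first by rewrite sgr0 !mul0r.
by rewrite (gtr0_sg (powR_gt0 _ _)) ?normr_gt0// mulr1 -numEsg.
Qed.

(** For t > 0 and m = ln t, one has t^r = t exp((r - 1) m) >= t (1 + (r - 1) m), and exp(-m) > 1 - m
    gives t (1 - m) < 1, which turns this into the claim. For t <= 0 the left side is negative. *)
Lemma bernoulli_powR r t : 1 < r -> t != 1 -> 1 + r * (t - 1) < `|t| `^ r.
Proof.
move=> r1 t1; have [t0|t0] := leP t 0.
  rewrite (lt_le_trans _ (powR_ge0 _ _))//.
  suff : r * t <= 0 by lra.
  by rewrite mulr_ge0_le0//; lra.
rewrite gtr0_norm// /powR gt_eqF//; set m := ln t.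
have tE : t = expR m by rewrite lnK.
have m0 : m != 0 by rewrite ln_eq0.
have rE : expR (r * m) = t * expR ((r - 1) * m) by rewrite tE -expRD; congr expR; ring.
have h1 : 1 + (r - 1) * m <= expR ((r - 1) * m) := expR_ge1Dx _.
have h2 : t * (1 - m) < 1.
  have := @expR_gt1Dx R (- m); rewrite oppr_eq0 m0 => /(_ isT).
  by rewrite expRN -tE -ltr_pdivlMl// mulr1.
have h3 := ler_wpM2l (ltW t0) h1.
rewrite rE (lt_le_trans _ h3)//.
have := h2; rewrite -subr_gt0 => h4.
have : 0 < (r - 1) * (1 - t * (1 - m)) by rewrite mulr_gt0// subr_gt0.
by lra.
Qed.

(** Strict convexity: the left side is the tangent to |.|^r at x. For x != 0, dividing by |x|^r
    reduces it to Bernoulli's inequality at t = y / x. *)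
Lemma tangent_powR r x y : 1 < r -> y != x ->
  `|x| `^ r + r * (spow (r - 1) x * (y - x)) < `|y| `^ r.
Proof.
move=> r1; have r0 : 0 < r by rewrite (lt_trans _ r1).
have [->|x0] := eqVneq x 0.
  by move=> y0; rewrite normr0 powR0 ?gt_eqF// spow0 mul0r mulr0 addr0 powR_gt0// normr_gt0.
move=> yx; pose t := y / x.
have yE : y = t * x by rewrite /t divfK.
have t1 : t != 1 by apply: contra yx => /eqP e; rewrite yE e mul1r.
rewrite yE normrM powRM//.
have -> : t * x - x = x * (t - 1) by ring.
rewrite [spow _ _ * _]mulrA spow_mul//.
have -> : `|x| `^ r + r * (`|x| `^ r * (t - 1)) = (1 + r * (t - 1)) * `|x| `^ r by ring.
by rewrite ltr_pM2r ?bernoulli_powR// powR_gt0// normr_gt0.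
Qed.

Lemma tangent_powR_le r x y : 1 < r ->
  `|x| `^ r + r * (spow (r - 1) x * (y - x)) <= `|y| `^ r.
Proof.
move=> r1; have [->|/(tangent_powR r1)/ltW//] := eqVneq y x.
by rewrite subrr !mulr0 addr0.
Qed.

(** At 0 the sign jumps but the factor |v|^s tends to 0; elsewhere the sign is locally constant. *)
Lemma spow_continuous s : 0 < s -> continuous (spow s).
Proof.
move=> s0 u; have [->|u0] := eqVneq u 0.
  rewrite /continuous_at spow0; apply/cvgrPdist_le => e e0.
  have e1 : 0 < e `^ s^-1 by rewrite powR_gt0.
  near=> v; rewrite sub0r normrN norm_spow ?gt_eqF//.
  have -> : e = (e `^ s^-1) `^ s by rewrite -powRrM mulVf ?gt_eqF// powRr1// ltW.
  rewrite ge0_ler_powR ?nnegrE ?powR_ge0 ?(ltW s0)//.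
have cabs : {for u, continuous (fun v : R => `|v| `^ s)}.
  apply: (@continuous_comp _ _ _ (fun v : R => `|v|) (fun w => w `^ s)).
    exact: norm_continuous.
  apply/differentiable_continuous/derivable1_diffP; apply: derivable_powR.
  by rewrite in_itv/= andbT normr_gt0.
have near_sg : \forall v \near u, Num.sg v = Num.sg u.
  move: u0; rewrite neq_lt => /orP[u0|u0]; near=> v.
    by rewrite !ltr0_sg//; near: v; exact: lt_nbhsl.
  by rewrite !gtr0_sg//; near: v; exact: lt_nbhsr.
rewrite /continuous_at /spow.
apply: (@cvg_trans _ (Num.sg u * `|v| `^ s @[v --> u])).
  by apply: near_eq_cvg; apply: filterS near_sg => v ->.
exact: (@cvgM R _ (nbhs u) _ (cst (Num.sg u)) (fun v => `|v| `^ s) _ _ (cvg_cst _) cabs).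
Unshelve. all: by end_near. Qed.

End SignedPower.

(** * Continuity of sums, products and dominated functions *)

Section ContinuousOperations.
Variables (R : realType) (T : topologicalType).
Implicit Types (f g : T -> R).

Lemma continuousD_fun f g : continuous f -> continuous g -> continuous (fun t => f t + g t).
Proof. by move=> cf cg t; apply: cvgD; [exact: cf|exact: cg]. Qed.

Lemma continuousB_fun f g : continuous f -> continuous g -> continuous (fun t => f t - g t).
Proof. by move=> cf cg t; apply: cvgB; [exact: cf|exact: cg]. Qed.

Lemma continuousM_fun f g : continuous f -> continuous g -> continuous (fun t => f t * g t).
Proof. by move=> cf cg t; apply: cvgM; [exact: cf|exact: cg]. Qed.

Lemma continuous_norm_fun f : continuous f -> continuous (fun t => `|f t|).
Proof. by move=> cf t; apply: cvg_norm; exact: cf. Qed.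

Lemma continuous_sum (I : Type) (s : seq I) (F : I -> T -> R) :
  (forall i, continuous (F i)) -> continuous (fun t => \sum_(i <- s) F i t).
Proof.
move=> cF; elim: s => [|i s ih].
  by rewrite (_ : (fun _ => _) = cst 0); [exact: cst_continuous|apply/funext => t; rewrite big_nil].
rewrite (_ : (fun _ => _) = (fun t => F i t + \sum_(j <- s) F j t)); last first.
  by apply/funext => t; rewrite big_cons.
exact: continuousD_fun.
Qed.

Lemma continuous_at_sum (I : Type) (s : seq I) (F : I -> T -> R) (x : T) :
  (forall i, {for x, continuous (F i)}) -> {for x, continuous (fun t => \sum_(i <- s) F i t)}.
Proof.
move=> cF; elim: s => [|i s ih].
  rewrite (_ : (fun _ => _) = cst 0); last by apply/funext => t; rewrite big_nil.
  exact: cst_continuous.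
rewrite (_ : (fun _ => _) = (fun t => F i t + \sum_(j <- s) F j t)); last first.
  by apply/funext => t; rewrite big_cons.
by apply: cvgD; [exact: cF|exact: ih].
Qed.

Lemma continuous_dominated f g x : continuous g -> g x = 0 ->
  (\forall t \near x, `|f x - f t| <= g t) -> {for x, continuous f}.
Proof.
move=> cg gx fg; apply/cvgrPdist_le => e e0.
have := cg x; rewrite /continuous_at gx => /cvgrPdist_le/(_ _ e0).
apply: filterS2 fg => t fgt; rewrite sub0r normrN; apply: le_trans.
by rewrite (le_trans fgt)// ler_norm.
Qed.

Lemma near_coord_bounded (I : finType) (F : I -> T -> R) x :
  (forall i, continuous (F i)) -> \forall t \near x, forall i, `|F i t| <= `|F i x| + 1.
Proof.
move=> cF; apply: filter_forall => i.
have := cF i x; move=> /cvgrPdist_le/(_ _ ltr01).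
apply: filterS => t h; rewrite -lerBlDl.
by apply: le_trans h; rewrite distrC (le_trans (ler_norm _))// ler_dist_dist.
Qed.

End ContinuousOperations.

(** * Integrals of continuous functions over [0, L] *)

Section IntegralOfContinuous.
Variable R : realType.
Implicit Types (L c : R) (f g : R -> R).
Local Notation mu := (@lebesgue_measure R).

Definition cint L f : R := \int[mu]_(t in `[0, L]) f t.

Lemma continuous_integrable_itv a b f : continuous f ->
  mu.-integrable `[a, b] (EFin \o f).
Proof.
move=> cf; apply: continuous_compact_integrable; first exact: segment_compact.
exact: continuous_subspaceT.
Qed.

Lemma eq_cint L f g : (forall t, 0 <= t <= L -> f t = g t) -> cint L f = cint L g.
Proof. by move=> fg; apply: eq_Rintegral => t /set_mem/=; rewrite in_itv/=; exact: fg. Qed.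

Lemma cintD L f g : continuous f -> continuous g ->
  cint L (fun t => f t + g t) = cint L f + cint L g.
Proof. by move=> cf cg; rewrite /cint RintegralD//; exact: continuous_integrable_itv. Qed.

Lemma cintB L f g : continuous f -> continuous g ->
  cint L (fun t => f t - g t) = cint L f - cint L g.
Proof. by move=> cf cg; rewrite /cint RintegralB//; exact: continuous_integrable_itv. Qed.

Lemma cintZ L c f : continuous f -> cint L (fun t => c * f t) = c * cint L f.
Proof. by move=> cf; rewrite /cint RintegralZl//; exact: continuous_integrable_itv. Qed.

Lemma cint0 L : cint L (cst 0) = 0.
Proof. by rewrite /cint /Rintegral integral0. Qed.

Lemma cint_sum L (I : Type) (s : seq I) (F : I -> R -> R) :
  (forall i, continuous (F i)) ->
  cint L (fun t => \sum_(i <- s) F i t) = \sum_(i <- s) cint L (F i).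
Proof.
move=> cF; elim: s => [|i s ih].
  by rewrite big_nil -[RHS](cint0 L); apply: eq_cint => t _; rewrite big_nil.
rewrite big_cons -ih -cintD//; last exact: continuous_sum.
by apply: eq_cint => t _; rewrite big_cons.
Qed.

Lemma cint_le L f g : continuous f -> continuous g ->
  (forall t, 0 <= t <= L -> f t <= g t) -> cint L f <= cint L g.
Proof.
by move=> cf cg fg; apply: le_Rintegral => //; exact: continuous_integrable_itv.
Qed.

Lemma cint_ge0 L f : (forall t, 0 <= t <= L -> 0 <= f t) -> 0 <= cint L f.
Proof. by move=> f0; apply: Rintegral_ge0 => t /=; rewrite in_itv/=; exact: f0. Qed.

Lemma cint_eq0 L f : 0 < L -> continuous f -> (forall t, 0 <= t <= L -> 0 <= f t) ->
  cint L f = 0 -> forall t, 0 <= t <= L -> f t = 0.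
Proof.
move=> L0 cf f0 If t /andP[t0 tL]; apply/eqP; rewrite eq_le f0 ?t0// andbT leNgt.
apply/negP => ft0.
have [d /= d0 dP] : \forall s \near t, f t / 2 < f s.
  have ft2 : f t / 2 < f t by lra.
  exact: (cvgr_gt (f t) (cf t) _ ft2).
pose u := Num.max 0 (t - d / 2); pose v := Num.min L (t + d / 2).
have uv : u < v by rewrite /u /v gt_max !lt_min; apply/andP; split; apply/andP; split; lra.
have u0 : 0 <= u by rewrite /u le_max lexx.
have vL : v <= L by rewrite /v ge_min lexx.
have sub : `[u, v] `<=` `[0, L].
  by move=> s /=; rewrite !in_itv/= => /andP[us sv]; rewrite (le_trans u0 us) (le_trans sv vL).
have h1 : cint L f >= \int[mu]_(s in `[u, v]) f s.
  rewrite /cint /Rintegral; apply: fine_le.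
  - apply: integrable_fin_num => //; exact: continuous_integrable_itv.
  - apply: integrable_fin_num => //; exact: continuous_integrable_itv.
  apply: ge0_subset_integral => //.
  apply/measurable_EFinP/measurable_funTS; exact: continuous_measurable_fun.
have h2 : \int[mu]_(s in `[u, v]) f s >= \int[mu]_(s in `[u, v]) (f t / 2).
  apply: le_Rintegral => //; try exact: continuous_integrable_itv.
    by apply: continuous_integrable_itv; exact: cst_continuous.
  move=> s /=; rewrite in_itv/= /u /v ge_max le_min => /andP[/andP[? ?] /andP[? ?]].
  apply/ltW/dP => /=; rewrite ltr_norml; apply/andP; split; lra.
have h3 : \int[mu]_(s in `[u, v]) (f t / 2) = f t / 2 * (v - u).
  rewrite Rintegral_cst//; congr (_ * _).
  have muv : mu (`[u, v]%classic : set R) = (v - u)%:E.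
    by rewrite lebesgue_measure_itv/= lte_fin uv -EFinB.
  by rewrite -[v - u]/(fine (v - u)%:E) -muv.
have : 0 < f t / 2 * (v - u) by rewrite mulr_gt0 ?subr_gt0// divr_gt0.
by rewrite -h3 => h4; have := le_trans h2 h1; rewrite If leNgt h4.
Qed.

End IntegralOfContinuous.

(** * The finite-dimensional dual problem *)

Section DualProblem.
Variables (R : realType) (E : finType) (N : nat).
Variables (L : E -> R) (y : 'I_N -> E -> R -> R) (q : R) (m : 'rV[R]_N).
Hypotheses (q1 : 1 < q) (L0 : forall e, 0 < L e).
Hypothesis cy : forall k e, continuous (y k e).
Implicit Types (l : 'rV[R]_N) (e : E) (k : 'I_N) (t : R).

Definition lin l e t := \sum_k l 0 k * y k e t.

Hypothesis indep : forall l, (forall e t, 0 <= t <= L e -> lin l e t = 0) -> l = 0.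

Definition dual_energy l := \sum_e cint (L e) (fun t => `|lin l e t| `^ q).

Definition dual_objective l := q^-1 * dual_energy l - \sum_k l 0 k * m 0 k.

(** Up to the factor q, a partial derivative of [dual_energy]. *)
Definition dual_moment l k := \sum_e cint (L e) (fun t => spow (q - 1) (lin l e t) * y k e t).

Let q0 : 0 < q. Proof. by rewrite (lt_trans _ q1). Qed.

Let q10 : 0 < q - 1. Proof. by rewrite subr_gt0. Qed.

Let q1N0 : q - 1 != 0. Proof. by rewrite gt_eqF. Qed.

Lemma lin_continuous l e : continuous (lin l e).
Proof.
by apply: continuous_sum => k; apply: continuousM_fun; [exact: cst_continuous|exact: cy].
Qed.

Lemma linD l l' e t : lin (l + l') e t = lin l e t + lin l' e t.
Proof. by rewrite /lin -big_split/=; apply: eq_bigr => k _; rewrite mxE mulrDl. Qed.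

Lemma linZ c l e t : lin (c *: l) e t = c * lin l e t.
Proof. by rewrite /lin mulr_sumr; apply: eq_bigr => k _; rewrite mxE mulrA. Qed.

Lemma linB l l' e t : lin (l - l') e t = lin l e t - lin l' e t.
Proof. by rewrite -scaleN1r linD linZ mulN1r. Qed.

Lemma powR_norm_continuous (f : R -> R) : continuous f -> continuous (fun t => `|f t| `^ q).
Proof.
move=> cf; rewrite (_ : (fun _ => _) = fun t => spow (q - 1) (f t) * f t); last first.
  by apply/funext => t; rewrite spow_mul.
move=> t; apply: cvgM; last exact: cf.
apply: (continuous_comp (cf t)); exact: spow_continuous.
Qed.

Lemma spow_comp_continuous (f : R -> R) : continuous f -> continuous (fun t => spow (q - 1) (f t)).
Proof. by move=> cf t; apply: (continuous_comp (cf t)); exact: spow_continuous. Qed.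

(** The tangent inequality at l, integrated. Bounding an increment of energy by the slope at l
    stands in for differentiability of the energy. *)
Lemma dual_energyB l l' : dual_energy l - dual_energy l' <=
  q * \sum_e cint (L e) (fun t => spow (q - 1) (lin l e t) * lin (l - l') e t).
Proof.
rewrite /dual_energy -sumrB mulr_sumr; apply: ler_sum => e _.
have c1 := powR_norm_continuous (@lin_continuous l e).
have c2 := powR_norm_continuous (@lin_continuous l' e).
have c3 := continuousM_fun (spow_comp_continuous (@lin_continuous l e)) (@lin_continuous (l - l') e).
rewrite -cintB// -cintZ//; apply: cint_le.
- by move=> t; apply: cvgB; [exact: c1|exact: c2].
- by move=> t; apply: cvgM; [exact: cvg_cst|exact: c3].
move=> t _; have := tangent_powR_le (lin l e t) (lin l' e t) q1.
by rewrite linB; lra.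
Qed.

(** Y majorises |lin l| over the box, and D integrates |Y|^(q-1) against each |y k|. The bound is
    uniform in the box, so applying it both ways gives continuity. *)
Lemma dual_energy_box (M : 'I_N -> R) : exists D : 'I_N -> R, forall l l',
  (forall k, `|l 0 k| <= M k) ->
  dual_energy l - dual_energy l' <= \sum_k `|l 0 k - l' 0 k| * D k.
Proof.
pose Y e t := \sum_k M k * `|y k e t|.
have cay k e : continuous (fun t => `|y k e t|).
  by move=> t; apply: cvg_norm; exact: cy.
have cY e : continuous (Y e).
  by apply: continuous_sum => k; apply: continuousM_fun; [exact: cst_continuous|exact: cay].
exists (fun k => q * \sum_e cint (L e) (fun t => `|Y e t| `^ (q - 1) * `|y k e t|)).
move=> l l' lM; apply: le_trans (dual_energyB _ _) _.
have cYp e : continuous (fun t => `|Y e t| `^ (q - 1)).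
  rewrite (_ : (fun _ => _) = fun t => `|spow (q - 1) (Y e t)|); last first.
    by apply/funext => t; rewrite norm_spow.
  by move=> t; apply: cvg_norm; exact: spow_comp_continuous.
rewrite mulr_sumr; under [leRHS]eq_bigr do rewrite mulrCA mulr_sumr.
rewrite -mulr_sumr -mulr_sumr exchange_big/= ler_pM2l//; apply: ler_sum => e _.
under [leRHS]eq_bigr => k _.
  rewrite -cintZ; last by apply: continuousM_fun; [exact: cYp|exact: cay].
  over.
have cR k : continuous (fun t => `|l 0 k - l' 0 k| * (`|Y e t| `^ (q - 1) * `|y k e t|)).
  apply: continuousM_fun; first exact: cst_continuous.
  by apply: continuousM_fun; [exact: cYp|exact: cay].
rewrite -cint_sum//; apply: cint_le.
- apply: continuousM_fun; last exact: lin_continuous.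
  by apply: spow_comp_continuous; exact: lin_continuous.
- exact: continuous_sum.
move=> t _; apply: (le_trans (ler_norm _)); rewrite normrM norm_spow//.
have -> : \sum_k `|l 0 k - l' 0 k| * (`|Y e t| `^ (q - 1) * `|y k e t|) =
   `|Y e t| `^ (q - 1) * \sum_k `|l 0 k - l' 0 k| * `|y k e t|.
  by rewrite mulr_sumr; apply: eq_bigr => k _; ring.
have M0 k : 0 <= M k by apply: le_trans (lM k).
apply: ler_pM; rewrite ?powR_ge0 ?normr_ge0//.
  rewrite ge0_ler_powR ?nnegrE ?(ltW q10)//.
  rewrite [leRHS]ger0_norm; last by apply: sumr_ge0 => k _; rewrite mulr_ge0.
  apply: le_trans (ler_norm_sum _ _ _) _; apply: ler_sum => k _.
  by rewrite normrM ler_wpM2r.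
rewrite /lin; apply: le_trans (ler_norm_sum _ _ _) _; apply: ler_sum => k _.
by rewrite normrM !mxE.
Qed.

Lemma coord_continuous_rV k : continuous (fun l => l 0 k : R).
Proof. exact: coord_continuous. Qed.

Lemma dual_energy_continuous : continuous dual_energy.
Proof.
move=> l0.
pose M k := `|l0 0 k| + 1.
have [D HD] := dual_energy_box M.
pose g l := \sum_k `|l 0 k - l0 0 k| * D k.
have cg : continuous g.
  apply: continuous_sum => k; apply: continuousM_fun; last exact: cst_continuous.
  apply: continuous_norm_fun; apply: continuousB_fun; last exact: cst_continuous.
  exact: coord_continuous_rV.
have g0 : g l0 = 0 by rewrite /g big1// => k _; rewrite subrr normr0 mul0r.
apply: (continuous_dominated cg g0).
have := @near_coord_bounded _ _ _ (fun k l => l 0 k : R) l0 coord_continuous_rV.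
apply: filterS => l lM; rewrite ler_norml lerNl opprB; apply/andP; split.
  exact: HD.
rewrite /g; under eq_bigr do rewrite distrC.
by apply: HD => k; rewrite /M lerDl.
Qed.

Lemma dual_objective_continuous : continuous dual_objective.
Proof.
apply: continuousB_fun.
  by apply: continuousM_fun; [exact: cst_continuous|exact: dual_energy_continuous].
apply: continuous_sum => k; apply: continuousM_fun; last exact: cst_continuous.
exact: coord_continuous_rV.
Qed.

Lemma dual_energy_ge0 l : 0 <= dual_energy l.
Proof. by apply: sumr_ge0 => e _; apply: cint_ge0 => t _; exact: powR_ge0. Qed.

Lemma dual_energy_eq0 l : dual_energy l = 0 -> l = 0.
Proof.
move=> H; apply: indep => e t te.
have cge0 e' : 0 <= cint (L e') (fun t => `|lin l e' t| `^ q).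
  by apply: cint_ge0 => s _; exact: powR_ge0.
have /eqP := H; rewrite /dual_energy psumr_eq0// => /allP /(_ e).
rewrite mem_index_enum => /(_ isT)/= /eqP.
move=> /(cint_eq0 (L0 e) (powR_norm_continuous (@lin_continuous l e))) H'.
have := H' (fun s _ => powR_ge0 _ _) t te.
by move/powR_eq0_eq0/eqP; rewrite normr_eq0 => /eqP.
Qed.

Lemma dual_energyZ c l : dual_energy (c *: l) = `|c| `^ q * dual_energy l.
Proof.
rewrite /dual_energy mulr_sumr; apply: eq_bigr => e _.
rewrite -cintZ; last exact: powR_norm_continuous (@lin_continuous l e).
by apply: eq_cint => t _; rewrite linZ normrM powRM.
Qed.

(** The energy is homogeneous of degree q and, by [indep], positive on the unit sphere; compactness
    of the sphere provides the minimum d. *)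
Lemma dual_energy_coercive : exists2 d : R, 0 < d &
  forall l, d * `|l| `^ q <= dual_energy l.
Proof.
(* In the zero space the sphere is empty. *)
have [[l1 l10]|H] := pselect (exists l : 'rV[R]_N, l != 0); last first.
  exists 1 => // l; have -> : l = 0 by apply/eqP; apply: contra_notT H => ?; exists l.
  by rewrite normr0 powR0 ?gt_eqF// mulr0 dual_energy_ge0.
pose S := [set l : 'rV[R]_N | `|l| = 1].
have unitS l : l != 0 -> S (`|l|^-1 *: l).
  by move=> l0; rewrite /S/= normrZ normfV normr_id mulVf// normr_eq0.
have cS : compact S.
  apply: bounded_closed_compact.
    by exists 1; split; rewrite ?num_real // => r r1 l /= ->; exact: ltW.
  apply: (@closed_comp _ _ (fun l : 'rV[R]_N => `|l|) [set 1]).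
    by move=> l _; exact: norm_continuous.
  exact: closed_eq.
have [ls /set_mem lsS lsmin] := EVT_min_rV (ex_intro _ _ (unitS _ l10)) cS
  (continuous_subspaceT dual_energy_continuous).
exists (dual_energy ls).
  rewrite lt_neqAle dual_energy_ge0 andbT eq_sym; apply/eqP => /dual_energy_eq0 ls0.
  by move: lsS; rewrite /S/= ls0 normr0 => /eqP; rewrite eq_sym oner_eq0.
move=> l; have [->|l0] := eqVneq l 0.
  by rewrite normr0 powR0 ?gt_eqF// mulr0 dual_energy_ge0.
have -> : dual_energy l = `|l| `^ q * dual_energy (`|l|^-1 *: l).
  by rewrite dual_energyZ mulrA -powRM// normfV normr_id mulfV ?powR1 ?mul1r// normr_eq0.
rewrite mulrC; apply: ler_wpM2l; first exact: powR_ge0.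
by apply: lsmin; rewrite inE; exact: unitS.
Qed.

Lemma norm_coord_le l k : `|l 0 k| <= `|l|.
Proof. by rewrite [leRHS]/Num.norm/= mx_normrE; apply/bigmax_geP; right; exists (ord0, k). Qed.

(** The linear term is at most C |l| and the energy term at least (d / q) |l|^q, which exceeds (C +
    1) |l| as soon as |l|^(q-1) > a. *)
Lemma dual_objective_coercive : exists2 rho : R, 0 < rho &
  forall l, rho < `|l| -> 0 < dual_objective l.
Proof.
have [d d0 Hd] := dual_energy_coercive.
pose C := \sum_k `|m 0 k|.
have C0 : 0 <= C by exact: sumr_ge0.
pose a := (C + 1) * q / d.
have a0 : 0 < a by rewrite divr_gt0// mulr_gt0// ltr_wpDl.
exists (a `^ (q - 1)^-1); first exact: powR_gt0.
move=> l rl.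
have l0 : 0 < `|l| by apply: le_lt_trans rl; exact: powR_ge0.
have h1 : a < `|l| `^ (q - 1).
  have -> : a = (a `^ (q - 1)^-1) `^ (q - 1) by rewrite -powRrM mulVf// powRr1// ltW.
  by rewrite gt0_ltr_powR// ?nnegrE ?powR_ge0// ltW.
have h2 : \sum_k l 0 k * m 0 k <= `|l| * C.
  rewrite mulr_sumr; apply: ler_sum => k _; apply: (le_trans (ler_norm _)).
  by rewrite normrM ler_wpM2r// norm_coord_le.
have h3 := Hd l.
have h4 : `|l| * (C + 1) < q^-1 * (d * `|l| `^ q).
  rewrite -(@mulr_powRB1 _ _ q)//.
  have -> : q^-1 * (d * (`|l| * `|l| `^ (q - 1))) = `|l| * (q^-1 * d * `|l| `^ (q - 1)) by ring.
  rewrite ltr_pM2l// -ltr_pdivrMl ?mulr_gt0 ?invr_gt0//.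
  apply: le_lt_trans h1; rewrite /a invfM invrK le_eqVlt; apply/orP; left; apply/eqP.
  by ring.
have h5 : q^-1 * (d * `|l| `^ q) <= q^-1 * dual_energy l by rewrite ler_pM2l// invr_gt0.
rewrite /dual_objective subr_gt0.
apply: le_lt_trans h2 _; apply: lt_le_trans h5; apply: lt_trans h4.
by rewrite ltr_pM2l// ltrDl.
Qed.

(** W is the kernel of B^T. Outside the ball of radius rho the objective is positive, hence above
    its value 0 at the origin, so a minimum over the part of W inside the ball is a minimum over
    W. *)
Lemma dual_minimizer (M : nat) (B : 'M[R]_(M, N)) : exists2 l, l *m B^T = 0 &
  forall l', l' *m B^T = 0 -> dual_objective l <= dual_objective l'.
Proof.
have [rho rho0 Hrho] := dual_objective_coercive.
have J0 : dual_objective 0 = 0.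
  have -> : 0 = (0 : R) *: (0 : 'rV[R]_N) by rewrite scale0r.
  rewrite /dual_objective dual_energyZ normr0 powR0 ?gt_eqF// mul0r mulr0 big1 ?subr0// => k _.
  by rewrite !mxE mulr0 mul0r.
pose S := [set l : 'rV[R]_N | `|l| <= rho] `&` [set l | l *m B^T = 0].
have cS : compact S.
  apply: bounded_closed_compact.
    by exists rho; split; rewrite ?num_real // => r r1 l [/= lr _]; exact: (le_trans lr (ltW r1)).
  apply: closedI.
    apply: (@closed_comp _ _ (fun l : 'rV[R]_N => `|l|) [set x | x <= rho]).
      by move=> l _; exact: norm_continuous.
    exact: closed_le.
  have -> : [set l | l *m B^T = 0] =
      \bigcap_(i in [set: 'I_M]) [set l : 'rV[R]_N | \sum_k l 0 k * B i k = 0].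
    apply/seteqP; split => l /=.
      move=> lB i _ /=; have := congr1 (fun A : 'rV_M => A 0 i) lB.
      by rewrite !mxE => e; rewrite -[RHS]e; apply: eq_bigr => k _; rewrite mxE.
    move=> lB; apply/rowP => i; rewrite !mxE -[RHS](lB i Logic.I).
    by apply: eq_bigr => k _; rewrite mxE.
  apply: closed_bigI => i _.
  apply: (@closed_comp _ _ (fun l : 'rV[R]_N => \sum_k l 0 k * B i k) [set 0]).
    move=> l _; apply: continuous_sum => k; apply: continuousM_fun; last exact: cst_continuous.
    exact: coord_continuous_rV.
  exact: closed_eq.
have S0 : S 0 by split => /=; [rewrite normr0 ltW|rewrite mul0mx].
have [ls /set_mem [lsr lsB] lsmin] := EVT_min_rV (ex_intro _ _ S0) cS
  (continuous_subspaceT dual_objective_continuous).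
exists ls => // l' l'B; have [l'r|/Hrho/ltW l'0] := leP `|l'| rho.
  by apply: lsmin; rewrite inE.
by apply: le_trans l'0; rewrite -J0; apply: lsmin; rewrite inE.
Qed.

(** Dominated convergence: for |t| < 1 the integrand is bounded by the continuous function g. *)
Lemma cint_spow_continuous (K : R) (a b : R -> R) : continuous a -> continuous b ->
  {for 0, continuous (fun t => cint K (fun s => spow (q - 1) (a s + t * b s) * b s))}.
Proof.
move=> ca cb.
have cab t : continuous (fun s => spow (q - 1) (a s + t * b s) * b s).
  apply: continuousM_fun => //; apply: spow_comp_continuous; apply: continuousD_fun => //.
  by apply: continuousM_fun => //; exact: cst_continuous.
pose g s := `|spow (q - 1) (`|a s| + `|b s|)| * `|b s|.
have cg : continuous g.
  apply: continuousM_fun; last exact: continuous_norm_fun.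
  apply: continuous_norm_fun; apply: spow_comp_continuous.
  by apply: continuousD_fun; exact: continuous_norm_fun.
apply: (@continuity_under_integral _ _ _ (@lebesgue_measure R) (fun t s => spow (q - 1) (a s + t * b s) * b s)
  `[0, K] _ (-1) 1 _ _ g).
- by [].
- by move=> t _; apply: continuous_integrable_itv; exact: cab.
- apply: aeW => s _ t _; apply: continuousM_fun; last exact: cst_continuous.
  apply: spow_comp_continuous; apply: continuousD_fun; first exact: cst_continuous.
  by apply: continuousM_fun; [move=> ?; exact: cvg_id|exact: cst_continuous].
- exact: continuous_integrable_itv.
- move=> t /=; rewrite in_itv/= => /andP[t1 t2]; apply: aeW => s _.
  rewrite normrM ler_wpM2r// !norm_spow// ge0_ler_powR ?nnegrE ?(ltW q10)//.
  rewrite [leRHS]ger0_norm ?addr_ge0//; apply: (le_trans (ler_normD _ _)).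
  rewrite lerD2l normrM ler_piMl//.
  by rewrite ler_norml; apply/andP; split; exact: ltW.
- by rewrite inE/= in_itv/= ltrN10 ltr01.
Qed.

(** By [dual_energyB] at l + t mu, minimality gives 0 <= t (h t - \sum_k mu 0 k * m 0 k) for t > 0,
    and h t tends to h 0, the right-hand side, as t decreases to 0. *)
Lemma dual_stationary (l : 'rV[R]_N) (mu : 'rV[R]_N) :
  (forall t, dual_objective l <= dual_objective (l + t *: mu)) ->
  \sum_k mu 0 k * m 0 k <= \sum_k mu 0 k * dual_moment l k.
Proof.
move=> lmin.
have aux (x1 x2 x3 x4 x5 : R) : 0 <= x1 - x3 - (x2 - (x3 - x4)) -> x1 - x2 <= x5 -> x4 <= x5.
  by lra.
pose h t := \sum_e cint (L e) (fun s => spow (q - 1) (lin l e s + t * lin mu e s) * lin mu e s).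
have cin e t : continuous (fun s => lin l e s + t * lin mu e s).
  apply: continuousD_fun; first exact: lin_continuous.
  by apply: continuousM_fun; [exact: cst_continuous|exact: lin_continuous].
have cint_h e t : continuous (fun s => spow (q - 1) (lin l e s + t * lin mu e s) * lin mu e s).
  by apply: continuousM_fun; [exact: spow_comp_continuous|exact: lin_continuous].
have ht t : 0 < t -> \sum_k mu 0 k * m 0 k <= h t.
  move=> t0; have := lmin t; rewrite /dual_objective => H.
  have := dual_energyB (l + t *: mu) l.
  have -> : q * \sum_e cint (L e) (fun s => spow (q - 1) (lin (l + t *: mu) e s) *
       lin (l + t *: mu - l) e s) = q * (t * h t).
    congr (_ * _); rewrite /h mulr_sumr; apply: eq_bigr => e _.
    rewrite -cintZ//; apply: eq_cint => s _.
    by rewrite linB linD linZ; ring.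
  have E1 : \sum_k l 0 k * m 0 k = \sum_k (l + t *: mu) 0 k * m 0 k - t * \sum_k mu 0 k * m 0 k.
    by rewrite mulr_sumr -sumrB; apply: eq_bigr => k _; rewrite !mxE; ring.
  rewrite E1 -subr_ge0 in H; move=> H2.
  have H3 : q^-1 * (dual_energy (l + t *: mu) - dual_energy l) <= t * h t.
    by rewrite -(@ler_pM2l _ q)// mulrA mulfV ?mul1r// gt_eqF.
  rewrite -(@ler_pM2l _ t)//; rewrite mulrBr in H3; exact: (aux _ _ _ _ _ H H3).
have ch : {for 0, continuous h}.
  apply: continuous_at_sum => e; apply: cint_spow_continuous; exact: lin_continuous.
rewrite leNgt; apply/negP => lt.
have h0 : h 0 = \sum_k mu 0 k * dual_moment l k.
  rewrite /h /dual_moment; under [RHS]eq_bigr do rewrite mulr_sumr.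
  rewrite exchange_big/=; apply: eq_bigr => e _.
  have cz k : continuous (fun t => spow (q - 1) (lin l e t) * y k e t).
    by apply: continuousM_fun; [apply: spow_comp_continuous; exact: lin_continuous|exact: cy].
  under [RHS]eq_bigr do rewrite -cintZ//.
  rewrite -cint_sum; last by move=> k; apply: continuousM_fun; [exact: cst_continuous|exact: cz].
  apply: eq_cint => t _; rewrite mul0r addr0 /lin mulr_sumr.
  by apply: eq_bigr => k _; ring.
rewrite -h0 in lt.
have := cvg_at_right_filter (ch : h t @[t --> 0] --> h 0).
move=> /(cvgr_lt _)/(_ _ lt) [d /= d0 dP].
have d20 : 0 < d / 2 by rewrite divr_gt0.
have : h (d / 2) < \sum_k mu 0 k * m 0 k.
  by apply: dP => //=; rewrite sub0r normrN gtr0_norm// ltr_pdivrMr// ltr_pMr// ltr1n.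
by rewrite ltNge ht.
Qed.

(** Testing with mu and -mu shows that the moments minus m are orthogonal to W. Tested on the
    columns of [cokermx B], this puts them in the row space of B, and g collects the Lagrange
    multipliers. *)
Theorem dual_solution (M : nat) (B : 'M[R]_(M, N)) : exists (l : 'rV[R]_N) (g : 'rV[R]_M),
  l *m B^T = 0 /\ forall k, dual_moment l k = m 0 k + (g *m B) 0 k.
Proof.
have [l lB lmin] := dual_minimizer B.
pose X : 'rV[R]_N := \row_k (dual_moment l k - m 0 k).
have XW (mu : 'rV[R]_N) : mu *m B^T = 0 -> \sum_k mu 0 k * X 0 k = 0.
  move=> muB.
  have ge (nu : 'rV[R]_N) : nu *m B^T = 0 -> 0 <= \sum_k nu 0 k * X 0 k.
    move=> nuB; have : \sum_k nu 0 k * m 0 k <= \sum_k nu 0 k * dual_moment l k.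
      apply: dual_stationary => t; apply: lmin.
      by rewrite mulmxDl -scalemxAl nuB scaler0 lB addr0.
    rewrite -subr_ge0 -sumrB; congr (_ <= _).
    by apply: eq_bigr => k _; rewrite mxE mulrBr.
  apply/eqP; rewrite eq_le ge// andbT -oppr_ge0 -sumrN.
  have -> : \sum_k - (mu 0 k * X 0 k) = \sum_k (- mu) 0 k * X 0 k.
    by apply: eq_bigr => k _; rewrite [(- mu) 0 k]mxE mulNr.
  by apply: ge; rewrite mulNmx muB oppr0.
have : (X <= B)%MS.
  rewrite submxE; apply/eqP/rowP => j; rewrite mxE [RHS]mxE.
  have := XW (row j (cokermx B)^T).
  have -> : row j (cokermx B)^T *m B^T = 0.
    by rewrite -row_mul -trmx_mul mulmx_coker trmx0 row0.
  move=> /(_ erefl) XC; rewrite -[RHS]XC; apply: eq_bigr => k _.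
  by rewrite !mxE mulrC.
case/submxP => g Xg; exists l, g; split=> // k.
by rewrite -Xg mxE subrKC.
Qed.

End DualProblem.

(** * Edges of a triangulation *)

Section Geometry.
Variables (R : realType) (n : nat) (V : 'I_n -> R * R).
Hypothesis Vinj : injective V.
Implicit Types (t : {set 'I_n}) (T : {set {set 'I_n}}) (e : 'I_n * 'I_n).

Lemma card3_split t : #|t| = 3%N -> exists i j k,
  [/\ t = [set i; j; k]%SET, i != j, i != k & j != k].
Proof.
move=> t3; have : size (enum t) = 3%N by rewrite -cardE.
have := enum_uniq t; have tE : t = [set x in enum t]%SET by apply/setP => x; rewrite inE mem_enum.
case: (enum t) tE => [|i [|j [|k [|? ?]]]]//= tE.
rewrite !inE negb_or andbT => /andP[/andP[ij ik] jk] _; exists i, j, k; split => //.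
by rewrite tE; apply/setP => x; rewrite !inE -orbA.
Qed.

Lemma sum_support3 (U : zmodType) i j k (f : 'I_n -> U) : i != j -> i != k -> j != k ->
  (forall x, x \notin [set i; j; k]%SET -> f x = 0) -> \sum_x f x = f i + f j + f k.
Proof.
move=> ij ik jk f0; have ji : j != i by rewrite eq_sym.
have kij : (k != i) && (k != j) by rewrite ![k == _]eq_sym ik jk.
rewrite (bigD1 i)//= (bigD1 j)//= (bigD1 k)//=.
rewrite [X in f k + X]big1; first by rewrite addr0 addrA.
by move=> x /andP[/andP[xi xj] xk]; apply: f0; rewrite !inE !negb_or xi xj xk.
Qed.

(** The differences d satisfy d j (V j - V i) + d k (V k - V i) = 0. Were d k nonzero, V k would lie
    on the line through V i and V j, with normal (- w2, w1). *)
Lemma barycentric_unique t (a b : 'I_n -> R) : #|t| = 3%N -> ~ collinear V t ->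
  (forall i, i \notin t -> a i = 0) -> (forall i, i \notin t -> b i = 0) ->
  \sum_i a i = \sum_i b i -> \sum_i a i *: V i = \sum_i b i *: V i -> a =1 b.
Proof.
move=> t3 ncol a0 b0 sab sabV.
have [i [j [k [tE ij ik jk]]]] := card3_split t3.
pose d x := a x - b x.
have d0 x : x \notin [set i; j; k]%SET -> d x = 0.
  by rewrite -tE => xt; rewrite /d a0// b0// subrr.
have sd : d i + d j + d k = 0.
  by rewrite -(sum_support3 ij ik jk d0) /d sumrB sab subrr.
have sdV : d i *: V i + d j *: V j + d k *: V k = 0.
  rewrite -(@sum_support3 _ i j k (fun x => d x *: V x))//; last first.
    by move=> x /d0 ->; rewrite scale0r.
  by rewrite /d; under eq_bigr do rewrite scalerBl; rewrite sumrB sabV subrr.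
have sd1 : d i * (V i).1 + d j * (V j).1 + d k * (V k).1 = 0 := congr1 fst sdV.
have sd2 : d i * (V i).2 + d j * (V j).2 + d k * (V k).2 = 0 := congr1 snd sdV.
have diE : d i = - d j - d k by move: sd; lra.
pose w1 := (V j).1 - (V i).1; pose w2 := (V j).2 - (V i).2.
have w0 : (- w2, w1) != (0, 0).
  apply: contra ij => /eqP[/eqP h2 /eqP h1]; apply/eqP/Vinj.
  move: h1 h2; rewrite oppr_eq0 !subr_eq0 => /eqP h1 /eqP h2.
  by rewrite [LHS]surjective_pairing [RHS]surjective_pairing h1 h2.
have dk0 : d k = 0.
  apply/eqP; apply: contra_notT ncol => dk; exists (- w2), w1, (- w2 * (V i).1 + w1 * (V i).2).
  split=> // x; rewrite tE !inE -orbA => /or3P[] /eqP -> //.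
    by rewrite /w1 /w2; ring.
  apply: (mulfI dk); rewrite /w1 /w2.
  have e1 : d k * ((V k).1 - (V i).1) = - d j * w1.
    by rewrite /w1; move: sd1; rewrite diE; lra.
  have e2 : d k * ((V k).2 - (V i).2) = - d j * w2.
    by rewrite /w2; move: sd2; rewrite diE; lra.
  have : - w2 * (d k * ((V k).1 - (V i).1)) + w1 * (d k * ((V k).2 - (V i).2)) = 0.
    by rewrite e1 e2; ring.
  by rewrite /w1 /w2 => h; apply/eqP; rewrite -subr_eq0 -[X in _ == X]h; apply/eqP; ring.
have dj0 : d j = 0.
  have e1 : d j * w1 = 0 by rewrite /w1; move: sd1; rewrite diE dk0; lra.
  have e2 : d j * w2 = 0 by rewrite /w2; move: sd2; rewrite diE dk0; lra.
  apply/eqP; apply: contraNT w0 => dj.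
  move/eqP: e1; move/eqP: e2; rewrite !mulf_eq0 (negbTE dj)/= => /eqP -> /eqP ->.
  by rewrite oppr0.
have di0 : d i = 0 by rewrite diE dj0 dk0; ring.
move=> x; apply/eqP; rewrite -subr_eq0 -/(d x); apply/eqP.
have [|/d0//] := boolP (x \in [set i; j; k]%SET).
by rewrite !inE -orbA => /or3P[] /eqP ->.
Qed.

(** Barycentric coordinates extended by 0 to all indices, the format of [hull]. *)
Definition edge_weight (i j : 'I_n) (tau : R) (x : 'I_n) : R :=
  (x == i)%:R * (1 - tau) + (x == j)%:R * tau.

Lemma sum_edge_weight (U : lmodType R) i j tau (f : 'I_n -> U) :
  \sum_x edge_weight i j tau x *: f x = (1 - tau) *: f i + tau *: f j.
Proof.
have sdelta (c : R) k : \sum_x ((x == k)%:R * c) *: f x = c *: f k.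
  rewrite (bigD1 k)//= eqxx mul1r big1 ?addr0// => x /negbTE ->.
  by rewrite mul0r scale0r.
rewrite -!sdelta -big_split/=; apply: eq_bigr => x _.
by rewrite -scalerDl.
Qed.

Lemma sum_edge_weight1 i j tau : \sum_x edge_weight i j tau x = 1.
Proof.
have := @sum_edge_weight R^o i j tau (fun=> 1).
under eq_bigr do rewrite /GRing.scale/= mulr1.
by move=> ->; rewrite /GRing.scale/= !mulr1 subrK.
Qed.

Lemma edge_weight_ge0 i j tau x : 0 <= tau <= 1 -> 0 <= edge_weight i j tau x.
Proof.
by move=> /andP[t0 t1]; rewrite addr_ge0// mulr_ge0// subr_ge0.
Qed.

Lemma edge_weight_out i j tau x : x != i -> x != j -> edge_weight i j tau x = 0.
Proof. by move=> /negbTE xi /negbTE xj; rewrite /edge_weight xi xj !mul0r addr0. Qed.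

Lemma edge_weight_neq0 i j tau : i != j -> 0 < tau < 1 ->
  edge_weight i j tau i != 0 /\ edge_weight i j tau j != 0.
Proof.
move=> ij /andP[t0 t1]; have ji : j != i by rewrite eq_sym.
rewrite /edge_weight !eqxx (negbTE ij) (negbTE ji) !mul0r !mul1r addr0 add0r.
by rewrite !gt_eqF ?subr_gt0.
Qed.

Lemma hull_edge t i j tau : i \in t -> j \in t -> 0 <= tau <= 1 ->
  hull V t ((1 - tau) *: V i + tau *: V j).
Proof.
move=> it jt tau01; exists (edge_weight i j tau); split.
- by move=> x; exact: edge_weight_ge0.
- by move=> x xt; apply: edge_weight_out; apply: contra xt => /eqP ->.
- exact: sum_edge_weight1.
- by rewrite sum_edge_weight.
Qed.

(** A common point has nonzero weight at both ends of e. If one triangle contains both edges,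
    uniqueness of barycentric coordinates makes the ends of e those of e', and the increasing order
    of the indices gives e = e'. Otherwise the triangles meet in the hull of common vertices, which
    must include both ends of e; so e is an edge of the second triangle too, which is the first
    case. *)
Lemma edges_disjoint T e e' (tau tau' : R) : triangulation V T ->
  e \in edges T -> e' \in edges T -> e != e' -> 0 < tau < 1 -> 0 <= tau' <= 1 ->
  (1 - tau) *: V e.1 + tau *: V e.2 <> (1 - tau') *: V e'.1 + tau' *: V e'.2.
Proof.
move=> [Tnd Tint _]; rewrite !inE => /andP[e12 /existsP[t1 /and3P[t1T e1t e2t]]].
move=> /andP[e'12 /existsP[t2 /and3P[t2T e'1t e'2t]]] ee' tau01 tau'01 wE.
have eN : e.1 != e.2 by apply/eqP => h; rewrite h ltnn in e12.
have [w1N0 w2N0] := edge_weight_neq0 eN tau01.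
have tau01' : 0 <= tau <= 1 by case/andP: tau01 => /ltW -> /ltW ->.
have uniq_weight t (b : 'I_n -> R) : t \in T -> e.1 \in t -> e.2 \in t ->
    (forall i, i \notin t -> b i = 0) -> \sum_i b i = 1 ->
    (1 - tau) *: V e.1 + tau *: V e.2 = \sum_i b i *: V i ->
    edge_weight e.1 e.2 tau =1 b.
  move=> tT e1 e2 b0 b1 bE; have [t3 tnc] := Tnd _ tT.
  apply: (barycentric_unique t3 tnc) => //.
  - by move=> i it; apply: edge_weight_out; apply: contra it => /eqP ->.
  - by rewrite sum_edge_weight1 b1.
  - by rewrite sum_edge_weight.
have same t : t \in T -> e.1 \in t -> e.2 \in t -> e'.1 \in t -> e'.2 \in t -> False.
  move=> tT e1 e2 e'1 e'2.
  have weq : edge_weight e.1 e.2 tau =1 edge_weight e'.1 e'.2 tau'.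
    apply: (uniq_weight t) => //.
    - by move=> i it; apply: edge_weight_out; apply: contra it => /eqP ->.
    - exact: sum_edge_weight1.
    - by rewrite sum_edge_weight.
  have mem x : edge_weight e.1 e.2 tau x != 0 -> (x == e'.1) || (x == e'.2).
    rewrite weq; apply: contraR; rewrite negb_or => /andP[x1 x2].
    by rewrite edge_weight_out.
  have := mem _ w1N0; have := mem _ w2N0.
  case/orP => /eqP h2; case/orP => /eqP h1.
  - by rewrite h1 h2 eqxx in eN.
  - by move: e12; rewrite h1 h2 ltnNge (ltnW e'12).
  - by case/negP: ee'; rewrite [e]surjective_pairing [e']surjective_pairing h1 h2.
  - by rewrite h1 h2 eqxx in eN.
have [t12|t12] := eqVneq t1 t2; first by apply: (same t1) => //; rewrite t12.
have h1 : hull V t1 ((1 - tau) *: V e.1 + tau *: V e.2) by exact: hull_edge.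
have h2 : hull V t2 ((1 - tau) *: V e.1 + tau *: V e.2) by rewrite wE; exact: hull_edge.
have h12 := conj h1 h2.
have supp (S : {set 'I_n}) : (S \subset t1) ->
    hull V S ((1 - tau) *: V e.1 + tau *: V e.2) -> (e.1 \in S) && (e.2 \in S).
  move=> St [b [b0 bS b1 bE]].
  have weq : edge_weight e.1 e.2 tau =1 b.
    apply: (uniq_weight t1) => // i it; apply: bS; apply: contra it.
    by move/fintype.subsetP : St; exact.
  apply/andP; split; first by apply: contraNT w1N0 => /bS; rewrite weq => ->.
  by apply: contraNT w2N0 => /bS; rewrite weq => ->.
case: (Tint _ _ t1T t2T t12) => [h0|[i it h0]|[i [j [ij it jt h0]]]].
- by have : set0 ((1 - tau) *: V e.1 + tau *: V e.2) by rewrite -h0.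
- have : (e.1 \in [set i]%SET) && (e.2 \in [set i]%SET).
    apply: supp; last by rewrite -h0.
    by rewrite finset.sub1set; move: it; rewrite inE => /andP[].
  by rewrite !inE => /andP[/eqP h /eqP h']; rewrite h h' eqxx in eN.
- move: it jt; rewrite !inE => /andP[i1 i2] /andP[j1 j2].
  have : (e.1 \in [set i; j]%SET) && (e.2 \in [set i; j]%SET).
    apply: supp; last by rewrite -h0.
    by apply/fintype.subsetP => x; rewrite !inE => /orP[] /eqP ->.
  rewrite !inE => /andP[m1 m2]; apply: (same t2) => //.
    by case/orP: m1 => /eqP ->.
  by case/orP: m2 => /eqP ->.
Qed.

(** Along another edge with parameter tau, A + B tau is the ordinate and s = C + D tau the abscissa
    relative to the given edge. At a zero of the ordinate s (L - s) is nonpositive, and from there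
    it grows at most linearly, as the ordinate does; without a zero the ordinate is bounded away
    from 0. *)
Lemma lens_exists (A B C D L : R) : 0 < L ->
  (forall tau, 0 <= tau <= 1 -> A + B * tau = 0 -> ~ (0 < C + D * tau < L)) ->
  exists2 c : R, 0 < c & forall tau, 0 <= tau <= 1 ->
    c * ((C + D * tau) * (L - (C + D * tau))) <= `|A + B * tau|.
Proof.
move=> L0 H.
have nonpos tau : 0 <= tau <= 1 -> A + B * tau = 0 -> (C + D * tau) * (L - (C + D * tau)) <= 0.
  move=> t01 /(H _ t01)/negP; rewrite negb_and -!leNgt => /orP[h|h].
    by rewrite mulr_le0_ge0//; lra.
  by rewrite mulr_ge0_le0//; lra.
have [[t0 t001 t0E]|noroot] := pselect (exists2 t0, 0 <= t0 <= 1 & A + B * t0 = 0).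
- have [B0|B0] := eqVneq B 0.
    exists 1 => // tau tau01; rewrite mul1r.
    have A0 : A = 0 by move: t0E; rewrite B0 mul0r addr0.
    by apply: le_trans (normr_ge0 _); apply: nonpos => //; rewrite A0 B0 mul0r addr0.
  pose s0 := C + D * t0.
  (* Bounds the growth of s (L - s) from tau = t0, relative to |tau - t0| <= 1; the added 1 makes K
     positive. *)
  pose K := `|D| * (L + 2 * `|s0| + `|D|) + 1.
  have K0 : 0 < K.
    by rewrite ltr_wpDl// mulr_ge0// !addr_ge0// ?ltW// mulr_ge0.
  exists (`|B| / K) => [|tau tau01]; first by rewrite divr_gt0// normr_gt0.
  have -> : A + B * tau = B * (tau - t0) by move: t0E; lra.
  rewrite normrM -mulrA ler_wpM2l// ler_pdivrMl//.
  have -> : C + D * tau = s0 + D * (tau - t0) by rewrite /s0; ring.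
  have np : s0 * (L - s0) <= 0 by exact: nonpos.
  have dt1 : `|tau - t0| <= 1.
    by rewrite ler_norml; move: tau01 t001 => /andP[? ?] /andP[? ?]; apply/andP; split; lra.
  have -> : (s0 + D * (tau - t0)) * (L - (s0 + D * (tau - t0))) =
     s0 * (L - s0) + D * (tau - t0) * (L - 2 * s0 - D * (tau - t0)) by ring.
  apply: (@le_trans _ _ (`|D * (tau - t0) * (L - 2 * s0 - D * (tau - t0))|)).
    by rewrite (le_trans _ (ler_norm _))// gerDr.
  rewrite normrM normrM -mulrA mulrCA mulrC ler_wpM2r//.
  rewrite /K (@le_trans _ _ (`|D| * (L + 2 * `|s0| + `|D|)))// ?lerDl// ler_wpM2l//.
  apply: (le_trans (ler_normB _ _)); apply: lerD.
    apply: (le_trans (ler_normB _ _)); rewrite gtr0_norm// lerD2l normrM.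
    by rewrite ger0_norm.
  by rewrite normrM ler_piMr.
(* Without a root in [0, 1] the end values A and A + B have the same sign. *)
- have AAB : 0 < A * (A + B).
    rewrite ltNge; apply/negP => AAB; apply: noroot.
    have [A0|A0] := eqVneq A 0; first by exists 0; rewrite ?lexx ?ler01// A0 mulr0 addr0.
    have A2 : 0 < A ^+ 2 by rewrite exprn_even_gt0.
    have AB : A * B <= - A ^+ 2 by move: AAB; rewrite mulrDr expr2; lra.
    have AB0 : A * B < 0 by lra.
    have B0 : B != 0 by apply: contraTneq AB0 => ->; rewrite mulr0 ltxx.
    exists (- A / B); last by rewrite mulrC divfK//; ring.
    have -> : - A / B = A ^+ 2 / - (A * B) by field; rewrite B0 A0.
    have nAB : 0 < - (A * B) by rewrite oppr_gt0.
    rewrite divr_ge0 ?(ltW A2) ?(ltW nAB)//= ler_pdivrMr// mul1r; lra.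
  pose m := Num.min `|A| `|A + B|.
  have A0 : A != 0 by apply: contraTneq AAB => ->; rewrite mul0r ltxx.
  have AB0 : A + B != 0 by apply: contraTneq AAB => ->; rewrite mulr0 ltxx.
  have m0 : 0 < m by rewrite lt_min !normr_gt0 A0 AB0.
  (* s (L - s) is at most L^2 / 4, and |A + B tau| is at least m. *)
  exists (m / L ^+ 2) => [|tau /andP[tau0 tau1]]; first by rewrite divr_gt0// exprn_gt0.
  apply: (@le_trans _ _ m).
    rewrite -mulrA ler_piMr ?(ltW m0)// ler_pdivrMl ?exprn_gt0// mulr1.
    have := sqr_ge0 (C + D * tau - L / 2); have := sqr_ge0 L.
    by rewrite !expr2; lra.
  have mA : m <= `|A| by rewrite ge_min lexx.
  have mAB : m <= `|A + B| by rewrite ge_min lexx orbT.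
  have -> : A + B * tau = (1 - tau) * A + tau * (A + B) by ring.
  move: (A0); rewrite neq_lt => /orP[An|Ap].
    have ABn : A + B < 0 by move: AAB; rewrite nmulr_rgt0.
    rewrite (ltr0_norm An) in mA; rewrite (ltr0_norm ABn) in mAB.
    rewrite -normrN (le_trans _ (ler_norm _))//.
    have := ler_wpM2l tau0 mAB; have := @ler_wpM2l _ (1 - tau) _ _ _ mA.
    by rewrite subr_ge0 => /(_ tau1); lra.
  have ABp : 0 < A + B by move: AAB; rewrite pmulr_rgt0.
  rewrite (gtr0_norm Ap) in mA; rewrite (gtr0_norm ABp) in mAB.
  rewrite (le_trans _ (ler_norm _))//.
  have := ler_wpM2l tau0 mAB; have := @ler_wpM2l _ (1 - tau) _ _ _ mA.
  by rewrite subr_ge0 => /(_ tau1); lra.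
Qed.

End Geometry.

(** * Continuously differentiable extension of a network *)

Section PlaneC1.
Variable R : realType.
Implicit Types (F G : R * R -> R) (w g h : R * R).

Definition dot g h : R := g.1 * h.1 + g.2 * h.2.

(** Frechet differentiability brings the calculus rules; [has_grad_gradient] passes to the relative
    notion, which is used for functions glued from pieces. *)
Definition has_grad F w g := is_diff w F (dot g).

Lemma fst_is_diff w : is_diff w (fst : R * R -> R) fst.
Proof.
apply: DiffDef; first by apply: (@linear_differentiable _ _ _ fst) => x; exact: cvg_fst.
by apply: (@diff_lin _ _ _ fst) => x; exact: cvg_fst.
Qed.

Lemma snd_is_diff w : is_diff w (snd : R * R -> R) snd.
Proof.
apply: DiffDef; first by apply: (@linear_differentiable _ _ _ snd) => x; exact: cvg_snd.
by apply: (@diff_lin _ _ _ snd) => x; exact: cvg_snd.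
Qed.

Lemma has_grad_eq F w g g' : g = g' -> has_grad F w g -> has_grad F w g'.
Proof. by move=> ->. Qed.

Lemma has_grad_gradient F w g D : has_grad F w g -> has_gradient_on D F w g.
Proof.
move=> [dF dFE] eps eps0; rewrite near_withinE.
have /eqaddoP/(_ _ eps0) := diff_locally dF.
move=> /nbhs_normP[d /= d0 H]. apply: (proj2 (@nbhs_normP R (R * R)%type w _)); exists d => //= w' w'd _.
have := H (w' - w); rewrite /= sub0r normrN distrC => /(_ w'd).
by rewrite /= dFE /dot /= !fctE /= subrK opprD addrA.
Qed.

Lemma has_grad_affine a b c w : has_grad (fun w' => a + b * w'.1 + c * w'.2) w (b, c).
Proof.
have d1 := fst_is_diff w; have d2 := snd_is_diff w.
apply: (is_diff_eq (is_diffD (is_diffD (is_diff_cst a w) (is_diffZ b d1)) (is_diffZ c d2))).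
by apply/funext => h; rewrite /dot !fctE/= add0r.
Qed.

Lemma has_gradD F G w g h : has_grad F w g -> has_grad G w h ->
  has_grad (fun w => F w + G w) w (g + h).
Proof.
move=> dF dG; apply: (is_diff_eq (is_diffD dF dG)).
by apply/funext => k; rewrite /dot fctE/=; ring.
Qed.

Lemma has_gradM F G w g h : has_grad F w g -> has_grad G w h ->
  has_grad (fun w => F w * G w) w (F w *: h + G w *: g).
Proof.
move=> dF dG; apply: (is_diff_eq (is_diffM dF dG)).
by apply/funext => k; rewrite /dot !fctE/= /GRing.scale/=; ring.
Qed.

Lemma has_grad_comp (f : R -> R) F (df : R) w g : has_grad F w g ->
  is_derive (F w) 1 f df -> has_grad (f \o F) w (df *: g).
Proof.
move=> dF [df1 dfE].
have dd : is_diff (F w) f (fun k => k * df).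
  apply: DiffDef; first exact/derivable1_diffP.
  by apply/funext => k; rewrite -dfE -derive1E diff1E//; exact/derivable1_diffP.
apply: (is_diff_eq (is_diff_comp dF dd)).
by apply/funext => k; rewrite /dot/= /GRing.scale/=; ring.
Qed.

Lemma has_gradient_onD D F G w g h : has_gradient_on D F w g -> has_gradient_on D G w h ->
  has_gradient_on D (fun w => F w + G w) w (g + h).
Proof.
move=> dF dG eps e0; have e20 : 0 < eps / 2 by rewrite divr_gt0.
apply: filterS2 (dF _ e20) (dG _ e20) => w' hF hG.
apply: (@le_trans _ _ (eps / 2 * `|w' - w| + eps / 2 * `|w' - w|)); last first.
  by rewrite -mulrDl -splitr.
apply: le_trans (lerD hF hG); apply: le_trans (ler_normD _ _).
rewrite le_eqVlt; apply/orP; left; apply/eqP.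
by congr `|_|; rewrite /=; ring.
Qed.

Lemma has_gradient_on_near D F G w g : (\forall w' \near w, F w' = G w') ->
  has_gradient_on D F w g -> has_gradient_on D G w g.
Proof.
move=> FG dF eps e0; have FGw : F w = G w := nbhs_singleton FG.
have := dF _ e0; rewrite !near_withinE => H.
by apply: filterS2 FG H => w' <-; rewrite FGw.
Qed.

Lemma has_gradient_on0 D F w g : has_gradient_on setT F w g -> has_gradient_on D F w g.
Proof.
move=> dF eps e0; have := dF _ e0; rewrite !near_withinE.
by apply: filterS => w' /(_ Logic.I).
Qed.

Definition C1_plane F := exists2 G : R * R -> R * R, continuous G &
  forall w, has_gradient_on setT F w (G w).

Lemma C1_plane_on D F : C1_plane F -> C1_on D F.
Proof.
move=> [G cG dF]; exists G; first exact: continuous_subspaceT.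
by move=> w _; exact: has_gradient_on0.
Qed.

Lemma C1_planeD F G : C1_plane F -> C1_plane G -> C1_plane (fun w => F w + G w).
Proof.
move=> [f cf dF] [g cg dG]; exists (fun w => f w + g w).
  by move=> w; apply: cvgD; [exact: cf|exact: cg].
by move=> w; apply: has_gradient_onD.
Qed.

Lemma C1_plane0 : C1_plane (fun=> 0).
Proof.
exists (fun=> 0); first exact: cst_continuous.
by move=> w eps e0; apply: nearW => w'; rewrite /= !mul0r addr0 !subr0 normr0 mulr_ge0// ltW.
Qed.

Lemma C1_plane_sum (I : Type) (s : seq I) (F : I -> R * R -> R) :
  (forall i, C1_plane (F i)) -> C1_plane (fun w => \sum_(i <- s) F i w).
Proof.
move=> C1F; elim: s => [|i s ih].
  rewrite (_ : (fun _ => _) = fun=> 0); first exact: C1_plane0.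
  by apply/funext => w; rewrite big_nil.
rewrite (_ : (fun _ => _) = (fun w => F i w + \sum_(j <- s) F j w)).
  exact: C1_planeD.
by apply/funext => w; rewrite big_cons.
Qed.

End PlaneC1.

(** * A continuously differentiable cutoff function *)

Section Cutoff.
Variable R : realType.
Implicit Types (x s t L c : R) (w : R * R).

Definition pos x : R := Num.max 0 x.

(** Squaring the positive part makes it C^1 at the ends of its support [-1, 1]. *)
Definition cutoff x : R := pos (1 - x ^+ 2) ^+ 2.

Definition dcutoff x : R := - 4 * x * pos (1 - x ^+ 2).

Lemma pos_ge0 x : 0 <= pos x. Proof. by rewrite /pos le_max lexx. Qed.

Lemma pos_id x : 0 <= x -> pos x = x. Proof. by move=> ?; rewrite /pos max_r. Qed.

Lemma pos0 x : x <= 0 -> pos x = 0. Proof. by move=> ?; rewrite /pos max_l. Qed.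

Lemma pos_continuous : continuous pos.
Proof.
move=> x; rewrite (_ : pos = fun x => (x + `|x|) / 2); last first.
  apply/funext => y; have [y0|/ltW y0] := leP 0 y.
    by rewrite pos_id// ger0_norm//; field.
  by rewrite pos0// ler0_norm//; field.
by apply: cvgM; [apply: cvgD; [exact: cvg_id|exact: norm_continuous]|exact: cvg_cst].
Qed.

Lemma is_derive_pos2 x : is_derive x 1 (fun y => pos y ^+ 2) (2 * pos x).
Proof.
have [x0|x0|->] := ltgtP x 0.
- rewrite pos0 ?(ltW x0)// mulr0.
  have d0 := is_derive_cst (0 : R) x (1 : R); apply: near_eq_is_derive d0.
  near=> y; rewrite pos0 ?expr0n//; apply/ltW; near: y; exact: lt_nbhsl.
- rewrite pos_id ?(ltW x0)//.
  have d2 : is_derive x (1 : R) (fun y : R => y ^+ 2) (2 * x).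
    by apply: is_derive_eq; rewrite /GRing.scale/=; ring.
  apply: near_eq_is_derive d2.
  near=> y; rewrite pos_id//; apply/ltW; near: y; exact: lt_nbhsr.
(* The slope of pos^2 from 0 is pos itself, continuous and zero at 0. *)
- rewrite pos_id// mulr0; apply/is_derive1_caratheodory; exists pos; split.
  + move=> z; rewrite (pos_id (lexx 0)) expr0n/= !subr0.
    have [z0|/ltW z0] := leP 0 z; first by rewrite pos_id.
    by rewrite pos0// expr0n mul0r.
  + exact: pos_continuous.
  + exact: pos_id.
Unshelve. all: by end_near. Qed.

Lemma is_derive_cutoff x : is_derive x 1 cutoff (dcutoff x).
Proof.
have d1 : is_derive x 1 (fun y : R => 1 - y ^+ 2) (- (2 * x)).
  by apply: is_derive_eq; rewrite /GRing.scale/=; ring.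
have := @is_derive1_comp _ (fun y => pos y ^+ 2) (fun y => 1 - y ^+ 2) x _ _
  (is_derive_pos2 (1 - x ^+ 2)) d1.
by rewrite (_ : _ * _ = dcutoff x)// /dcutoff; ring.
Qed.

Lemma cutoff_continuous : continuous cutoff.
Proof.
move=> x; apply/differentiable_continuous/derivable1_diffP.
by have [] := is_derive_cutoff x.
Qed.

Lemma dcutoff_continuous : continuous dcutoff.
Proof.
apply: continuousM_fun.
  by apply: continuousM_fun; [exact: cst_continuous|move=> ?; exact: cvg_id].
move=> x; apply: (@continuous_comp _ _ _ (fun x : R => 1 - x ^+ 2) pos); last exact: pos_continuous.
by apply: cvgB; [exact: cvg_cst|exact: exprn_continuous].
Qed.

Lemma cutoff_out x : 1 <= `|x| -> cutoff x = 0.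
Proof.
move=> x1; rewrite /cutoff pos0 ?expr0n// subr_le0 -real_normK ?num_real//.
by rewrite expr_ge1.
Qed.

Lemma dcutoff_out x : 1 <= `|x| -> dcutoff x = 0.
Proof.
move=> x1; rewrite /dcutoff pos0 ?mulr0// subr_le0 -real_normK ?num_real//.
by rewrite expr_ge1.
Qed.

Lemma cutoff0 : cutoff 0 = 1.
Proof. by rewrite /cutoff expr0n/= subr0 pos_id// expr1n. Qed.

Lemma dcutoff0 : dcutoff 0 = 0.
Proof. by rewrite /dcutoff mulr0 mul0r. Qed.

Let pos_le1 x : pos (1 - x ^+ 2) <= 1.
Proof. by rewrite /pos ge_max ler01/= gerBl sqr_ge0. Qed.

Lemma cutoff_le1 x : `|cutoff x| <= 1.
Proof.
by rewrite /cutoff ger0_norm ?sqr_ge0// exprn_ile1// pos_ge0.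
Qed.

Lemma dcutoff_le x : `|dcutoff x| <= 4.
Proof.
have [x1|x1] := leP 1 `|x|; first by rewrite dcutoff_out// normr0.
rewrite /dcutoff !normrM normrN [`|4|]ger0_norm// -[leRHS]mulr1 -mulrA ler_pM2l//.
by rewrite mulr_ile1// ?(ltW x1)// ger0_norm ?pos_ge0.
Qed.

Lemma xdcutoff_le x : `|x * dcutoff x| <= 4.
Proof.
have [x1|x1] := leP 1 `|x|; first by rewrite dcutoff_out// mulr0 normr0.
rewrite normrM -[leRHS]mul1r ler_pM// ?dcutoff_le// ltW//.
Qed.

End Cutoff.

(** * Functions carried by a lens *)

Section Lens.
Variable R : realType.
Variables (r dr : R -> R) (L c : R) (a0 a1 a2 b0 b1 b2 : R).
Implicit Types (s t : R) (w : R * R).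
Hypotheses (L0 : 0 < L) (c0 : 0 < c).
Hypothesis rD : forall s, 0 <= s <= L -> is_derive s 1 r (dr s).
Hypothesis drC : forall s, 0 <= s <= L -> {for s, continuous dr}.
Hypotheses (r0 : r 0 = 0) (dr0 : dr 0 = 0) (rL : r L = 0) (drL : dr L = 0).

Definition affine_form (x y z : R) w := x + y * w.1 + z * w.2.

Let S := affine_form a0 a1 a2.
Let T := affine_form b0 b1 b2.
Let wd s := c * (s * (L - s)).

(** S and T are the abscissa and ordinate relative to the edge; the half-width [wd] of the lens
    vanishes at s = 0 and s = L. *)
Definition lens w : R := if 0 < S w < L then r (S w) * cutoff (T w / wd (S w)) else 0.

Let wd_gt0 s : 0 < s < L -> 0 < wd s.
Proof. by move=> /andP[s0 sL]; rewrite !mulr_gt0// subr_gt0. Qed.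

(** The partial derivatives in S and T, with x = T / wd kept as a block because x [dcutoff] x is
    bounded although 1 / wd is not. *)
Let gS w : R := if 0 < S w < L then
  dr (S w) * cutoff (T w / wd (S w)) -
  r (S w) / wd (S w) * (c * (L - 2 * S w)) * (T w / wd (S w) * dcutoff (T w / wd (S w))) else 0.

Let gT w : R := if 0 < S w < L then
  r (S w) / wd (S w) * dcutoff (T w / wd (S w)) else 0.

Let S_continuous x y z : continuous (affine_form x y z).
Proof.
apply: continuousD_fun; first apply: continuousD_fun.
- exact: cst_continuous.
- by apply: continuousM_fun; [exact: cst_continuous|move=> ?; exact: cvg_fst].
- by apply: continuousM_fun; [exact: cst_continuous|move=> ?; exact: cvg_snd].
Qed.

Let inside w : 0 < S w < L -> \forall w' \near w, 0 < S w' < L.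
Proof.
move=> /andP[s0 sL].
have h1 := cvgr_gt (S w) (@S_continuous a0 a1 a2 w) _ s0.
have h2 := cvgr_lt (S w) (@S_continuous a0 a1 a2 w) _ sL.
near=> w'; apply/andP; split; near: w'; [exact: h1|exact: h2].
Unshelve. all: by end_near. Qed.

Let wd_derive s : is_derive s 1 wd (c * (L - 2 * s)).
Proof. by rewrite /wd; apply: is_derive_eq; rewrite /GRing.scale/=; ring. Qed.

Lemma lens_has_gradient_inside w : 0 < S w < L ->
  has_gradient_on setT lens w (gS w *: (a1, a2) + gT w *: (b1, b2)).
Proof.
move=> ins; have wd0 := wd_gt0 ins.
have insle : 0 <= S w <= L by case/andP: ins => /ltW -> /ltW ->.
pose F w := r (S w) * cutoff (T w * (wd (S w))^-1).
apply: (@has_gradient_on_near _ _ F).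
  by apply: filterS (inside ins) => w' ins'; rewrite /lens ins'.
apply: has_grad_gradient.
have dS : has_grad S w (a1, a2) by exact: has_grad_affine.
have dT : has_grad T w (b1, b2) by exact: has_grad_affine.
have dV : is_derive (S w) 1 (fun s => (wd s)^-1) (- (wd (S w)) ^- 2 *: (c * (L - 2 * S w))).
  by apply: (@is_deriveV _ wd (S w) (c * (L - 2 * S w)) 1) => //; rewrite gt_eqF.
have dq := has_gradM dT (has_grad_comp dS dV).
have db := has_grad_comp dq (is_derive_cutoff _).
have := has_gradM (has_grad_comp dS (rD insle)) db.
apply: has_grad_eq; rewrite /gS /gT ins.
have wdN : wd (S w) != 0 by rewrite gt_eqF.
rewrite /=; move: (wd (S w)) wdN => W WN.
by congr pair; rewrite /= /GRing.scale/= /GRing.scale/=; field.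
Qed.

Let near_end s0 : 0 <= s0 <= L -> r s0 = 0 -> dr s0 = 0 -> forall e, 0 < e ->
  exists2 d : R, 0 < d & forall s, `|s - s0| < d -> `|r s| <= e * `|s - s0| /\ `|dr s| <= e.
Proof.
move=> s0L rs0 drs0 e e0.
have := rD s0L; rewrite drs0 => /is_derive1_caratheodory[g [rE cg g0]].
have [d1 /= d10 h1] : \forall s \near s0, `|g s| <= e.
  have := cg; rewrite /prop_for /continuous_at g0 => /cvgrPdist_le/(_ _ e0).
  by apply: filterS => s; rewrite sub0r normrN.
have [d2 /= d20 h2] : \forall s \near s0, `|dr s| <= e.
  have := drC s0L; rewrite /prop_for /continuous_at drs0 => /cvgrPdist_le/(_ _ e0).
  by apply: filterS => s; rewrite sub0r normrN.
exists (Num.min d1 d2) => [|s]; first by rewrite lt_min d10.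
rewrite lt_min distrC => /andP[sd1 sd2]; split; last exact: h2.
have := rE s; rewrite rs0 subr0 => ->; rewrite normrM [`|s0 - s|]distrC ler_wpM2r//.
exact: h1.
Qed.

Let near0 e : 0 < e -> exists2 d : R, 0 < d & forall s, 0 < s -> s < d -> s < L ->
  `|r s| <= e * s /\ `|dr s| <= e.
Proof.
have L00 : 0 <= (0 : R) <= L by rewrite lexx ltW.
move=> e0; have [d d0 H] := near_end L00 r0 dr0 e0; exists d => // s s0 sd _.
by have := H s; rewrite subr0 gtr0_norm//; exact.
Qed.

Let nearL e : 0 < e -> exists2 d : R, 0 < d & forall s, 0 < L - s -> L - s < d -> 0 < s ->
  `|r s| <= e * (L - s) /\ `|dr s| <= e.
Proof.
have LLL : 0 <= L <= L by rewrite lexx ltW.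
move=> e0; have [d d0 H] := near_end LLL rL drL e0; exists d => // s s0 sd _.
by have := H s; rewrite distrC gtr0_norm//; exact.
Qed.

Let near_ends e : 0 < e -> exists2 d : R, 0 < d & forall s, 0 < s < L ->
  Num.min s (L - s) < d -> `|r s| <= e * Num.min s (L - s) /\ `|dr s| <= e.
Proof.
move=> e0; have [d1 d10 h1] := near0 e0; have [d2 d20 h2] := nearL e0.
exists (Num.min d1 d2) => [|s /andP[s0 sL]]; first by rewrite lt_min d10.
have Ls0 : 0 < L - s by rewrite subr_gt0.
rewrite lt_min => /andP[sd1 sd2]; move: sd1 sd2.
by case: (leP s (L - s)) => _ sd1 sd2; [exact: h1|exact: h2].
Qed.

Let K := `|a1| + `|a2| + 1.

Let K0 : 0 < K. Proof. by rewrite ltr_wpDl// addr_ge0. Qed.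

Let S_lip w w' : `|S w' - S w| <= K * `|w' - w|.
Proof.
have -> : S w' - S w = a1 * (w' - w).1 + a2 * (w' - w).2 by rewrite /S /affine_form/=; ring.
have n1 : `|(w' - w).1| <= `|w' - w| by rewrite [leRHS]/Num.norm/= le_max lexx.
have n2 : `|(w' - w).2| <= `|w' - w| by rewrite [leRHS]/Num.norm/= le_max lexx orbT.
rewrite (le_trans (ler_normD _ _))// !normrM.
have := ler_wpM2l (normr_ge0 a1) n1; have := ler_wpM2l (normr_ge0 a2) n2.
by have := normr_ge0 (w' - w); rewrite /K !mulrDl mul1r; lra.
Qed.

Let outside_dist w w' : ~~ (0 < S w < L) -> 0 < S w' < L ->
  Num.min (S w') (L - S w') <= K * `|w' - w|.
Proof.
rewrite negb_and -!leNgt => out /andP[s0 sL].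
have := S_lip w w'; rewrite ler_norml => /andP[h1 h2].
case/orP: out => out.
  by rewrite ge_min; apply/orP; left; move: h2; lra.
by rewrite ge_min; apply/orP; right; move: h1; lra.
Qed.

(** |lens w'| <= |r (S w')| is small compared with the distance from S w' to the nearer end, which
    is at most K |w' - w| because w lies outside the strip. *)
Lemma lens_has_gradient_outside w : ~~ (0 < S w < L) -> has_gradient_on setT lens w 0.
Proof.
move=> out e e0.
have eK : 0 < e / K by rewrite divr_gt0.
have [d d0 H] := near_ends eK.
rewrite near_withinE; apply: (proj2 (@nbhs_normP R (R * R)%type w _)).
exists (d / K); first by rewrite /= divr_gt0.
move=> w' /=; rewrite distrC => w'd _; rewrite !mul0r addr0 subr0.
rewrite {2}/lens (negbTE out) subr0 /lens.
case: ifPn => [ins|_]; last by rewrite normr0 mulr_ge0// ltW.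
have mK := outside_dist out ins.
have md : Num.min (S w') (L - S w') < d.
  by apply: (le_lt_trans mK); rewrite mulrC -ltr_pdivlMr.
have [h1 _] := H _ ins md.
rewrite normrM; apply: (@le_trans _ _ (`|r (S w')| * 1)).
  by rewrite ler_wpM2l// cutoff_le1.
rewrite mulr1 (le_trans h1)//.
have := ler_wpM2l (ltW eK) mK.
by rewrite mulrA divfK ?gt_eqF.
Qed.

Let coef_small w e : ~~ (0 < S w < L) -> 0 < e ->
  \forall w' \near w, `|gS w'| <= e /\ `|gT w'| <= e.
Proof.
move=> out e0.
(* From |r| <= e' min(s, L - s) and wd >= c L min(s, L - s) / 2 follows |r / wd| <= 2 e' / (c L).
   Hence |gS| <= e' + 8 e' and |gT| <= 8 e' / (c L). *)
pose e' := Num.min (e / 9) (e * (c * L) / 8).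
have cL0 : 0 < c * L by rewrite mulr_gt0.
have e'0 : 0 < e' by rewrite lt_min !divr_gt0// mulr_gt0.
have e'1 : e' <= e / 9 by rewrite ge_min lexx.
have e'2 : e' <= e * (c * L) / 8 by rewrite ge_min lexx orbT.
have [d d0 H] := near_ends e'0.
apply: (proj2 (@nbhs_normP R (R * R)%type w _)).
exists (d / K); first by rewrite /= divr_gt0.
move=> w' /=; rewrite distrC => w'd; rewrite /gS /gT.
case: ifPn => [ins|_]; last by rewrite normr0 ltW.
have mK := outside_dist out ins.
have md : Num.min (S w') (L - S w') < d.
  by apply: (le_lt_trans mK); rewrite mulrC -ltr_pdivlMr.
have [h1 h2] := H _ ins md.
have wd0 := wd_gt0 ins.
set s := S w' in ins mK md h1 h2 wd0 *; set x := T w' / wd s.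
move: (ins) => /andP[s0 sL].
have q : `|r s / wd s| * (c * L) <= 2 * e'.
  rewrite normrM normfV [`|wd s|]gtr0_norm// mulrAC ler_pdivrMr//.
  have h3 : `|r s| * (c * L) <= e' * Num.min s (L - s) * (c * L).
    by rewrite ler_wpM2r// ltW.
  apply: (le_trans h3).
  have -> : 2 * e' * wd s = e' * c * (2 * (s * (L - s))) by rewrite /wd; ring.
  have -> : e' * Num.min s (L - s) * (c * L) = e' * c * (Num.min s (L - s) * L) by ring.
  rewrite ler_pM2l ?mulr_gt0//.
  case: (leP s (L - s)) => sLs; first by rewrite mulrCA ler_pM2l//; lra.
  by rewrite [s * _]mulrC mulrCA ler_pM2l ?subr_gt0//; lra.
have q2 : `|r s / wd s| * (c * `|L - 2 * s|) <= 2 * e'.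
  apply: le_trans q; rewrite ler_wpM2l// ler_pM2l//.
  by rewrite ler_norml; apply/andP; split; lra.
split.
  apply: (le_trans (ler_normB _ _)).
  have t1 : `|dr s * cutoff x| <= e'.
    rewrite normrM -[leRHS]mulr1 ler_pM ?cutoff_le1//.
  have t2 : `|r s / wd s * (c * (L - 2 * s)) * (x * dcutoff x)| <= 2 * e' * 4.
    rewrite normrM ler_pM ?xdcutoff_le// normrM [`|c * _|]normrM (gtr0_norm c0)//.
  move: t1 t2 e'1; lra.
rewrite normrM; apply: (@le_trans _ _ (`|r s / wd s| * 4)).
  by rewrite ler_wpM2l// dcutoff_le.
by rewrite -(@ler_pM2r _ (c * L))//; move: q e'2; lra.
Qed.

Let gST_continuous : continuous gS /\ continuous gT.
Proof.
suff H w : {for w, continuous gS} /\ {for w, continuous gT} by split=> w; have [] := H w.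
have [ins|out] := boolP (0 < S w < L); last first.
  have gS0 : gS w = 0 by rewrite /gS (negbTE out).
  have gT0 : gT w = 0 by rewrite /gT (negbTE out).
  split; apply/cvgrPdist_le => e e0; apply: filterS (coef_small out e0) => w' [h1 h2].
    by rewrite gS0 sub0r normrN.
  by rewrite gT0 sub0r normrN.
have insle : 0 <= S w <= L by case/andP: ins => /ltW -> /ltW ->.
have wd0 : wd (S w) != 0 by rewrite gt_eqF// wd_gt0.
have cS : S w' @[w' --> w] --> S w := @S_continuous a0 a1 a2 w.
have cT : T w' @[w' --> w] --> T w := @S_continuous b0 b1 b2 w.
have cr : r (S w') @[w' --> w] --> r (S w).
  apply: continuous_comp; first exact: cS.
  by apply/differentiable_continuous/derivable1_diffP; have [] := rD insle.
have cdr : dr (S w') @[w' --> w] --> dr (S w).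
  by apply: continuous_comp; [exact: cS|exact: drC].
have cwd : wd (S w') @[w' --> w] --> wd (S w).
  apply: cvgM; first exact: cvg_cst.
  by apply: cvgM; [exact: cS|apply: cvgB; [exact: cvg_cst|exact: cS]].
have cV : (wd (S w'))^-1 @[w' --> w] --> (wd (S w))^-1 by exact: cvgV.
have cx : T w' / wd (S w') @[w' --> w] --> T w / wd (S w) by exact: cvgM.
have cb : cutoff (T w' / wd (S w')) @[w' --> w] --> cutoff (T w / wd (S w)).
  by apply: (continuous_comp cx); exact: cutoff_continuous.
have cdb : dcutoff (T w' / wd (S w')) @[w' --> w] --> dcutoff (T w / wd (S w)).
  by apply: (continuous_comp cx); exact: dcutoff_continuous.
have near_lim (f g : R * R -> R) : (\forall w' \near w, f w' = g w') ->
    g w' @[w' --> w] --> g w -> {for w, continuous f}.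
  move=> fg gw; rewrite /prop_for /continuous_at (nbhs_singleton fg).
  apply: cvg_trans gw; apply: near_eq_cvg; exact: filterS fg.
split.
  apply: (near_lim _ (fun w => dr (S w) * cutoff (T w / wd (S w)) -
    r (S w) / wd (S w) * (c * (L - 2 * S w)) * (T w / wd (S w) * dcutoff (T w / wd (S w))))).
    by apply: filterS (inside ins) => w' ins'; rewrite /gS ins'.
  apply: cvgB; first exact: cvgM.
  apply: cvgM; last exact: cvgM.
  apply: cvgM; first exact: cvgM.
  apply: cvgM; first exact: cvg_cst.
  apply: cvgB; first exact: cvg_cst.
  by apply: cvgM; [exact: cvg_cst|exact: cS].
apply: (near_lim _ (fun w => r (S w) / wd (S w) * dcutoff (T w / wd (S w)))).
  by apply: filterS (inside ins) => w' ins'; rewrite /gT ins'.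
by apply: cvgM; first exact: cvgM.
Qed.

(** Inside the strip 0 < S < L this is the chain rule. Towards its boundary 1 / wd blows up, and the
    vanishing of both r and dr at 0 and L makes the two coefficients tend to 0. *)
Theorem lens_C1 : C1_plane lens.
Proof.
exists (fun w => gS w *: (a1, a2) + gT w *: (b1, b2)).
  have [cS cT] := gST_continuous.
  by move=> w; apply: cvgD; apply: cvgZl; [exact: cS|exact: cT].
move=> w; have [ins|out] := boolP (0 < S w < L); first exact: lens_has_gradient_inside.
rewrite /gS /gT (negbTE out) !scale0r addr0; exact: lens_has_gradient_outside.
Qed.

Lemma lens_axis w : T w = 0 -> 0 <= S w <= L -> lens w = r (S w).
Proof.
move=> Tw /andP[s0 sL]; rewrite /lens Tw mul0r cutoff0 mulr1.
move: s0; rewrite le_eqVlt => /predU1P[<-|s0]; first by rewrite ltxx r0.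
move: sL; rewrite le_eqVlt => /predU1P[->|sL]; first by rewrite ltxx andbF rL.
by rewrite s0 sL.
Qed.

Lemma lens_out w : c * (S w * (L - S w)) <= `|T w| -> lens w = 0.
Proof.
move=> h; rewrite /lens; case: ifPn => // /wd_gt0 wd0.
rewrite cutoff_out ?mulr0// normrM normfV (gtr0_norm wd0) ler_pdivlMr// mul1r.
exact: h.
Qed.

End Lens.

(** * Explicit gradients and Hermite interpolation at the vertices *)

Section SmoothPlane.
Variable R : realType.
Implicit Types (F : R * R -> R) (G : R * R -> R * R) (w u : R * R).

(** The gradient is carried along as a function so that its values at the vertices can be
    computed. *)
Definition smooth F G := continuous G /\ forall w, has_grad F w (G w).

Lemma smooth_continuous F G : smooth F G -> continuous F.
Proof. by move=> [_ dF] w; apply: differentiable_continuous; have [] := dF w. Qed.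

Lemma smooth_C1 F G : smooth F G -> C1_plane F.
Proof. by move=> [cG dF]; exists G => // w; exact: has_grad_gradient. Qed.

Lemma smooth_affine a b c : smooth (affine_form a b c) (fun=> (b, c)).
Proof. by split; [exact: cst_continuous|move=> w; exact: has_grad_affine]. Qed.

Lemma smoothD F G F' G' : smooth F G -> smooth F' G' ->
  smooth (fun w => F w + F' w) (fun w => G w + G' w).
Proof.
move=> [cG dF] [cG' dF']; split; last by move=> w; exact: has_gradD.
by move=> w; apply: cvgD; [exact: cG|exact: cG'].
Qed.

Lemma smooth0 : smooth (fun=> 0) (fun=> 0).
Proof.
have := smooth_affine 0 0 0; rewrite (_ : affine_form 0 0 0 = fun=> 0)//.
by apply/funext => w; rewrite /affine_form !mul0r !addr0.
Qed.

Lemma smooth_sum (I : Type) (s : seq I) (F : I -> R * R -> R) (G : I -> R * R -> R * R) :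
  (forall i, smooth (F i) (G i)) ->
  smooth (fun w => \sum_(i <- s) F i w) (fun w => \sum_(i <- s) G i w).
Proof.
move=> sF; elim: s => [|i s ih].
  rewrite (_ : (fun _ => _) = fun=> 0); last by apply/funext => w; rewrite big_nil.
  rewrite (_ : (fun _ => _) = fun=> 0); last by apply/funext => w; rewrite big_nil.
  exact: smooth0.
rewrite (_ : (fun _ => _) = (fun w => F i w + \sum_(j <- s) F j w)); last first.
  by apply/funext => w; rewrite big_cons.
rewrite (_ : (fun w => \sum_(j <- i :: s) _) = (fun w => G i w + \sum_(j <- s) G j w)); last first.
  by apply/funext => w; rewrite big_cons.
exact: smoothD.
Qed.

Lemma smoothM F G F' G' : smooth F G -> smooth F' G' ->
  smooth (fun w => F w * F' w) (fun w => F w *: G' w + F' w *: G w).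
Proof.
move=> sF sF'; have cF := smooth_continuous sF; have cF' := smooth_continuous sF'.
case: sF sF' => [cG dF] [cG' dF']; split; last by move=> w; exact: has_gradM.
by move=> w; apply: cvgD; apply: cvgZ; [exact: cF|exact: cG'|exact: cF'|exact: cG].
Qed.

Lemma smooth_comp (f df : R -> R) F G : (forall x : R, is_derive x 1 f (df x)) -> continuous df ->
  smooth F G -> smooth (fun w => f (F w)) (fun w => df (F w) *: G w).
Proof.
move=> dfE cdf sF; have cF := smooth_continuous sF; case: sF => cG dF.
split; last by move=> w; exact: has_grad_comp.
move=> w; apply: cvgZ; last exact: cG.
by apply: (continuous_comp (cF w)); exact: cdf.
Qed.

Lemma smooth_line F G A u (s : R) : smooth F G ->
  is_derive s 1 (fun s => F (A + s *: u)) (dot (G (A + s *: u)) u).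
Proof.
move=> [_ dF].
have dl : is_diff s (fun s : R => A + s *: u) (fun h => h *: u).
  have d1 := is_diff_scalel s u; have d2 := is_diff_cst A s.
  by apply: (is_diff_eq (is_diffD d2 d1)); apply/funext => h; rewrite !fctE add0r.
have [dd ddE] := is_diff_comp dl (dF (A + s *: u)).
apply: DeriveDef; first exact/derivable1_diffP.
by rewrite deriveE// ddE/= scale1r.
Qed.

Lemma smooth_line_continuous F G A u : smooth F G ->
  continuous (fun s : R => dot (G (A + s *: u)) u).
Proof.
move=> [cG _] s; have cl : A + t *: u @[t --> s] --> A + s *: u.
  by apply: cvgD; [exact: cvg_cst|apply: cvgZl; exact: cvg_id].
have cGl : G (A + t *: u) @[t --> s] --> G (A + s *: u) by apply: (continuous_comp cl); exact: cG.
apply: cvgD; apply: cvgM; try exact: cvg_cst.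
  by apply: (continuous_comp cGl); exact: cvg_fst.
by apply: (continuous_comp cGl); exact: cvg_snd.
Qed.

Section VertexInterpolation.
Variables (n : nat) (V : 'I_n -> R * R) (z : 'I_n -> R) (g : 'I_n -> R * R).
Hypothesis Vinj : injective V.

Lemma min_positive (I : finType) (c : I -> R) : (forall i, 0 < c i) ->
  exists2 m : R, 0 < m & forall i, m <= c i.
Proof.
move=> c0; exists (\big[Num.min/1]_i c i).
  by elim/big_ind : _ => // x y x0 y0; rewrite lt_min x0.
by move=> i; apply: bigmin_le_cond.
Qed.

(** The norm on pairs is the maximum norm, so a bound on a distance is a bound on one of the
    coordinates. *)
Lemma vertex_separation : exists2 rho : R, 0 < rho &
  forall i j, i != j -> rho <= `|(V j).1 - (V i).1| \/ rho <= `|(V j).2 - (V i).2|.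
Proof.
pose c (ij : 'I_n * 'I_n) := if ij.1 == ij.2 then 1 else `|V ij.2 - V ij.1|.
have [|m m0 mP] := @min_positive _ c.
  move=> [i j]; rewrite /c/=; case: ifPn => // ij.
  by rewrite normr_gt0 subr_eq0; apply: contra ij => /eqP/Vinj ->.
exists m => // i j ij; have := mP (i, j); rewrite /c/= (negbTE ij).
by rewrite [leRHS]/Num.norm/= le_max => /orP[]; [left|right].
Qed.

(** Each affine function l i, with the required value and gradient at V i, is multiplied by a
    product of cutoffs in the two coordinates. At V i this product is 1 with zero gradient; at any
    other vertex it vanishes with its gradient, as one coordinate is at least rho away. *)
Lemma vertex_interpolant : exists F G, [/\ smooth F G,
  forall i, F (V i) = z i & forall i, G (V i) = g i].
Proof.
have [rho rho0 sep] := vertex_separation.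
pose X i := affine_form (- (V i).1 / rho) rho^-1 0.
pose Y i := affine_form (- (V i).2 / rho) 0 rho^-1.
pose l i := affine_form (z i - dot (g i) (V i)) (g i).1 (g i).2.
pose bx i w := cutoff (X i w); pose b_y i w := cutoff (Y i w).
pose gbx i w : R * R := dcutoff (X i w) *: (rho^-1, 0).
pose gby i w : R * R := dcutoff (Y i w) *: (0, rho^-1).
have sx i : smooth (bx i) (gbx i).
  by apply: smooth_comp; [exact: is_derive_cutoff|exact: dcutoff_continuous|exact: smooth_affine].
have sy i : smooth (b_y i) (gby i).
  by apply: smooth_comp; [exact: is_derive_cutoff|exact: dcutoff_continuous|exact: smooth_affine].
have sl i : smooth (l i) (fun=> ((g i).1, (g i).2)) by exact: smooth_affine.
pose F i w := l i w * (bx i w * b_y i w).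
pose G i w := l i w *: (bx i w *: gby i w + b_y i w *: gbx i w) +
  (bx i w * b_y i w) *: ((g i).1, (g i).2).
have sF i : smooth (F i) (G i) by exact: (smoothM (sl i) (smoothM (sx i) (sy i))).
exists (fun w => \sum_i F i w), (fun w => \sum_i G i w).
have XE i j : X i (V j) = ((V j).1 - (V i).1) / rho by rewrite /X /affine_form; ring.
have YE i j : Y i (V j) = ((V j).2 - (V i).2) / rho by rewrite /Y /affine_form; ring.
have big_le x : rho <= `|x| -> 1 <= `|x / rho|.
  by move=> h; rewrite normrM normfV (gtr0_norm rho0) ler_pdivlMr// mul1r.
have offd i j : i != j -> F i (V j) = 0 /\ G i (V j) = 0.
  move=> ij; rewrite /F /G /bx /b_y /gbx /gby XE YE.
  case: (sep i j ij) => /big_le h.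
    by rewrite (cutoff_out h) (dcutoff_out h) !(mul0r, mulr0, scale0r, scaler0, addr0).
  by rewrite (cutoff_out h) (dcutoff_out h) !(mul0r, mulr0, scale0r, scaler0, addr0).
have lV i : l i (V i) = z i by rewrite /l /affine_form /dot; ring.
have diag i : F i (V i) = z i /\ G i (V i) = g i.
  rewrite /F /G /bx /b_y /gbx /gby XE YE !subrr !mul0r cutoff0 dcutoff0 lV.
  by rewrite !scale0r !scaler0 !mulr1 addr0 scaler0 add0r scale1r -surjective_pairing.
split.
- exact: smooth_sum.
- move=> i; rewrite (bigD1 i)//= big1 ?addr0; first by have [] := diag i.
  by move=> j ji; have [] := offd j i ji.
- move=> i; rewrite (bigD1 i)//= big1 ?addr0; first by have [] := diag i.
  by move=> j ji; have [] := offd j i ji.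
Qed.

End VertexInterpolation.

End SmoothPlane.

(** * Edge coordinates and extension of a network to the plane *)

Section EdgeInterpolation.
Variables (R : realType) (n : nat) (V : 'I_n -> R * R) (T : {set {set 'I_n}}).
Hypotheses (Vinj : injective V) (triV : triangulation V T).
Implicit Types (e : 'I_n * 'I_n) (s tau : R).
Local Notation L := (edge_length V).

Definition edge_dir e : R * R := (L e)^-1 *: (V e.2 - V e.1).

Lemma edges_lt e : e \in edges T -> (e.1 < e.2)%N.
Proof. by rewrite inE => /andP[]. Qed.

Lemma edge_length_gt0 e : e \in edges T -> 0 < L e.
Proof.
move=> /edges_lt e12; rewrite sqrtr_gt0 lt_neqAle addr_ge0 ?sqr_ge0// andbT eq_sym.
rewrite paddr_eq0 ?sqr_ge0// !sqrf_eq0 !subr_eq0; apply/negP => /andP[/eqP h1 /eqP h2].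
have e21 : e.2 = e.1.
  by apply: Vinj; rewrite [LHS]surjective_pairing [RHS]surjective_pairing h1 h2.
by rewrite e21 ltnn in e12.
Qed.

Lemma edge_dir_norm e : e \in edges T -> (edge_dir e).1 ^+ 2 + (edge_dir e).2 ^+ 2 = 1.
Proof.
move=> eT; have L0 := edge_length_gt0 eT; have LN : L e != 0 by rewrite gt_eqF.
rewrite /edge_dir/= /GRing.scale/= !exprMn -mulrDr exprVn.
have -> : ((V e.2).1 - (V e.1).1) ^+ 2 + ((V e.2).2 - (V e.1).2) ^+ 2 = L e ^+ 2.
  by rewrite sqr_sqrtr// addr_ge0 ?sqr_ge0.
by rewrite mulVf// expf_neq0.
Qed.

Lemma edge_pathE e s : edge_path V e s = V e.1 + s *: edge_dir e.
Proof.
rewrite /edge_path /edge_dir scalerA scalerBr scalerBl scale1r.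
by rewrite addrAC addrA.
Qed.

Lemma edge_path0 e : edge_path V e 0 = V e.1.
Proof. by rewrite edge_pathE scale0r addr0. Qed.

Lemma edge_path_end e : e \in edges T -> edge_path V e (L e) = V e.2.
Proof.
move=> /edge_length_gt0 L0; rewrite /edge_path divff ?gt_eqF// subrr scale0r add0r.
by rewrite scale1r.
Qed.

Lemma vertex_on_edge i : exists2 e, e \in edges T & i = e.1 \/ i = e.2.
Proof.
have [Tnd _ /(_ i)[t tT it]] := triV.
have [j jt ji] : exists2 j, j \in t & j != i.
  have [t3 _] := Tnd _ tT.
  have : (0 < #|t :\ i|)%N by have := cardsD1 i t; rewrite t3 it; case: #|_|.
  by case/card_gt0P => j; rewrite !inE => /andP[ji jt]; exists j.
have [ij|ij] := ltnP i j.
  exists (i, j); last by left.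
  by rewrite inE/= ij; apply/existsP; exists t; rewrite tT it.
exists (j, i); last by right.
rewrite inE/= ltn_neqAle ij andbT; apply/andP; split; last first.
  by apply/existsP; exists t; rewrite tT it jt.
by apply: contra ji => /eqP h; apply/eqP/val_inj.
Qed.

(** Together with [edge_ordinate], orthonormal coordinates with origin V e.1 and first axis along e,
    as affine forms with the coefficients that are passed to [lens]. *)
Definition edge_abscissa e := affine_form (- dot (edge_dir e) (V e.1)) (edge_dir e).1 (edge_dir e).2.

Definition edge_ordinate e := affine_form
  ((edge_dir e).2 * (V e.1).1 - (edge_dir e).1 * (V e.1).2) (- (edge_dir e).2) (edge_dir e).1.

Lemma edge_abscissa_path e s : e \in edges T -> edge_abscissa e (edge_path V e s) = s.
Proof.
move=> /edge_dir_norm; rewrite edge_pathE /edge_abscissa; move: (edge_dir e) => u h.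
transitivity (s * (u.1 ^+ 2 + u.2 ^+ 2)); last by rewrite h mulr1.
by rewrite /affine_form /dot/= /GRing.scale/=; ring.
Qed.

Lemma edge_ordinate_path e s : edge_ordinate e (edge_path V e s) = 0.
Proof.
rewrite edge_pathE /edge_ordinate; move: (edge_dir e) => u.
by rewrite /affine_form/= /GRing.scale/=; ring.
Qed.

Lemma edge_coordinatesK e w : e \in edges T -> edge_ordinate e w = 0 ->
  w = edge_path V e (edge_abscissa e w).
Proof.
move=> /edge_dir_norm; rewrite edge_pathE /edge_ordinate /edge_abscissa.
move: (edge_dir e) (V e.1) => u v h; rewrite /affine_form => h0.
rewrite [LHS]surjective_pairing [RHS]surjective_pairing.
rewrite /dot/= /GRing.scale/=; congr pair.
  transitivity (w.1 * (u.1 ^+ 2 + u.2 ^+ 2) + u.2 * (u.2 * v.1 - u.1 * v.2 + - u.2 * w.1 + u.1 * w.2)).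
    by rewrite h0 mulr0 addr0 h mulr1.
  transitivity (v.1 * (u.1 ^+ 2 + u.2 ^+ 2) + (- (u.1 * v.1 + u.2 * v.2) + u.1 * w.1 + u.2 * w.2) * u.1).
    by ring.
  by rewrite h mulr1.
transitivity (w.2 * (u.1 ^+ 2 + u.2 ^+ 2) - u.1 * (u.2 * v.1 - u.1 * v.2 + - u.2 * w.1 + u.1 * w.2)).
  by rewrite h0 mulr0 subr0 h mulr1.
transitivity (v.2 * (u.1 ^+ 2 + u.2 ^+ 2) + (- (u.1 * v.1 + u.2 * v.2) + u.1 * w.1 + u.2 * w.2) * u.2).
  by ring.
by rewrite h mulr1.
Qed.

(** A point of e' with ordinate 0 and abscissa in ]0, L e[ would be interior to e, contrary to
    [edges_disjoint]. So [lens_exists] applies to each pair of edges, and finitely many pairs leave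
    a positive minimum. *)
Lemma uniform_lens : exists2 c : R, 0 < c &
  forall e e' tau, e \in edges T -> e' \in edges T -> e != e' -> 0 <= tau <= 1 ->
  let w := (1 - tau) *: V e'.1 + tau *: V e'.2 in
  c * (edge_abscissa e w * (L e - edge_abscissa e w)) <= `|edge_ordinate e w|.
Proof.
pose P (ee : ('I_n * 'I_n) * ('I_n * 'I_n)) c := ee.1 \in edges T -> ee.2 \in edges T ->
  ee.1 != ee.2 -> forall tau, 0 <= tau <= 1 ->
  let w := (1 - tau) *: V ee.2.1 + tau *: V ee.2.2 in
  c * (edge_abscissa ee.1 w * (L ee.1 - edge_abscissa ee.1 w)) <= `|edge_ordinate ee.1 w|.
have Pex ee : exists c, 0 < c /\ P ee c.
  case: ee => e e'; rewrite /P/=.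
  have [/andP[/andP[eT e'T] ee']|] := boolP ((e \in edges T) && (e' \in edges T) && (e != e')); last first.
    by move=> h; exists 1; split => // eT e'T ee'; rewrite eT e'T ee' in h.
  pose S0 := edge_abscissa e (V e'.1); pose S1 := edge_abscissa e (V e'.2).
  pose T0 := edge_ordinate e (V e'.1); pose T1 := edge_ordinate e (V e'.2).
  have SE tau : edge_abscissa e ((1 - tau) *: V e'.1 + tau *: V e'.2) = S0 + (S1 - S0) * tau.
    by rewrite /S0 /S1 /edge_abscissa /affine_form/= /GRing.scale/=; ring.
  have TE tau : edge_ordinate e ((1 - tau) *: V e'.1 + tau *: V e'.2) = T0 + (T1 - T0) * tau.
    by rewrite /T0 /T1 /edge_ordinate /affine_form/= /GRing.scale/=; ring.
  have L0 := edge_length_gt0 eT.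
  have [|c c0 cP] := @lens_exists _ T0 (T1 - T0) S0 (S1 - S0) (L e) L0.
    move=> tau tau01; rewrite -TE -SE; set w := _ + _ => /(edge_coordinatesK eT) wE.
    move=> /andP[s0 sL]; pose s := edge_abscissa e w.
    have sL01 : 0 < s / L e < 1 by rewrite divr_gt0//= ltr_pdivrMr// mul1r.
    exact: (edges_disjoint Vinj triV eT e'T ee' sL01 tau01 (esym wE)).
  by exists c; split => // _ _ _ tau tau01; rewrite SE TE; exact: cP.
have [c cP] := choice Pex.
have [m m0 mP] := @min_positive _ _ c (fun ee => (cP ee).1).
exists m; first exact: m0.
move=> e e' tau eT e'T ee' tau01 /=; set w := _ + _.
have [_ /(_ eT e'T ee' tau tau01)] := cP (e, e'); rewrite /= -/w => h.
(* Decreasing c lowers the left side where the product is nonnegative; elsewhere any positive c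
   works. *)
have [h0|h0] := leP 0 (edge_abscissa e w * (L e - edge_abscissa e w)).
  by apply: le_trans h; rewrite ler_wpM2r.
by rewrite (le_trans _ (normr_ge0 _))// pmulr_rle0// ltW.
Qed.

Variables (z : 'I_n -> R) (g : 'I_n -> R * R).
Variables (f df : 'I_n * 'I_n -> R -> R).
Hypothesis fD : forall e, e \in edges T -> forall s, 0 <= s <= L e -> is_derive s 1 (f e) (df e s).
Hypothesis dfC : forall e, e \in edges T -> forall s, 0 <= s <= L e -> {for s, continuous (df e)}.
Hypothesis f0 : forall e, e \in edges T -> f e 0 = z e.1.
Hypothesis fL : forall e, e \in edges T -> f e (L e) = z e.2.
Hypothesis df0 : forall e, e \in edges T -> df e 0 = dot (g e.1) (edge_dir e).
Hypothesis dfL : forall e, e \in edges T -> df e (L e) = dot (g e.2) (edge_dir e).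

(** The end conditions on f and df express common tangent planes g; they make each residual vanish
    with its slope at both ends, as [lens_C1] requires. *)
Theorem network_extension : exists F, [/\ C1_plane F, forall i, F (V i) = z i &
  forall e, e \in edges T -> forall s, 0 <= s <= L e -> F (edge_path V e s) = f e s].
Proof.
have [P [G [sP PV GV]]] := vertex_interpolant z g Vinj.
have [c c0 cP] := uniform_lens.
pose p e s := P (edge_path V e s).
pose dp e s := dot (G (edge_path V e s)) (edge_dir e).
have pE e : p e = fun s => P (V e.1 + s *: edge_dir e).
  by apply/funext => t; rewrite /p edge_pathE.
have dpE e : dp e = fun s => dot (G (V e.1 + s *: edge_dir e)) (edge_dir e).
  by apply/funext => t; rewrite /dp edge_pathE.
have pD e s : is_derive s 1 (p e) (dp e s) by rewrite pE dpE; exact: smooth_line sP.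
have dpC e : continuous (dp e) by rewrite dpE; exact: smooth_line_continuous sP.
pose r e s := f e s - p e s; pose dr e s := df e s - dp e s.
pose lens_e e := lens (r e) (L e) c (- dot (edge_dir e) (V e.1)) (edge_dir e).1 (edge_dir e).2
  ((edge_dir e).2 * (V e.1).1 - (edge_dir e).1 * (V e.1).2) (- (edge_dir e).2) (edge_dir e).1.
have r0 e : e \in edges T -> r e 0 = 0 by move=> eT; rewrite /r f0// /p edge_path0 PV subrr.
have rL e : e \in edges T -> r e (L e) = 0.
  by move=> eT; rewrite /r fL// /p edge_path_end// PV subrr.
have C1_lens e : e \in edges T -> C1_plane (lens_e e).
  move=> eT; apply: (@lens_C1 _ (r e) (dr e)) => //.
  - exact: edge_length_gt0.
  - by move=> s sL; apply: is_deriveB; exact: fD.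
  - by move=> s sL; apply: cvgB; [exact: dfC|exact: dpC].
  - exact: r0.
  - by rewrite /dr df0// /dp edge_path0 GV subrr.
  - exact: rL.
  - by rewrite /dr dfL// /dp edge_path_end// GV subrr.
pose F w := P w + \sum_e (if e \in edges T then lens_e e w else 0).
have Fedge e : e \in edges T -> forall s, 0 <= s <= L e -> F (edge_path V e s) = f e s.
  move=> eT s sL; have L0 := edge_length_gt0 eT.
  rewrite /F (bigD1 e)//= eT big1 ?addr0; last first.
    move=> e' e'e; case: ifPn => // e'T; apply: lens_out; first exact: c0.
    apply: cP => //; case/andP: sL => s0 sL.
    by rewrite divr_ge0 ?(ltW L0)//= ler_pdivrMr// mul1r.
  have S_e : edge_abscissa e (edge_path V e s) = s by exact: edge_abscissa_path.
  rewrite /lens_e lens_axis//.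
  - by rewrite -/(edge_abscissa e _) S_e /r /p subrKC.
  - exact: r0.
  - exact: rL.
  - exact: edge_ordinate_path.
  - by rewrite -/(edge_abscissa e _) S_e.
exists F; split => //.
- apply: C1_planeD; first exact: smooth_C1 sP.
  apply: C1_plane_sum => e; have [eT|_] := boolP (e \in edges T); first exact: C1_lens.
  exact: C1_plane0.
(* Every vertex is an end of some edge, so its value is read off there. *)
- move=> i; have [e eT [->|->]] := vertex_on_edge i.
    by rewrite -(edge_path0 e) Fedge ?f0// lexx ltW// edge_length_gt0.
  by rewrite -(edge_path_end eT) Fedge ?fL// lexx ltW// edge_length_gt0.
Qed.

End EdgeInterpolation.

(** * Relative derivatives and integration by parts *)

Section RelativeDerivative.
Variable R : realType.
Implicit Types (a b s l : R) (f g : R -> R).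
Local Notation mu := (@lebesgue_measure R).

(** Unlike [derive_on], which always returns a value, this asserts that the derivative relative to
    [a, b] exists. *)
Definition rel_derive a b f s l := forall eps : R, 0 < eps -> exists2 d : R, 0 < d &
  forall r, a <= r <= b -> `|r - s| < d -> `|f r - f s - l * (r - s)| <= eps * `|r - s|.

(** No point of [a, b] is isolated, which makes limits within it unique; at b the witness is taken
    on the left. *)
Lemma within_punctured_proper a b s : a < b -> a <= s <= b -> ProperFilter (within `[a, b] (s^')).
Proof.
move=> ab /andP[as_ sb]; apply: Build_ProperFilter_ex => P.
move=> /nbhs_ballP[d /= d0 H].
have [sb'|bs] := ltP s b.
  pose r := s + Num.min (d / 2) (b - s).
  have m0 : 0 < Num.min (d / 2) (b - s) by rewrite lt_min subr_gt0 sb' andbT divr_gt0.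
  have m1 : Num.min (d / 2) (b - s) <= d / 2 by rewrite ge_min lexx.
  have m2 : Num.min (d / 2) (b - s) <= b - s by rewrite ge_min lexx orbT.
  exists r; apply: H.
  - by rewrite /ball/= /r opprD addNKr normrN gtr0_norm//; lra.
  - by rewrite /r addrC -subr_eq0 addrK gt_eqF.
  - by rewrite /= in_itv/= /r; apply/andP; split; lra.
have sE : s = b by apply/eqP; rewrite eq_le sb bs.
pose r := s - Num.min (d / 2) (s - a).
have m0 : 0 < Num.min (d / 2) (s - a) by rewrite lt_min subr_gt0 sE ab andbT divr_gt0.
have m1 : Num.min (d / 2) (s - a) <= d / 2 by rewrite ge_min lexx.
have m2 : Num.min (d / 2) (s - a) <= s - a by rewrite ge_min lexx orbT.
exists r; apply: H.
- by rewrite /ball/= /r opprB addrC subrK gtr0_norm//; lra.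
- by rewrite /r -subr_eq0 addrAC subrr sub0r oppr_eq0 gt_eqF.
- by rewrite /= in_itv/= /r; apply/andP; split; lra.
Qed.

Lemma rel_derive_cvg a b f s l : rel_derive a b f s l ->
  (f r - f s) / (r - s) @[r --> within `[a, b] s^'] --> l.
Proof.
move=> H; apply/cvgrPdist_le => e e0; have [d d0 Hd] := H _ e0.
rewrite near_withinE; apply/nbhs_ballP; exists d => //= r rd rs.
rewrite /= in_itv/= => rab.
have rs0 : r - s != 0 by rewrite subr_eq0.
rewrite /ball/= distrC in rd.
have := Hd _ rab rd; rewrite -ler_pdivrMr ?normr_gt0// -normfV -normrM distrC.
apply: le_trans; rewrite le_eqVlt; apply/orP; left; apply/eqP; congr `|_|.
by field.
Qed.

Lemma rel_derive_on a b f s l : a < b -> a <= s <= b -> rel_derive a b f s l ->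
  derive_on a b f s = l.
Proof.
move=> ab sab /rel_derive_cvg H.
have F := within_punctured_proper ab sab.
by apply: cvg_lim => //; exact: Rhausdorff.
Qed.

Lemma is_derive_rel a b f s l : is_derive s 1 f l -> rel_derive a b f s l.
Proof.
move=> /is_derive1_caratheodory[g [fE cg gs]] e e0.
move: cg; rewrite /prop_for /continuous_at gs => /cvgrPdist_le/(_ _ e0).
move=> /nbhs_ballP[d /= d0 H]; exists d => // r _ rd.
have : `|l - g r| <= e by apply: H; rewrite /ball/= distrC.
rewrite fE -mulrBl normrM distrC => h; exact: ler_wpM2r.
Qed.

Lemma rel_is_derive a b f s l : a < s < b -> rel_derive a b f s l -> is_derive s 1 f l.
Proof.
move=> /andP[as_ sb] H; apply/is_derive1_caratheodory.
exists (fun r => if r == s then l else (f r - f s) / (r - s)); split; last by rewrite eqxx.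
- move=> r; case: eqVneq => [->|rs]; first by rewrite !subrr mulr0.
  by rewrite divfK// subr_eq0.
- rewrite /prop_for /continuous_at eqxx; apply/cvgrPdist_le => e e0.
  have [d d0 Hd] := H _ e0.
  near=> r; case: eqVneq => [_|rs]; first by rewrite subrr normr0 ltW.
  have rs0 : r - s != 0 by rewrite subr_eq0.
  have rab : a <= r <= b.
    by apply/andP; split; near: r; [exact: lt_le_nbhsr|exact: lt_le_nbhsl].
  have rd : `|r - s| < d by rewrite distrC; near: r; exact: cvgr_dist_lt.
  have := Hd _ rab rd; rewrite -ler_pdivrMr ?normr_gt0// -normfV -normrM distrC.
  apply: le_trans; rewrite le_eqVlt; apply/orP; left; apply/eqP; congr `|_|.
  by field.
Unshelve. all: by end_near. Qed.

Lemma rel_derive_continuous a b f s l : rel_derive a b f s l ->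
  forall e, 0 < e -> exists2 d : R, 0 < d &
  forall r, a <= r <= b -> `|r - s| < d -> `|f r - f s| <= e.
Proof.
move=> H e e0; have [d d0 Hd] := H _ ltr01.
have l1 : 0 < `|l| + 1 by rewrite ltr_wpDl.
exists (Num.min d (e / (`|l| + 1))) => [|r rab]; first by rewrite lt_min d0 divr_gt0.
rewrite lt_min => /andP[rd re]; have := Hd _ rab rd; rewrite mul1r => h.
have -> : f r - f s = (f r - f s - l * (r - s)) + l * (r - s) by ring.
apply: (le_trans (ler_normD _ _)); rewrite normrM.
apply: (le_trans (lerD h (lexx _))).
move: re; rewrite ltr_pdivlMr// mulrDr mulr1 mulrC => /ltW; lra.
Qed.

Lemma eq_derive_on a b f g s : a <= s <= b -> (forall r, a <= r <= b -> f r = g r) ->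
  derive_on a b f s = derive_on a b g s.
Proof.
move=> sab fg; rewrite /derive_on; congr (lim _).
apply/funext => P; apply/propext; rewrite /= /nbhs/=.
have E r : `[a, b]%classic r -> (f r - f s) / (r - s) = (g r - g s) / (r - s).
  by rewrite /= in_itv/= => rab; rewrite (fg _ rab) (fg _ sab).
have D : (within `[a, b] (s^')) `[a, b]%classic by exact: withinT.
by split=> W; apply: filterS2 W D => r H rab /=; [rewrite -(E _ rab)|rewrite (E _ rab)].
Qed.

Lemma rel_derive_mvt a b f (df : R -> R) : a < b ->
  (forall s, a <= s <= b -> rel_derive a b f s (df s)) ->
  forall u v, a <= u -> u < v -> v <= b ->
  exists2 c, u < c < v & f v - f u = df c * (v - u).
Proof.
move=> ab fD u v au uv vb.
have cf : {within `[u, v], continuous f}.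
  apply/continuous_within_itvP => //.
  have ins s : u <= s <= v -> a <= s <= b.
    by move=> /andP[us sv]; rewrite (le_trans au us) (le_trans sv vb).
  have lim s : u <= s <= v -> forall e, 0 < e -> exists2 d : R, 0 < d &
      forall r, u <= r <= v -> `|r - s| < d -> `|f s - f r| <= e.
    move=> suv e e0; have [d d0 Hd] := rel_derive_continuous (fD _ (ins _ suv)) e0.
    by exists d => // r ruv rd; rewrite distrC Hd// ins.
  split.
  - move=> s; rewrite in_itv/= => /andP[us sv]; apply/cvgrPdist_le => e e0.
    have [|d d0 Hd] := lim s _ _ e0; first by rewrite !ltW.
    near=> r; apply: Hd.
      by apply/andP; split; near: r; [exact: lt_le_nbhsr|exact: lt_le_nbhsl].
    by rewrite distrC; near: r; exact: cvgr_dist_lt.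
  - apply/cvgrPdist_le => e e0; have [|d d0 Hd] := lim u _ _ e0; first by rewrite lexx ltW.
    near=> r; apply: Hd.
      by apply/andP; split; near: r; [exact: nbhs_right_ge|exact: nbhs_right_le].
    near: r; exists d => // r /=; rewrite distrC => + _; exact.
  - apply/cvgrPdist_le => e e0; have [|d d0 Hd] := lim v _ _ e0; first by rewrite lexx ltW.
    near=> r; apply: Hd.
      by apply/andP; split; near: r; [exact: nbhs_left_ge|exact: nbhs_left_le].
    near: r; exists d => // r /=; rewrite distrC => + _; exact.
have fD' x : x \in `]u, v[ -> is_derive x 1 f (df x).
  rewrite in_itv/= => /andP[ux xv].
  apply: (@rel_is_derive a b); first by rewrite (le_lt_trans au ux) (lt_le_trans xv vb).
  by apply: fD; rewrite (ltW (le_lt_trans au ux)) (ltW (lt_le_trans xv vb)).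
by have [c] := MVT uv fD' cf; rewrite in_itv/= => cuv ->; exists c.
Unshelve. all: by end_near. Qed.

Lemma ac_of_lipschitz a b f K : (forall u v, a <= u -> u <= v -> v <= b ->
  `|f v - f u| <= K * (v - u)) -> absolutely_continuous a b f.
Proof.
move=> fK e e0; pose K' := `|K| + 1; have K'0 : 0 < K' by rewrite ltr_wpDl.
exists (e / K') => [|m u v uv _ S]; first by rewrite divr_gt0.
apply: (@le_lt_trans _ _ (\sum_k K' * (v k - u k))).
  apply: ler_sum => k _; have [/andP[au uv'] vb] := uv k.
  apply: (le_trans (fK _ _ au uv' vb)); rewrite ler_wpM2r ?subr_ge0//.
  by rewrite /K' (le_trans (ler_norm _))// lerDl.
by rewrite -mulr_sumr mulrC -ltr_pdivlMr.
Qed.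

Lemma ac_bounded a b f : a <= b -> absolutely_continuous a b f ->
  exists M : R, forall s, a <= s <= b -> `|f s| <= M.
Proof.
move=> ab acf; have := ac_on_systems_continuous (ac_on_systems_clamp ab acf).
move=> cT; have cf : {within `[a, b], continuous (f \o clamp a b)} by exact: continuous_subspaceT.
have /compact_bounded[M [_ H]] := continuous_compact cf (@segment_compact _ a b).
exists (M + 1) => s sab; apply: (H (M + 1)); first by rewrite ltrDl.
by exists s => //=; rewrite clamp_id.
Qed.

Lemma acM_affine a b f (al be : R) : a <= b -> absolutely_continuous a b f ->
  absolutely_continuous a b (fun s => (al + be * s) * f s).
Proof.
move=> ab acf e e0; have [M HM] := ac_bounded ab acf.
have M0 : 0 <= M by apply: le_trans (HM a _); rewrite // lexx ab.
(* A bounds |al + be v k| and B bounds |be f (u k)| in the product rule for increments; the added 1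
   makes them positive. *)
pose A := `|al| + `|be| * (`|a| + `|b|) + 1.
have A0 : 0 < A by rewrite ltr_wpDl// addr_ge0// mulr_ge0// addr_ge0.
pose B := `|be| * M + 1; have B0 : 0 < B by rewrite ltr_wpDl// mulr_ge0.
have e1 : 0 < e / 2 / A by rewrite !divr_gt0.
have [d d0 Hd] := acf _ e1.
exists (Num.min d (e / 2 / B)) => [|m u v uv tri]; first by rewrite lt_min d0 !divr_gt0.
rewrite lt_min => /andP[S1 S2].
have := Hd m u v uv tri S1 => H1.
apply: (@le_lt_trans _ _ (A * (\sum_k `|f (v k) - f (u k)|) + B * (\sum_k (v k - u k)))).
  rewrite !mulr_sumr -big_split/=; apply: ler_sum => k _.
  have [/andP[au uv'] vb] := uv k.
  have -> : (al + be * v k) * f (v k) - (al + be * u k) * f (u k) =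
    (al + be * v k) * (f (v k) - f (u k)) + be * f (u k) * (v k - u k) by ring.
  apply: (le_trans (ler_normD _ _)); rewrite normrM [X in _ + X <= _]normrM; apply: lerD.
    rewrite ler_wpM2r//; apply: (le_trans (ler_normD _ _)); rewrite normrM /A.
    have : `|v k| <= `|a| + `|b|.
      rewrite ler_norml; have := ler_norm (- a); have := ler_norm b; rewrite normrN => ? ?.
      have := normr_ge0 a; have := normr_ge0 b => ? ?.
      by apply/andP; split; lra.
    by move=> /(ler_wpM2l (normr_ge0 be)); lra.
  rewrite [`|v k - u k|]ger0_norm ?subr_ge0// ler_wpM2r ?subr_ge0// normrM /B.
  have : `|f (u k)| <= M by apply: HM; rewrite au (le_trans uv' vb).
  by move=> /(ler_wpM2l (normr_ge0 be)); lra.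
rewrite (splitr e); apply: ltrD.
  by rewrite mulrC -ltr_pdivlMr.
by rewrite mulrC -ltr_pdivlMr.
Qed.

Lemma acB a b f g : absolutely_continuous a b f -> absolutely_continuous a b g ->
  absolutely_continuous a b (fun s => f s - g s).
Proof.
move=> acf acg e e0; have e2 : 0 < e / 2 by rewrite divr_gt0.
have [d1 d10 H1] := acf _ e2; have [d2 d20 H2] := acg _ e2.
exists (Num.min d1 d2) => [|m u v uv tri]; first by rewrite lt_min d10.
rewrite lt_min => /andP[S1 S2].
apply: (@le_lt_trans _ _ (\sum_k `|f (v k) - f (u k)| + \sum_k `|g (v k) - g (u k)|)).
  rewrite -big_split/=; apply: ler_sum => k _.
  have -> : f (v k) - g (v k) - (f (u k) - g (u k)) = (f (v k) - f (u k)) - (g (v k) - g (u k)) by ring.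
  exact: ler_normB.
by rewrite (splitr e) ltrD// ?H1// H2.
Qed.

End RelativeDerivative.

(** * Integration by parts with an absolutely continuous derivative *)

Section IntegralIdentity.
Variable R : realType.
Implicit Types (s x : R) (f d k h : R -> R).
Local Notation mu := (@lebesgue_measure R).

Lemma aeS (P Q : R -> Prop) : (forall x, P x -> Q x) ->
  {ae mu, forall x, P x} -> {ae mu, forall x, Q x}.
Proof. by move=> PQ; apply: filterS => //; exact: (ae_filter_ringOfSetsType mu). Qed.

Lemma aeS2 (P Q S : R -> Prop) : (forall x, P x -> Q x -> S x) ->
  {ae mu, forall x, P x} -> {ae mu, forall x, Q x} -> {ae mu, forall x, S x}.
Proof.
move=> PQ aP aQ; have := @filterI _ _ (ae_filter_ringOfSetsType mu) _ _ aP aQ.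
by apply: aeS => x [Px Qx]; exact: PQ.
Qed.

Lemma aeS3 (P Q S U : R -> Prop) : (forall x, P x -> Q x -> S x -> U x) ->
  {ae mu, forall x, P x} -> {ae mu, forall x, Q x} -> {ae mu, forall x, S x} ->
  {ae mu, forall x, U x}.
Proof.
move=> H aP aQ; apply: aeS2 (aeS2 (fun x Px Qx => conj Px Qx) aP aQ) => x [Px Qx].
exact: H.
Qed.

Lemma ae_open_closed (L : R) (P : R -> Prop) :
  {ae mu, forall x, 0 < x < L -> P x} -> {ae mu, forall x, `[0, L]%classic x -> x != 0 -> x != L -> P x}.
Proof.
apply: aeS => x H; rewrite /= in_itv/= => /andP[x0 xL] xN0 xNL; apply: H.
by rewrite !lt_neqAle x0 xL [0 == _]eq_sym xN0 xNL.
Qed.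

Lemma ae_neq (c : R) : {ae mu, forall x, x != c}.
Proof.
exists [set c]; split => //; first exact: lebesgue_measure_set1.
by move=> x /= /negP; rewrite negbK => /eqP.
Qed.

Lemma ae_itv (L : R) (P : R -> Prop) :
  {ae mu, forall x, 0 < x < L -> P x} -> {ae mu, forall x, `[0, L]%classic x -> P x}.
Proof.
move=> H; apply: aeS3 (ae_open_closed H) (ae_neq 0) (ae_neq L) => x H1 x0 xL xI.
exact: H1.
Qed.

Lemma ac_cint (L : R) d : 0 < L -> absolutely_continuous 0 L d -> exists h,
  [/\ mu.-integrable setT (EFin \o h), forall x, 0 <= x <= L -> d x = d 0 + cint x h &
    {ae mu, forall x, `[0, L]%classic x -> 0 < x < L /\ is_derive x 1 d (h x)}].
Proof.
move=> L0 /(ac_fundamental L0)[h [hint dE hD]]; exists h; split => //.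
- have hI (i : interval R) : mu.-integrable [set` i] (EFin \o h) by exact: integrableS hint.
  have I0 : \int[mu]_(t in `]-oo, 0]) h t = 0.
    by have := dE 0; rewrite lexx (ltW L0) => /(_ isT)/eqP; rewrite -subr_eq0 opprD addNKr oppr_eq0 => /eqP.
  move=> x /andP[x0 xL]; rewrite dE ?x0//; congr (_ + _).
  rewrite /cint -Rintegral_itv_obnd_cbnd// -(@Rintegral_itvB _ h -oo%O (BRight x) 0)//.
  by rewrite I0 subr0.
- by apply: ae_itv; apply: aeS hD => x H x0; split => //; exact: H.
Qed.

Section integration_by_parts.
Variables (L : R) (f d : R -> R).
Hypotheses (L0 : 0 < L) (fD : forall s, 0 <= s <= L -> rel_derive 0 L f s (d s)).
Hypothesis acd : absolutely_continuous 0 L d.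
Let k := derive_on 0 L d.
Hypothesis mk : measurable_fun `[0, L] k.

(** The derivative d is bounded, so f is Lipschitz by the mean value theorem. *)
Lemma ac_primitive : absolutely_continuous 0 L f.
Proof.
have [M HM] := ac_bounded (ltW L0) acd.
apply: (@ac_of_lipschitz _ _ _ _ M) => u v u0; rewrite le_eqVlt => /predU1P[->|uv] vL.
  by rewrite !subrr normr0 mulr0.
have [c /andP[uc cv] ->] := rel_derive_mvt L0 fD u0 uv vL.
rewrite normrM [`|v - u|]gtr0_norm ?subr_gt0// ler_wpM2r ?subr_ge0 ?(ltW uv)//.
by apply: HM; rewrite (le_trans u0 (ltW uc)) (le_trans (ltW cv) vL).
Qed.

Lemma ac_derive_on_ae h : {ae mu, forall x, `[0, L]%classic x -> 0 < x < L /\ is_derive x 1 d (h x)} ->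
  {ae mu, forall x, `[0, L]%classic x -> k x = h x}.
Proof.
apply: aeS => x H xI; have [/andP[x0 xL] dx] := H xI.
by apply: rel_derive_on => //; exact: is_derive_rel.
Qed.

Lemma measurable_affine al be : measurable_fun setT (fun s : R => al + be * s).
Proof.
apply: continuous_measurable_fun; apply: continuousD_fun; first exact: cst_continuous.
by apply: continuousM_fun; [exact: cst_continuous|move=> ?; exact: cvg_id].
Qed.

(** phi = (al + be s) d - be f is absolutely continuous, and its derivative is (al + be s) k almost
    everywhere because the terms be d cancel. Integrability is inherited from the density of phi,
    given that k is measurable. *)
Lemma affine_second_derivative al be :
  mu.-integrable `[0, L] (EFin \o (fun s => (al + be * s) * k s)) /\
  cint L (fun s => (al + be * s) * k s) =
    (al + be * L) * d L - be * f L - (al * d 0 - be * f 0).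
Proof.
pose phi s := (al + be * s) * d s - be * f s.
have acphi : absolutely_continuous 0 L phi.
  apply: acB; first exact: acM_affine (ltW L0) acd.
  have := @acM_affine _ _ _ f be 0 (ltW L0) ac_primitive.
  by rewrite (_ : (fun s => _) = fun s => be * f s)//; apply/funext => s; rewrite mul0r addr0.
have [h [hint hE hD]] := ac_cint L0 acphi.
have [hd [_ _ hdD]] := ac_cint L0 acd.
have hk : {ae mu, forall x, `[0, L]%classic x -> (EFin \o h) x = (EFin \o (fun s => (al + be * s) * k s)) x}.
  apply: aeS2 hD hdD => x H1 H2 xI.
  have [x0L D1] := H1 xI; have [_ D2] := H2 xI.
  have D3 : is_derive x 1 f (d x).
    apply: (rel_is_derive x0L); apply: fD.
    by move: xI; rewrite /= in_itv.
  have kx : k x = hd x.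
    have x0L' : 0 <= x <= L by case/andP: x0L => /ltW -> /ltW ->.
    by apply: (rel_derive_on L0 x0L'); exact: is_derive_rel.
  have D4 : is_derive x 1 phi ((al + be * x) * hd x).
    have Da : is_derive x (1 : R) (fun s : R => al + be * s) be.
      by apply: is_derive_eq; rewrite /GRing.scale/=; ring.
    have Db := is_deriveB (is_deriveM Da D2) (is_deriveZ be D3).
    by apply: (is_derive_eq Db); rewrite /GRing.scale/=; ring.
  by rewrite /= kx; congr EFin; have [_ <-] := D1; have [_ <-] := D4.
have mlk : measurable_fun `[0, L] (EFin \o (fun s => (al + be * s) * k s)).
  apply/measurable_EFinP; apply: measurable_funM => //.
  by apply: measurable_funTS; exact: measurable_affine.
have hint' : mu.-integrable `[0, L] (EFin \o h) by exact: integrableS hint.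
have mh := measurable_int mu hint'.
split.
  apply/integrableP; split => //.
  case/integrableP : hint' => _; apply: le_lt_trans.
  rewrite le_eqVlt; apply/orP; left; apply/eqP; apply: ge0_ae_eq_integral => //.
  - by apply: measurableT_comp mlk => //; exact: measurable_abse.
  - by apply: measurableT_comp mh => //; exact: measurable_abse.
  - by apply: aeS hk => x H xI; rewrite H.
have <- : cint L h = cint L (fun s => (al + be * s) * k s).
  by rewrite /cint /Rintegral; congr fine; apply: ae_eq_integral.
have := hE L; rewrite lexx (ltW L0) => /(_ isT) => /eqP; rewrite addrC -subr_eq => /eqP <-.
by rewrite /phi mulr0 addr0.
Qed.

End integration_by_parts.

Lemma ac_derivative_unique (L : R) d1 d2 : 0 < L ->
  absolutely_continuous 0 L d1 -> absolutely_continuous 0 L d2 ->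
  {ae mu, forall x, `[0, L]%classic x -> derive_on 0 L d1 x = derive_on 0 L d2 x} ->
  forall x, 0 <= x <= L -> d1 x - d1 0 = d2 x - d2 0.
Proof.
move=> L0 ac1 ac2 H x xL.
have [h1 [h1int h1E h1D]] := ac_cint L0 ac1; have [h2 [h2int h2E h2D]] := ac_cint L0 ac2.
rewrite h1E// h2E// ![_ + _ - _]addrAC !subrr !add0r /cint /Rintegral; congr fine.
apply: ae_eq_integral => //.
- by apply: (measurable_int mu); exact: integrableS h1int.
- by apply: (measurable_int mu); exact: integrableS h2int.
have k1 := ac_derive_on_ae L0 h1D; have k2 := ac_derive_on_ae L0 h2D.
apply: aeS3 k1 k2 H => t e1 e2 e3; rewrite /= in_itv/= => /andP[t0 tx].
have tL : `[0, L]%classic t by rewrite /= in_itv/= t0 (le_trans tx)//; case/andP: xL.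
by rewrite -e1// -e2// e3.
Qed.

End IntegralIdentity.

(** * The minimal network *)

Section DualNetwork.
Variables (R : realType) (n : nat) (V : 'I_n -> R * R) (z : 'I_n -> R) (T : {set {set 'I_n}}).
Hypotheses (Vinj : injective V).
Variable q : R.
Hypothesis q1 : 1 < q.
Implicit Types (e : 'I_n * 'I_n) (t : R).

(** Unknowns: the values of l_e at both ends of e, with [true] for e.2. The indices in [H] are the
    gradient components at the vertices, with [true] for the first one. *)
Let K := (('I_n * 'I_n) * bool)%type.
Let H := ('I_n * bool)%type.

(** Pairs that are not edges get length 1, so that positivity and independence hold for every index;
    their entries in [m] and [B] are 0. *)
Let L e := if e \in edges T then edge_length V e else 1.

Let L0 e : 0 < L e.
Proof. by rewrite /L; case: ifPn => // eT; exact: (edge_length_gt0 Vinj eT). Qed.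

Let LE e : e \in edges T -> L e = edge_length V e.
Proof. by rewrite /L => ->. Qed.

Let hat (b : bool) e t : R := if b then t / L e else 1 - t / L e.

Let y (k : 'I_#|{: K}|) e t : R := if e == (enum_val k).1 then hat (enum_val k).2 e t else 0.

Let hat_continuous b e : continuous (hat b e).
Proof.
have c : continuous (fun t => t / L e).
  by apply: continuousM_fun; [move=> ?; exact: cvg_id|exact: cst_continuous].
by case: b => //; apply: continuousB_fun => //; exact: cst_continuous.
Qed.

Let y_continuous k e : continuous (y k e).
Proof. by rewrite /y; case: eqP => _; [exact: hat_continuous|exact: cst_continuous]. Qed.

Let sum_rank (X : finType) (F : 'I_#|{: X}| -> R) : \sum_k F k = \sum_(x : X) F (enum_rank x).
Proof. by rewrite (reindex (@enum_rank X))//; exact/onW_bij/enum_rank_bij. Qed.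

Let sumK (F : 'I_#|{: K}| -> R) :
  \sum_k F k = \sum_e (F (enum_rank (e, true)) + F (enum_rank (e, false))).
Proof.
rewrite sum_rank (eq_bigr (fun x => F (enum_rank (x.1, x.2)))); last by case.
rewrite -(pair_bigA _ (fun e b => F (enum_rank (e, b))))/=.
by apply: eq_bigr => e _; rewrite big_bool.
Qed.

Let sumH (F : 'I_#|{: H}| -> R) :
  \sum_k F k = \sum_i (F (enum_rank (i, true)) + F (enum_rank (i, false))).
Proof.
rewrite sum_rank (eq_bigr (fun x => F (enum_rank (x.1, x.2)))); last by case.
rewrite -(pair_bigA _ (fun i b => F (enum_rank (i, b))))/=.
by apply: eq_bigr => i _; rewrite big_bool.
Qed.

Let linE (l : 'rV_#|{: K}|) e t : lin y l e t =
  l 0 (enum_rank (e, true)) * (t / L e) + l 0 (enum_rank (e, false)) * (1 - t / L e).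
Proof.
rewrite /lin sumK (bigD1 e)//= [X in _ + X]big1 ?addr0; last first.
  move=> e' e'e; rewrite /y !enum_rankK/= eq_sym (negbTE e'e).
  by rewrite !mulr0 addr0.
by rewrite /y !enum_rankK/= eqxx.
Qed.

Let indep (l : 'rV_#|{: K}|) : (forall e t, 0 <= t <= L e -> lin y l e t = 0) -> l = 0.
Proof.
move=> H0; apply/rowP => k; rewrite mxE -(enum_valK k); case: (enum_val k) => e b.
have LN : L e != 0 by rewrite gt_eqF.
have := H0 e 0; rewrite lexx (ltW (L0 e)) linE mul0r mulr0 add0r subr0 mulr1 => /(_ isT) h0.
have := H0 e (L e); rewrite lexx (ltW (L0 e)) linE divff// mulr1 subrr mulr0 addr0 => /(_ isT) h1.
by case: b.
Qed.

Let u e (c : bool) : R := if c then (edge_dir V e).1 else (edge_dir V e).2.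

(** Integration by parts gives the moments of f'' as f'(L) - (f(L) - f(0)) / L against t / L and
    (f(L) - f(0)) / L - f'(0) against 1 - t / L. [m] holds the divided differences, [B] the slopes
    as functions of the gradients. *)
Let m : 'rV[R]_#|{: K}| := \row_k
  let e := (enum_val k).1 in
  if e \in edges T then
    (if (enum_val k).2 then - ((z e.2 - z e.1) / L e) else (z e.2 - z e.1) / L e) else 0.

Let B : 'M[R]_(#|{: H}|, #|{: K}|) := \matrix_(r, k)
  let e := (enum_val k).1 in
  if e \in edges T then
    (if (enum_val k).2 then (e.2 == (enum_val r).1)%:R else - (e.1 == (enum_val r).1)%:R)
      * u e (enum_val r).2
  else 0.

Let sum_delta (i : 'I_n) (F : 'I_n -> R) : \sum_j (i == j)%:R * F j = F i.
Proof.
rewrite (bigD1 i)//= eqxx mul1r big1 ?addr0// => j ji.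
by rewrite eq_sym (negbTE ji) mul0r.
Qed.

(** The multipliers g of [dual_solution] serve as vertex gradients: the first two clauses are the
    moments of a network with values z and gradients g. The third is l *m B^T = 0, tested against
    arbitrary gradients d. *)
Lemma dual_network : exists (a b : 'I_n * 'I_n -> R) (g : 'I_n -> R * R),
  [/\ forall e, e \in edges T -> let len := edge_length V e in
        cint len (fun t => spow (q - 1) (a e * (1 - t / len) + b e * (t / len)) * (1 - t / len))
          = (z e.2 - z e.1) / len - dot (g e.1) (edge_dir V e),
      forall e, e \in edges T -> let len := edge_length V e in
        cint len (fun t => spow (q - 1) (a e * (1 - t / len) + b e * (t / len)) * (t / len))
          = dot (g e.2) (edge_dir V e) - (z e.2 - z e.1) / len &
      forall d : 'I_n -> R * R, \sum_(e in edges T)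
        (b e * dot (d e.2) (edge_dir V e) - a e * dot (d e.1) (edge_dir V e)) = 0].
Proof.
have [l [g [lB lg]]] := dual_solution m q1 L0 y_continuous indep B.
pose a e := l 0 (enum_rank (e, false)); pose b e := l 0 (enum_rank (e, true)).
pose gg i : R * R := (g 0 (enum_rank (i, true)), g 0 (enum_rank (i, false))).
have momE e (bb : bool) : dual_moment L y q l (enum_rank (e, bb)) =
    cint (L e) (fun t => spow (q - 1) (lin y l e t) * hat bb e t).
  rewrite /dual_moment (bigD1 e)//= [X in _ + X]big1 ?addr0.
    by apply: eq_cint => t _; rewrite /y enum_rankK/= eqxx.
  move=> e' e'e; rewrite -[RHS](cint0 (L e')); apply: eq_cint => t _.
  by rewrite /y enum_rankK/= (negbTE e'e) mulr0.
have gB e (bb : bool) : e \in edges T -> (g *m B) 0 (enum_rank (e, bb)) =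
    if bb then dot (gg e.2) (edge_dir V e) else - dot (gg e.1) (edge_dir V e).
  move=> eT; rewrite mxE sumH.
  under eq_bigr do rewrite !mxE !enum_rankK/= eT /u/=.
  case: bb.
    rewrite -(sum_delta e.2 (fun i => dot (gg i) (edge_dir V e))).
    by apply: eq_bigr => i _; rewrite /dot/=; ring.
  rewrite -(sum_delta e.1 (fun i => dot (gg i) (edge_dir V e))) -sumrN.
  by apply: eq_bigr => i _; rewrite /dot/=; ring.
exists a, b, gg; split.
- move=> e eT len; have := lg (enum_rank (e, false)); rewrite momE gB//.
  rewrite mxE enum_rankK/= eT (LE eT) => <-; apply: eq_cint => t _.
  by rewrite linE /hat (LE eT) -/(a e) -/(b e); congr (spow _ _ * _); rewrite addrC.
- move=> e eT len; have := lg (enum_rank (e, true)); rewrite momE gB//.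
  rewrite mxE enum_rankK/= eT (LE eT) => h; rewrite [RHS]addrC -h; apply: eq_cint => t _.
  by rewrite linE /hat (LE eT) -/(a e) -/(b e); congr (spow _ _ * _); rewrite addrC.
- move=> d; pose D : 'rV_#|{: H}| := \row_r
    (if (enum_val r).2 then (d (enum_val r).1).1 else (d (enum_val r).1).2).
  have : \sum_k l 0 k * (D *m B) 0 k = 0.
    have : (l *m (D *m B)^T) 0 0 = 0 by rewrite trmx_mul mulmxA lB mul0mx mxE.
    by rewrite mxE => e; rewrite -[RHS]e; apply: eq_bigr => k _; rewrite [_^T _ _]mxE.
  rewrite sumK => h; rewrite -[RHS]h big_mkcond/=; apply: eq_bigr => e _.
  case: ifPn => eT; last first.
    rewrite !mxE !big1 ?mulr0 ?addr0// => r _; by rewrite !mxE enum_rankK/= (negbTE eT) mulr0.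
  have DB (bb : bool) : (D *m B) 0 (enum_rank (e, bb)) =
    if bb then dot (d e.2) (edge_dir V e) else - dot (d e.1) (edge_dir V e).
    rewrite mxE sumH.
    under eq_bigr do rewrite !mxE !enum_rankK/= eT /u/=.
    case: bb.
      rewrite -(sum_delta e.2 (fun i => dot (d i) (edge_dir V e))).
      by apply: eq_bigr => i _; rewrite /dot/=; ring.
    rewrite -(sum_delta e.1 (fun i => dot (d i) (edge_dir V e))) -sumrN.
    by apply: eq_bigr => i _; rewrite /dot/=; ring.
  by rewrite !DB mulrN.
Qed.

End DualNetwork.

(** * Repeated antiderivatives *)

Section Antiderivative.
Variable R : realType.
Implicit Types (g : R -> R) (s x L : R).
Local Notation mu := (@lebesgue_measure R).

(** Starting at -1 makes the derivative at 0 two-sided; the second integral normalises the value at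
    0. *)
Definition antiderivative g x := \int[mu]_(t in `[-1, x]) g t - \int[mu]_(t in `[-1, 0]) g t.

Lemma antiderivative0 g : antiderivative g 0 = 0.
Proof. exact: subrr. Qed.

Lemma antiderivativeE g L : 0 <= L -> continuous g -> antiderivative g L = cint L g.
Proof.
move=> L0 cg; have cI : mu.-integrable `]0, L] (EFin \o g).
  by apply: integrableS (continuous_integrable_itv 0 L cg) => //; exact: subset_itv_oc_cc.
rewrite /antiderivative /cint -[RHS]Rintegral_itv_obnd_cbnd//.
rewrite (@Rintegral_itvB _ g (BLeft (-1)) (BRight L) 0)//.
- exact: continuous_integrable_itv.
- by rewrite bnd_simp lerN10.
Qed.

Lemma is_derive_antiderivative g x : continuous g -> -1 < x ->
  is_derive x 1 (antiderivative g) (g x).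
Proof.
move=> cg x1; have [] := @continuous_FTC1_closed _ g (-1) x (x + 1) _ _ x1 (cg x).
- by rewrite ltrDl.
- exact: continuous_integrable_itv.
set G := (fun y : R => _) => dG GE.
have D : is_derive x 1 G (g x) by rewrite -GE derive1E; exact/derivableP.
rewrite -[X in is_derive _ _ _ X]subr0.
exact: is_deriveB.
Qed.

(** Cauchy's formula: f s is z + c s plus the integral of (s - t) g t over [0, s], expanded so that
    the integrands are free of s. *)
Lemma double_antiderivative g L (z c : R) : continuous g -> 0 < L -> exists f df : R -> R,
  [/\ forall s, 0 <= s <= L -> is_derive s 1 f (df s),
      forall s, 0 <= s <= L -> is_derive s 1 df (g s),
      f 0 = z /\ df 0 = c,
      f L = z + c * L + cint L (fun t => (L - t) * g t) & df L = c + cint L g].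
Proof.
move=> cg L0; have ctg : continuous (fun t : R => t * g t).
  by apply: continuousM_fun => // ?; exact: cvg_id.
exists (fun s => z + c * s + (s * antiderivative g s - antiderivative (fun t => t * g t) s)).
exists (fun s => c + antiderivative g s); split.
- move=> s /andP[s0 _]; have s1 : -1 < s by rewrite (lt_le_trans _ s0)// ltrN10.
  have D1 := is_derive_antiderivative cg s1; have D2 := is_derive_antiderivative ctg s1.
  by apply: is_derive_eq; rewrite /GRing.scale/=; ring.
- move=> s /andP[s0 _]; have s1 : -1 < s by rewrite (lt_le_trans _ s0)// ltrN10.
  have D1 := is_derive_antiderivative cg s1.
  by apply: (is_derive_eq (is_deriveD (is_derive_cst c s (1 : R)) D1)); rewrite add0r.
- by rewrite !antiderivative0 mulr0 mul0r subr0 !addr0.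
- rewrite !antiderivativeE ?(ltW L0)// -cintZ// -cintB//.
    by congr (_ + _); apply: eq_cint => t _; ring.
  by apply: continuousM_fun => //; exact: cst_continuous.
- by rewrite antiderivativeE ?(ltW L0).
Qed.

End Antiderivative.

(** * The L_p energy and its tangent gap *)

Section Energy.
Variable R : realType.
Implicit Types (L p : R) (k g l : R -> R).
Local Notation mu := (@lebesgue_measure R).

Definition energy p L k := cint L (fun s => `|k s| `^ p).

Lemma in_Lp_integrable p L k : in_Lp p 0 L k ->
  mu.-integrable `[0, L] (EFin \o (fun s => `|k s| `^ p)).
Proof.
move=> [mk fin]; apply/integrableP; split.
  apply/measurable_EFinP.
  apply: (@measurableT_comp _ _ _ _ _ _ (fun x : R => x `^ p)); first exact: measurable_powR.
  exact: measurableT_comp.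
apply: le_lt_trans fin; rewrite le_eqVlt; apply/orP; left; apply/eqP.
by apply: eq_integral => s _; rewrite /= ger0_norm// powR_ge0.
Qed.

Lemma in_Lp_energy p L k : in_Lp p 0 L k ->
  (\int[mu]_(s in `[0%R, L]) (`|k s| `^ p)%:E)%E = (energy p L k)%:E.
Proof.
move=> /in_Lp_integrable ki; rewrite /energy /cint /Rintegral fineK//.
exact: integrable_fin_num.
Qed.

Lemma integrableD_EFin (i : interval R) k g : mu.-integrable [set` i] (EFin \o k) ->
  mu.-integrable [set` i] (EFin \o g) -> mu.-integrable [set` i] (EFin \o (fun s => k s + g s)).
Proof.
move=> ki gi; rewrite (_ : EFin \o _ = (EFin \o k) \+ (EFin \o g))%E; first exact: integrableD.
by apply/funext => s; rewrite /= EFinD.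
Qed.

Lemma integrableZ_EFin (i : interval R) c k : mu.-integrable [set` i] (EFin \o k) ->
  mu.-integrable [set` i] (EFin \o (fun s => c * k s)).
Proof.
move=> ki; rewrite (_ : EFin \o _ = (fun s => c%:E * (EFin \o k) s))%E; first exact: integrableZl.
by apply/funext => s; rewrite /= EFinM.
Qed.

Lemma integrableB_EFin (i : interval R) k g : mu.-integrable [set` i] (EFin \o k) ->
  mu.-integrable [set` i] (EFin \o g) -> mu.-integrable [set` i] (EFin \o (fun s => k s - g s)).
Proof.
move=> ki gi; rewrite (_ : EFin \o _ = (EFin \o k) \- (EFin \o g))%E; first exact: integrableB.
by apply/funext => s; rewrite /= EFinB.
Qed.

Section gap.
Variables (p q L : R) (k l : R -> R).
Hypotheses (p1 : 1 < p) (q1 : 1 < q) (pq : (q - 1) * (p - 1) = 1).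
Hypotheses (kp : in_Lp p 0 L k) (lC : continuous l).
Hypothesis lk : mu.-integrable `[0, L] (EFin \o (fun s => l s * k s)).
Let g s := spow (q - 1) (l s).

Let gC : continuous g.
Proof. by apply: spow_comp_continuous. Qed.

(** As l = [spow] (p - 1) g, this is the height of |k|^p above the tangent to |.|^p at g. It
    integrates to the excess energy of k, corrected by the difference of the works of k and g
    against l. *)
Let gap s := `|k s| `^ p - (`|g s| `^ p + p * (l s * k s - l s * g s)).

Let gapE s : gap s = `|k s| `^ p - (`|g s| `^ p + p * (spow (p - 1) (g s) * (k s - g s))).
Proof. by rewrite /gap /g spowK// [l s * (_ - _)]mulrBr. Qed.

Let gap_ge0 s : 0 <= gap s.
Proof. by rewrite gapE subr_ge0 tangent_powR_le. Qed.

Let gap_eq0 s : gap s = 0 -> k s = g s.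
Proof.
rewrite gapE => /eqP h; apply/eqP; apply: contraTT h => /(tangent_powR p1) h.
by rewrite gt_eqF// subr_gt0.
Qed.

Let i1 := in_Lp_integrable kp.

Let i2 : mu.-integrable `[0, L] (EFin \o (fun s => `|g s| `^ p)).
Proof. by apply: continuous_integrable_itv; exact: powR_norm_continuous. Qed.

Let i3 : mu.-integrable `[0, L] (EFin \o (fun s => l s * g s)).
Proof. by apply: continuous_integrable_itv; exact: continuousM_fun. Qed.

Let i4 : mu.-integrable `[0, L] (EFin \o (fun s => l s * k s - l s * g s)).
Proof. exact: integrableB_EFin. Qed.

Let i5 : mu.-integrable `[0, L] (EFin \o (fun s => p * (l s * k s - l s * g s))).
Proof. exact: integrableZ_EFin. Qed.

Let i6 : mu.-integrable `[0, L] (EFin \o (fun s => `|g s| `^ p + p * (l s * k s - l s * g s))).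
Proof. exact: integrableD_EFin. Qed.

Let i7 : mu.-integrable `[0, L] (EFin \o gap).
Proof. exact: integrableB_EFin. Qed.

Lemma energy_gap : energy p L k - energy p L g
    - p * (cint L (fun s => l s * k s) - cint L (fun s => l s * g s)) = cint L gap.
Proof.
rewrite /energy /cint /gap [RHS]RintegralB// RintegralD// RintegralZl// RintegralB//.
by rewrite opprD addrA.
Qed.

Lemma energy_gap_ge0 : 0 <= energy p L k - energy p L g
    - p * (cint L (fun s => l s * k s) - cint L (fun s => l s * g s)).
Proof. by rewrite energy_gap; apply: cint_ge0 => s _; exact: gap_ge0. Qed.

Lemma energy_gap_eq0 : energy p L k - energy p L g
    - p * (cint L (fun s => l s * k s) - cint L (fun s => l s * g s)) = 0 ->
  {ae mu, forall s, `[0, L]%classic s -> k s = g s}.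
Proof.
rewrite energy_gap => h.
have : (\int[mu]_(s in `[0%R, L]) `|(EFin \o gap) s|)%E = 0%E.
  transitivity (\int[mu]_(s in `[0%R, L]) (EFin \o gap) s)%E.
    by apply: eq_integral => s _; rewrite /= ger0_norm// gap_ge0.
  rewrite -[LHS]fineK; first by congr EFin; exact: h.
  exact: integrable_fin_num.
move/ae_eq_integral_abs => /(_ (measurable_itv _) (measurable_int mu i7)).
by apply: aeS => s H sL; apply: gap_eq0; have /= := H sL => -[].
Qed.

End gap.
End Energy.

(** * Existence and uniqueness of the minimal network *)

Section Interpolants.
Variables (R : realType) (n : nat) (V : 'I_n -> R * R) (z : 'I_n -> R).
Variables (T : {set {set 'I_n}}) (p : R).
Hypotheses (Vinj : injective V) (triV : triangulation V T) (p1 : 1 < p).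
Implicit Types (e : 'I_n * 'I_n) (s t : R) (F : R * R -> R) (f : network R n).
Local Notation mu := (@lebesgue_measure R).
Local Notation L := (edge_length V).
Local Notation D := (triangulated_domain V T).
Local Notation u := (edge_dir V).

Lemma edge_path_domain e s : e \in edges T -> 0 <= s <= L e -> D (edge_path V e s).
Proof.
move=> eT /andP[s0 sL]; have L0 := edge_length_gt0 Vinj eT.
move: eT; rewrite inE => /andP[_ /existsP[t /and3P[tT e1 e2]]].
exists t => //; apply: hull_edge => //.
by rewrite divr_ge0 ?(ltW L0)//= ler_pdivrMr// mul1r.
Qed.

(** Edges stay in D, so relative differentiability suffices for the chain rule; |u e| + 1 turns
    parameter distance into distance in the plane. *)
Lemma C1_edge_derive F (g : R * R -> R * R) e : e \in edges T ->
  (forall w, D w -> has_gradient_on D F w (g w)) ->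
  forall s, 0 <= s <= L e ->
    rel_derive 0 (L e) (induced_network V F e) s (dot (g (edge_path V e s)) (u e)).
Proof.
move=> eT dF s sL eps eps0.
have C0 : 0 < `|u e| + 1 by rewrite ltr_wpDl.
have e1 : 0 < eps / (`|u e| + 1) by rewrite divr_gt0.
have := dF _ (edge_path_domain eT sL) _ e1.
rewrite near_withinE => /(proj1 (@nbhs_normP R (R * R)%type _ _))[d d0 H].
have d0' : 0 < d by [].
exists (d / (`|u e| + 1)) => [|r rL rs]; first by rewrite divr_gt0.
have dE : edge_path V e r - edge_path V e s = (r - s) *: u e.
  by rewrite !edge_pathE opprD addrACA subrr add0r scalerBl.
have nE : `|edge_path V e r - edge_path V e s| <= `|r - s| * (`|u e| + 1).
  by rewrite dE normrZ ler_wpM2l// lerDl.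
have near_r : `|edge_path V e s - edge_path V e r| < d.
  by rewrite distrC (le_lt_trans nE)// -ltr_pdivlMr.
have := H (edge_path V e r) near_r (edge_path_domain eT rL).
rewrite /induced_network; move: dE nE; set w := edge_path V e s; set w' := edge_path V e r.
move=> dE nE.
have -> : (g w).1 * (w'.1 - w.1) + (g w).2 * (w'.2 - w.2) = dot (g w) (u e) * (r - s).
  rewrite -[w'.1 - w.1]/((w' - w).1) -[w'.2 - w.2]/((w' - w).2) dE.
  by rewrite /dot/= /GRing.scale/=; ring.
move=> h; apply: (le_trans h); have := ler_wpM2l (ltW e1) nE.
by move=> /le_trans; apply; rewrite mulrCA divfK ?gt_eqF// mulrC.
Qed.

Lemma interpolant_edge F : interpolants V z T p F -> exists d : 'I_n -> R * R,
  forall e, e \in edges T -> let f := induced_network V F in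
  [/\ forall s, 0 <= s <= L e -> rel_derive 0 (L e) (f e) s (network_derive V f e s),
      network_derive V f e 0 = dot (d e.1) (u e),
      network_derive V f e (L e) = dot (d e.2) (u e),
      f e 0 = z e.1 & f e (L e) = z e.2].
Proof.
move=> [Fz [g cg dg] _]; exists (fun i => g (V i)) => e eT f.
have L0 := edge_length_gt0 Vinj eT.
have dF := C1_edge_derive eT dg.
have dE s : 0 <= s <= L e -> network_derive V f e s = dot (g (edge_path V e s)) (u e).
  by move=> sL; apply: rel_derive_on => //; exact: dF.
split.
- by move=> s sL; rewrite dE//; exact: dF.
- by rewrite dE ?edge_path0// lexx ltW.
- by rewrite dE ?(edge_path_end Vinj eT)// lexx ltW.
- by rewrite /f /induced_network edge_path0.
- by rewrite /f /induced_network (edge_path_end Vinj eT).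
Qed.

Lemma network_eq_derive2 f f' e s : network_eq V T f f' -> e \in edges T -> 0 <= s <= L e ->
  network_derive2 V f e s = network_derive2 V f' e s.
Proof.
move=> ff' eT sL; apply: eq_derive_on => // r rL; apply: eq_derive_on => // t tL.
exact: ff'.
Qed.

Definition network_energy (k : network R n) := \sum_(e in edges T) energy p (L e) (k e).

Lemma network_norm_energy F f : interpolants V z T p F ->
  network_eq V T f (induced_network V F) ->
  network_norm V T p (network_derive2 V f) =
    (network_energy (network_derive2 V (induced_network V F)) `^ p^-1)%:E.
Proof.
move=> [_ _ FLp] fF; rewrite -poweR_EFin /network_norm /network_energy -sumEFin.
congr (_ `^ _)%E; apply: eq_bigr => e eT; have [_ eLp] := FLp _ eT.
rewrite -(in_Lp_energy eLp); apply: eq_integral => s /set_mem; rewrite /= in_itv/= => sL.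
by rewrite (network_eq_derive2 fF eT sL).
Qed.

Lemma network_energy_ge0 k : 0 <= network_energy k.
Proof. by apply: sumr_ge0 => e _; apply: cint_ge0 => s _; exact: powR_ge0. Qed.

Section optimal_multiplier.
Variables (a b : 'I_n * 'I_n -> R).
Hypothesis balance : forall d : 'I_n -> R * R,
  \sum_(e in edges T) (b e * dot (d e.2) (u e) - a e * dot (d e.1) (u e)) = 0.

Let l e s := a e + (b e - a e) / L e * s.

(** Integration by parts leaves slope terms, which cancel by [balance] with d the vertex gradients
    of F, and value terms, which depend on z only. So all interpolants do the same work against
    l. *)
Lemma interpolant_work F : interpolants V z T p F ->
  let k := network_derive2 V (induced_network V F) in
  (forall e, e \in edges T -> mu.-integrable `[0, L e] (EFin \o (fun s => l e s * k e s))) /\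
  \sum_(e in edges T) cint (L e) (fun s => l e s * k e s) =
    - \sum_(e in edges T) (b e - a e) / L e * (z e.2 - z e.1).
Proof.
move=> FI k; have [d dP] := interpolant_edge FI; have [_ _ FLp] := FI.
have ibp e (eT : e \in edges T) := let: And5 fD _ _ _ _ := dP e eT in
  affine_second_derivative (edge_length_gt0 Vinj eT) fD (FLp e eT).1 (FLp e eT).2.1 (a e) ((b e - a e) / L e).
split; first by move=> e eT; have [] := ibp e eT.
rewrite -sumrN -[RHS]add0r -[X in _ = X + _](balance d) -big_split/=.
apply: eq_bigr => e eT; have [_ d0 dL f0 fL] := dP e eT.
have [_ ->] := ibp e eT; rewrite d0 dL f0 fL.
by field; rewrite gt_eqF// (edge_length_gt0 Vinj eT).
Qed.

End optimal_multiplier.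

Let q := p / (p - 1).

Let q1 : 1 < q.
Proof. by rewrite /q ltr_pdivlMr ?subr_gt0// mul1r gtrBl. Qed.

Let pN : p - 1 != 0.
Proof. by rewrite gt_eqF// subr_gt0. Qed.

Let pq : (q - 1) * (p - 1) = 1.
Proof. by rewrite /q; field. Qed.

Lemma affine_hat (a b len t : R) : len != 0 ->
  a * (1 - t / len) + b * (t / len) = a + (b - a) / len * t.
Proof. by move=> lenN; field. Qed.

(** w e = phi(l e) is integrated twice from the value and slope at e.1; the two moment identities
    say precisely that the value and slope at e.2 come out right. *)
Lemma optimal_interpolant : exists (F : R * R -> R) (a b : 'I_n * 'I_n -> R),
  [/\ interpolants V z T p F,
      forall d : 'I_n -> R * R,
        \sum_(e in edges T) (b e * dot (d e.2) (u e) - a e * dot (d e.1) (u e)) = 0 &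
      forall e s, e \in edges T -> 0 <= s <= L e ->
        network_derive2 V (induced_network V F) e s = spow (q - 1) (a e + (b e - a e) / L e * s)].
Proof.
have [a [b [g [m0 m1 bal]]]] := dual_network z T Vinj q1.
pose l e s := a e + (b e - a e) / L e * s.
pose w e s := spow (q - 1) (l e s).
have lC e : continuous (l e).
  apply: continuousD_fun; first exact: cst_continuous.
  by apply: continuousM_fun; [exact: cst_continuous|move=> ?; exact: cvg_id].
have wC e : continuous (w e) by exact: (spow_comp_continuous q1 (@lC e)).
have ex e : exists fdf : (R -> R) * (R -> R), e \in edges T ->
  [/\ forall s, 0 <= s <= L e -> is_derive s 1 fdf.1 (fdf.2 s),
      forall s, 0 <= s <= L e -> is_derive s 1 fdf.2 (w e s),
      fdf.1 0 = z e.1 /\ fdf.2 0 = dot (g e.1) (u e),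
      fdf.1 (L e) = z e.2 & fdf.2 (L e) = dot (g e.2) (u e)].
  have [eT|eN] := boolP (e \in edges T); last by exists (cst 0, cst 0).
  have L0 := edge_length_gt0 Vinj eT; have LN : L e != 0 by rewrite gt_eqF.
  have [f [df [fD dfD f0 fL dfL]]] := double_antiderivative (z e.1) (dot (g e.1) (u e)) (@wC e) L0.
  exists (f, df) => _.
  have hatC : continuous (fun t : R => t / L e).
    by apply: continuousM_fun; [move=> ?; exact: cvg_id|exact: cst_continuous].
  have hatC' : continuous (fun t : R => 1 - t / L e).
    by apply: continuousB_fun; [exact: cst_continuous|exact: hatC].
  have M0 : cint (L e) (fun t => w e t * (1 - t / L e)) = (z e.2 - z e.1) / L e - dot (g e.1) (u e).
    by rewrite -(m0 e eT); apply: eq_cint => t _; rewrite affine_hat.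
  have M1 : cint (L e) (fun t => w e t * (t / L e)) = dot (g e.2) (u e) - (z e.2 - z e.1) / L e.
    by rewrite -(m1 e eT); apply: eq_cint => t _; rewrite affine_hat.
  split => //=.
    have -> : f (L e) = z e.1 + dot (g e.1) (u e) * L e + L e * cint (L e) (fun t => w e t * (1 - t / L e)).
      rewrite fL -cintZ; first by congr (_ + _); apply: eq_cint => t _; field.
      by apply: continuousM_fun; [exact: wC|exact: hatC'].
    by rewrite M0; field.
  have -> : df (L e) = dot (g e.1) (u e) + (cint (L e) (fun t => w e t * (1 - t / L e)) +
      cint (L e) (fun t => w e t * (t / L e))).
    rewrite dfL -cintD; first by congr (_ + _); apply: eq_cint => t _; ring.
      by apply: continuousM_fun; [exact: wC|exact: hatC'].
    by apply: continuousM_fun; [exact: wC|exact: hatC].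
  by rewrite M0 M1; ring.
have [fdf fdfP] := choice ex.
have dfC e : e \in edges T -> forall s, 0 <= s <= L e -> {for s, continuous (fdf e).2}.
  move=> eT s sL; have [_ /(_ s sL) dfD _ _ _] := fdfP e eT.
  by apply/differentiable_continuous/derivable1_diffP; have [] := dfD.
have [F [C1F Fz Ff]] := @network_extension _ _ V T Vinj triV z g (fun e => (fdf e).1) (fun e => (fdf e).2)
  (fun e eT => let: And5 h _ _ _ _ := fdfP e eT in h) dfC
  (fun e eT => let: And5 _ _ h _ _ := fdfP e eT in h.1)
  (fun e eT => let: And5 _ _ _ h _ := fdfP e eT in h)
  (fun e eT => let: And5 _ _ h _ _ := fdfP e eT in h.2)
  (fun e eT => let: And5 _ _ _ _ h := fdfP e eT in h).
have D1 e s : e \in edges T -> 0 <= s <= L e ->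
    network_derive V (induced_network V F) e s = (fdf e).2 s.
  move=> eT sL; have [fD _ _ _ _] := fdfP e eT.
  have L0 := edge_length_gt0 Vinj eT.
  transitivity (derive_on 0 (L e) (fdf e).1 s).
    by apply: eq_derive_on => // r rL; exact: Ff.
  by apply: (rel_derive_on L0 sL); apply: is_derive_rel; exact: fD.
have D2 e s : e \in edges T -> 0 <= s <= L e ->
    network_derive2 V (induced_network V F) e s = w e s.
  move=> eT sL; have [_ dfD _ _ _] := fdfP e eT.
  have L0 := edge_length_gt0 Vinj eT.
  transitivity (derive_on 0 (L e) (fdf e).2 s).
    by apply: eq_derive_on => // r rL; exact: D1.
  by apply: (rel_derive_on L0 sL); apply: is_derive_rel; exact: dfD.
exists F, a, b; split => //; split => //; first exact: C1_plane_on.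
move=> e eT; have L0 := edge_length_gt0 Vinj eT.
have [_ dfD _ _ _] := fdfP e eT.
split.
  (* A bound on the continuous w e makes the first derivative Lipschitz. *)
  have [M HM] : exists M, forall s, 0 <= s <= L e -> `|w e s| <= M.
    have cw : {within `[0, L e], continuous (w e)} by exact: continuous_subspaceT.
    have /compact_bounded[M [_ HM]] := continuous_compact cw (@segment_compact _ 0 (L e)).
    exists (M + 1) => s sL; apply: (HM (M + 1)); first by rewrite ltrDl.
    by exists s.
  apply: (@ac_of_lipschitz _ _ _ _ M) => x y x0; rewrite le_eqVlt => /predU1P[->|xy] yL.
    by rewrite !subrr normr0 mulr0.
  have xL : 0 <= x <= L e by rewrite x0 (le_trans (ltW xy)).
  have yL' : 0 <= y <= L e by rewrite yL (le_trans x0 (ltW xy)).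
  rewrite !D1//.
  have [c /andP[xc cy] ->] := @rel_derive_mvt _ 0 (L e) (fdf e).2 (w e) L0
    (fun s sL => is_derive_rel 0 (L e) (dfD s sL)) x y x0 xy yL.
  rewrite normrM [`|y - x|]gtr0_norm ?subr_gt0// ler_wpM2r ?subr_ge0 ?(ltW xy)//.
  by apply: HM; rewrite (le_trans x0 (ltW xc)) (le_trans (ltW cy) yL).
have eqw : {in `[0, L e]%classic, network_derive2 V (induced_network V F) e =1 w e}.
  by move=> s /set_mem; rewrite /= in_itv/= => sL; exact: D2.
split.
  apply: (@eq_measurable_fun _ _ _ _ _ (w e)); first by move=> s sI; rewrite eqw.
  by apply: measurable_funTS; exact: continuous_measurable_fun.
have -> : (\int[mu]_(s in `[0%R, L e]) (`|network_derive2 V (induced_network V F) e s| `^ p)%:E =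
   \int[mu]_(s in `[0%R, L e]) (`|w e s| `^ p)%:E)%E.
  by apply: eq_integral => s sI; rewrite eqw.
have : mu.-integrable `[0, L e] (EFin \o (fun s => `|w e s| `^ p)).
  by apply: continuous_integrable_itv; exact: (powR_norm_continuous p1 (@wC e)).
move=> /integrableP[_]; apply: le_lt_trans.
rewrite le_eqVlt; apply/orP; left; apply/eqP; apply: eq_integral => s _.
by rewrite /= [`|_ `^ _|]ger0_norm ?powR_ge0.
Qed.

(** f1 - f2 has constant derivative c; vanishing at both ends forces c = 0. *)
Lemma primitive_unique len (f1 f2 d1 d2 : R -> R) : 0 < len ->
  (forall s, 0 <= s <= len -> rel_derive 0 len f1 s (d1 s)) ->
  (forall s, 0 <= s <= len -> rel_derive 0 len f2 s (d2 s)) ->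
  (forall s, 0 <= s <= len -> d1 s - d1 0 = d2 s - d2 0) ->
  f1 0 = f2 0 -> f1 len = f2 len -> forall s, 0 <= s <= len -> f1 s = f2 s.
Proof.
move=> len0 D1 D2 d12 f0 fL.
pose c := d1 0 - d2 0.
have Dw s : 0 <= s <= len -> rel_derive 0 len (fun s => f1 s - f2 s) s c.
  move=> sL e e0; have e2 : 0 < e / 2 by rewrite divr_gt0.
  have [r1 r10 H1] := D1 s sL _ e2; have [r2 r20 H2] := D2 s sL _ e2.
  exists (Num.min r1 r2) => [|r rL]; first by rewrite lt_min r10.
  rewrite lt_min => /andP[h1 h2].
  have -> : f1 r - f2 r - (f1 s - f2 s) - c * (r - s) =
    (f1 r - f1 s - d1 s * (r - s)) - (f2 r - f2 s - d2 s * (r - s)).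
    have -> : d1 s = d2 s + c by rewrite /c; have := d12 s sL; lra.
    by ring.
  apply: (le_trans (ler_normB _ _)); apply: (le_trans (lerD (H1 _ rL h1) (H2 _ rL h2))).
  by rewrite -mulrDl -splitr.
have c0 : c = 0.
  have [x _ /eqP] := rel_derive_mvt len0 Dw (lexx 0) len0 (lexx len).
  rewrite f0 fL !subrr subr0 eq_sym mulf_eq0 (gt_eqF len0) orbF => /eqP //.
move=> s /andP[s0 sL]; move: s0; rewrite le_eqVlt => /predU1P[<-//|s0].
have [x _] := rel_derive_mvt len0 Dw (lexx 0) s0 sL.
by rewrite c0 mul0r f0 subrr subr0 => /eqP; rewrite subr_eq0 => /eqP.
Qed.

Theorem minimal_network : exists2 Fs : network R n, extremal_solution V z T p Fs &
  forall G : network R n, extremal_solution V z T p G -> network_eq V T G Fs.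
Proof.
have [F [a [b [FI bal F2]]]] := optimal_interpolant.
have [Fwi Fw] := interpolant_work bal FI.
pose kF := network_derive2 V (induced_network V F).
have p0 : 0 < p by rewrite (lt_trans _ p1).
have p0' : 0 < p^-1 by rewrite invr_gt0.
pose l e s := a e + (b e - a e) / L e * s.
have lC e : continuous (l e).
  apply: continuousD_fun; first exact: cst_continuous.
  by apply: continuousM_fun; [exact: cst_continuous|move=> ?; exact: cvg_id].
have gapP G : interpolants V z T p G ->
    let k := network_derive2 V (induced_network V G) in
    [/\ network_energy kF <= network_energy k &
      network_energy k <= network_energy kF -> forall e, e \in edges T ->
        {ae mu, forall s, `[0, L e]%classic s -> k e s = kF e s}].
  move=> GI k; have [Gwi Gw] := interpolant_work bal GI.
  have [_ _ GLp] := GI.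
  pose w e s := spow (q - 1) (l e s).
  pose gap e := energy p (L e) (k e) - energy p (L e) (w e)
    - p * (cint (L e) (fun s => l e s * k e s) - cint (L e) (fun s => l e s * w e s)).
  have gap0 e : e \in edges T -> 0 <= gap e.
    by move=> eT; apply: energy_gap_ge0 => //; [exact: (GLp e eT).2|exact: Gwi].
  have kFw e s : e \in edges T -> 0 <= s <= L e -> kF e s = w e s by exact: F2.
  (* Summed over the edges, the work terms cancel by [interpolant_work]; on a single edge they need
     not. *)
  have sumgap : \sum_(e in edges T) gap e = network_energy k - network_energy kF.
    rewrite /gap !sumrB -mulr_sumr sumrB Gw.
    have -> : \sum_(e in edges T) cint (L e) (fun s => l e s * w e s) =
      \sum_(e in edges T) cint (L e) (fun s => l e s * kF e s).
      by apply: eq_bigr => e eT; apply: eq_cint => s sL; rewrite kFw.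
    have -> : \sum_(e in edges T) energy p (L e) (w e) = network_energy kF.
      by apply: eq_bigr => e eT; apply: eq_cint => s sL; rewrite kFw.
    by rewrite Fw [X in p * X]subrr mulr0 subr0.
  split; first by rewrite -subr_ge0 -sumgap sumr_ge0.
  move=> le e eT.
  (* Nonnegative gaps with sum at most 0 all vanish, which is the equality case of the tangent
     inequality. *)
  have gapz : gap e = 0.
    have /eqP : \sum_(e in edges T) gap e = 0.
      apply/eqP; rewrite eq_le sumr_ge0// andbT sumgap subr_le0//.
    rewrite psumr_eq0// => /allP /(_ e); rewrite mem_index_enum => /(_ isT).
    by rewrite eT => /eqP.
  have := @energy_gap_eq0 _ p q (L e) (k e) (l e) p1 q1 pq (GLp e eT).2 (@lC e) (Gwi e eT) gapz.
  apply: aeS => s H sI; rewrite H// kFw//.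
have FnormE : network_norm V T p kF = (network_energy kF `^ p^-1)%:E.
  exact: (network_norm_energy FI (fun _ _ _ _ => erefl)).
exists (induced_network V F).
  split; first by exists F.
  apply/eqP; rewrite eq_le; apply/andP; split; last first.
    by apply: ereal_inf_lbound; exists (induced_network V F) => //; exists F.
  apply: le_ereal_inf_tmp => _ [G [G' G'I GG'] <-].
  rewrite FnormE (network_norm_energy G'I GG') lee_fin.
  apply: ge0_ler_powR; first exact: ltW.
  - by rewrite nnegrE network_energy_ge0.
  - by rewrite nnegrE network_energy_ge0.
  by have [] := gapP _ G'I.
move=> G [[G' G'I GG'] Gnorm] e eT s sL.
have le : network_energy (network_derive2 V (induced_network V G')) <= network_energy kF.
  have : (network_norm V T p (network_derive2 V G) <= network_norm V T p kF)%E.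
    by rewrite Gnorm; apply: ereal_inf_lbound; exists (induced_network V F) => //; exists F.
  rewrite (network_norm_energy G'I GG') FnormE lee_fin => h.
  rewrite leNgt; apply/negP => lt.
  have : network_energy kF `^ p^-1 <
      network_energy (network_derive2 V (induced_network V G')) `^ p^-1.
    by apply: (gt0_ltr_powR p0'); [rewrite nnegrE network_energy_ge0|
      rewrite nnegrE network_energy_ge0|exact: lt].
  by rewrite ltNge h.
have [_ /(_ le e eT) ae] := gapP _ G'I.
have L0 := edge_length_gt0 Vinj eT.
rewrite GG'//.
have [dG dGP] := interpolant_edge G'I; have [dF dFP] := interpolant_edge FI.
have [Grel _ _ G0 GL] := dGP e eT; have [Frel _ _ F0 FL] := dFP e eT.
have [_ _ /(_ e eT)[acG _]] := G'I; have [_ _ /(_ e eT)[acF _]] := FI.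
(* Second derivatives equal almost everywhere give slopes equal up to a constant; the common vertex
   values remove it. *)
apply: (primitive_unique L0 Grel Frel _ _ _ sL).
- exact: (ac_derivative_unique L0 acG acF ae).
- by rewrite G0 F0.
- by rewrite GL FL.
Qed.

End Interpolants.

Theorem theorem1 (R : realType) (n : nat) (V : 'I_n -> R * R)
  (z : 'I_n -> R) (T : {set {set 'I_n}}) (p : R) :
  (3 <= n)%N ->
  injective V ->
  ~ collinear V [set: 'I_n]%SET ->
  triangulation V T ->
  1 < p ->
  exists2 Fs : network R n,
    extremal_solution V z T p Fs &
    forall G : network R n,
      extremal_solution V z T p G -> network_eq V T G Fs.
Proof. by move=> _ Vinj _ triV p1; exact: minimal_network. Qed.
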